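(* Let $\alpha\in(0,2]$ and let $X$ be a real random variable with $\mathbb E X^2=\infty$ such that, as $x\to\infty$, \[ \mathbb P(X>x)=(p+o(1))\,\ell(x)\,x^{-\alpha},\qquad \mathbb P(X\le -x)=(q+o(1))\,\ell(x)\,x^{-\alpha}, \] where $\ell:[0,\infty)\to(0,\infty)$ is continuous and slowly varying and $p,q\ge 0$ with $p+q>0$. Let $S_n=X_1+\dots+X_n$ where the $X_i$ are independent copies of $X$, and let $\tilde\ell$, $a_n$, $b_n$ be as defined in the context. Then for every $h>0$ there is a constant $C>0$ such that \[ \mathbb P\big(S_n-b_n\in(x-h,x+h]\big)\le C\,\frac{n}{a_n}\,\frac{\tilde\ell(|x|)}{1+|x|^\alpha}\qquad\text{for all } n\ge 1,\ x\in\mathbb R. \] In particular, in the lattice case where $X$ is supported on $\mathbb Z$, there is a constant $C>0$ such that \[ \mathbb P\big(S_n-[b_n]=N\big)\le C\,\frac{n}{a_n}\,\frac{\tilde\ell(|N|)}{1+|N|^\alpha}\qquad\text{for all } n\ge 1,\ N\in\mathbb Z. \]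
   Context: Set $\tilde\ell=\ell$ if $\alpha\in(0,2)$, and $\tilde\ell(x)=1+\int_1^{1+x}\frac{\ell(u)}{u}\,du$ if $\alpha=2$. The sequence $a_n>0$ satisfies $\lim_{n\to\infty} n\tilde\ell(a_n)/a_n^{\alpha}=1$. The sequence $b_n$ is defined by $b_n=0$ if $\alpha\in(0,1)$; $b_n=n\,\mathbb E(X1_{\{|X|\le a_n\}})$ if $\alpha=1$; $b_n=n\,\mathbb E X$ if $\alpha\in(1,2]$. $[b_n]$ denotes the integer part of $b_n$. Continuity of $\ell$ is assumed in the paper without loss of generality. *)

(* Defs.v *)
From HB Require Import structures.
From mathcomp Require Import all_boot all_order all_algebra finmap.
From mathcomp Require Import all_classical all_reals all_analysis.

Set Implicit Arguments.
Unset Strict Implicit.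
Unset Printing Implicit Defensive.
Import Order.TTheory GRing.Theory Num.Theory.
Import numFieldNormedType.Exports.
Local Open Scope classical_set_scope.
Local Open Scope ring_scope.

Definition slowly_varying (R : realType) (ell : R -> R) : Prop :=
  forall c : R, 0 < c -> ell (c * x) / ell x @[x --> +oo] --> (1 : R).

(* F x = (c + o(1)) * g x as x --> +oo *)
Definition asymp_cst (R : realType) (F : R -> R) (c : R) (g : R -> R) : Prop :=
  exists eps : R -> R,
    (eps x @[x --> +oo] --> (0 : R)) /\
    (\forall x \near +oo, F x = (c + eps x) * g x).

Definition mutually_independent (d : measure_display) (T : measurableType d)
    (R : realType) (P : probability T R) (X : nat -> {RV P >-> R}) : Prop :=
  forall (J : {fset nat}) (B : nat -> set R),
    (forall i, measurable (B i)) ->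
    P (\bigcap_(i in [set` J]) (X i @^-1` B i)) =
      (\prod_(i <- J) P (X i @^-1` B i))%E.

(* Both sides of the equality are only meaningful on measurable sets, so the
   laws are not compared as functions on set R. *)
Definition same_law (d : measure_display) (T : measurableType d)
    (R : realType) (P : probability T R) (X Y : {RV P >-> R}) : Prop :=
  forall B : set R, measurable B -> distribution P X B = distribution P Y B.

Definition independent_copies (d : measure_display) (T : measurableType d)
    (R : realType) (P : probability T R) (X : {RV P >-> R})
    (Xs : nat -> {RV P >-> R}) : Prop :=
  mutually_independent Xs /\ forall i, same_law (Xs i) X.

(* The independent copies X_1, X_2, ... are indexed from 0:
   S_n = Xs 0 + ... + Xs (n - 1). *)
Definition partial_sum (T : Type) (R : realType) (Xs : nat -> T -> R)
    (n : nat) (w : T) : R := \sum_(i < n) Xs i w.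

(* Only used at x >= 0. *)
Definition tilde_ell (R : realType) (alpha : R) (ell : R -> R) (x : R) : R :=
  if alpha == 2 then
    1 + \int[@lebesgue_measure R]_(u in `[1, 1 + x]) (ell u / u)
  else ell x.

(* For 0 < alpha <= 2. The expectations are finite in the cases where they
   are used, so fine loses nothing. *)
Definition centering (d : measure_display) (T : measurableType d)
    (R : realType) (P : probability T R) (X : {RV P >-> R})
    (alpha : R) (a : nat -> R) (n : nat) : R :=
  if alpha < 1 then 0
  else if alpha == 1 then
    n%:R * fine 'E_P[fun w => X w * \1_[set v | `|X v| <= a n] w]
  else n%:R * fine 'E_P[X].

(* Main.v *)
Require Import Defs.
From HB Require Import structures.
From mathcomp Require Import all_boot all_order all_algebra finmap.
From mathcomp Require Import all_classical all_reals all_analysis.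
From mathcomp Require Import measurable_realfun.
From mathcomp Require Import zify ring lra.

Set Implicit Arguments.
Unset Strict Implicit.
Unset Printing Implicit Defensive.
Import Order.TTheory GRing.Theory Num.Theory.
Import numFieldNormedType.Exports.
Local Open Scope classical_set_scope.
Local Open Scope ring_scope.

(** Write [tail x] for the probability that [X] leaves the window from [- x] to
    [x], and [conc2 x] for the expectation of the minimum of [1] and
    [X ^+ 2 / x ^+ 2]. The whole estimate is expressed through [conc2], which
    is monotone and treats all exponents at once.

    Comparison. Since [tail] is monotone and [tail (2 * x) / tail x] tends to
    [2 `^ (- alpha)], it suffices to follow inequalities along doublings of
    [x]. This gives that [conc2 x] and [tilde_ell x / x `^ alpha] are comparable
    at infinity ([conc2_comparable]), hence that [n * conc2 (a n)] stays
    between two positive constants ([norming_conc2]), and that [conc2] shrinks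
    by a fixed factor at each doubling ([conc2_contract]).

    Local bound. Let [phi] be the characteristic function of [X]. A Fejer
    kernel on the grid of mesh [1 / a n] bounds the concentration of [S_k] at
    scale [h] by the average of [phi ^+ k], in modulus, over about [a n] grid
    points ([concentration]). Symmetrisation shows that the squared modulus of
    [phi] at [1 / x] is at most [1 - c * conc2 x] ([char2_gap]). For [k] of the
    order of [n] the [j]-th grid value is therefore at most
    [exp (- c * k * conc2 (a n / j))], which decays like [1 / j ^ 2], and the
    concentration is at most [C / a n] ([local_bound]).

    Deviations. Truncating the steps at level [x] and using Chebyshev's
    inequality, a walk of at most [n] steps deviates from its centre by
    [x / 3] with probability at most [37 * n * conc2 x], provided that
    truncation moves the centre by at most [x / 6] ([deviation_bound]). For
    [x] beyond a large multiple of [a n] the latter holds for each of the three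
    choices of centring ([bias_bound]).

    Conclusion. If [S_n] is far from its centre, so is one of its two halves,
    and given that half the other one still has to hit an interval of length
    [2 * h]. The two costs multiply ([halves_bound]) and give
    [C * (n / a n) * conc2 x]. For [x] at most a multiple of [a n] the local
    bound alone is enough, because [n * conc2 x] is then bounded below. *)

(** * Expectations of bounded measurable functions *)

(** Integrability is automatic for such functions; unbounded moments are reached
    through truncation. *)
Definition bounded_measurable d (T : measurableType d) (R : realType)
    (f : T -> R) : Prop :=
  measurable_fun setT f /\ exists M : R, forall w, `|f w| <= M.

Section BoundedMeasurable.
Context d (T : measurableType d) (R : realType).
Implicit Types f g : T -> R.

Lemma bmeas_cst (c : R) : bounded_measurable (fun _ : T => c).
Proof. by split; [exact: measurable_cst|exists `|c|]. Qed.

Lemma bmeas_add f g : bounded_measurable f -> bounded_measurable g ->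
  bounded_measurable (fun w => f w + g w).
Proof.
move=> [mf [M fM]] [mg [N gN]]; split; first exact: measurable_funD.
by exists (M + N) => w; rewrite (le_trans (ler_normD _ _))// lerD.
Qed.

Lemma bmeas_opp f : bounded_measurable f -> bounded_measurable (fun w => - f w).
Proof.
move=> [mf [M fM]]; split; first exact: measurableT_comp.
by exists M => w; rewrite normrN.
Qed.

Lemma bmeas_sub f g : bounded_measurable f -> bounded_measurable g ->
  bounded_measurable (fun w => f w - g w).
Proof. by move=> bf /bmeas_opp; exact: bmeas_add. Qed.

Lemma bmeas_mul f g : bounded_measurable f -> bounded_measurable g ->
  bounded_measurable (fun w => f w * g w).
Proof.
move=> [mf [M fM]] [mg [N gN]]; split; first exact: measurable_funM.
by exists (M * N) => w; rewrite normrM ler_pM.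
Qed.

Lemma bmeas_sum (I : Type) (r : seq I) (Q : pred I) (f : I -> T -> R) :
  (forall i, bounded_measurable (f i)) ->
  bounded_measurable (fun w => \sum_(i <- r | Q i) f i w).
Proof.
move=> bf; elim: r => [|i r IH].
  rewrite (_ : (fun _ => _) = cst 0); first exact: bmeas_cst.
  by apply/funext => w; rewrite big_nil.
rewrite (_ : (fun _ => _) = (fun w =>
    (if Q i then f i w else 0) + \sum_(j <- r | Q j) f j w)); last first.
  by apply/funext => w; rewrite big_cons; case: ifP => // _; rewrite add0r.
apply: bmeas_add => //; case: (Q i) => //; exact: bmeas_cst.
Qed.

Lemma bmeas_indic (A : set T) : measurable A ->
  bounded_measurable (\1_A : T -> R).
Proof.
move=> mA; split; first exact: measurable_indic.
by exists 1 => w; rewrite indicE; case: (_ \in _); rewrite ?normr1// normr0.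
Qed.

Lemma bmeas_sqr f : bounded_measurable f ->
  bounded_measurable (fun w => f w ^+ 2).
Proof.
by move=> bf; under eq_fun do rewrite expr2; exact: bmeas_mul.
Qed.

End BoundedMeasurable.

Lemma bmeas_comp d (T : measurableType d) (R : realType) (U : T -> R)
    (f : R -> R) :
  measurable_fun setT U -> bounded_measurable f ->
  bounded_measurable (fun w => f (U w)).
Proof.
move=> mU [mf [M fM]]; split; first exact: measurableT_comp.
by exists M => w.
Qed.

Section ExpectationBounded.
Context d (T : measurableType d) (R : realType) (P : probability T R).
Implicit Types f g : T -> R.

Lemma bmeas_integrable f : bounded_measurable f ->
  P.-integrable setT (EFin \o f).
Proof.
move=> [mf [M fM]]; apply: measurable_bounded_integrable => //.
  by rewrite (le_lt_trans (probability_le1 P measurableT))// ltry.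
exists M; split; first by rewrite num_real.
by move=> x Mx w _ /=; rewrite (le_trans (fM w))// ltW.
Qed.

Definition Ex f : R := \int[P]_w f w.

Lemma Ex_add f g : bounded_measurable f -> bounded_measurable g ->
  Ex (fun w => f w + g w) = Ex f + Ex g.
Proof. by move=> bf bg; apply: RintegralD => //; exact: bmeas_integrable. Qed.

Lemma Ex_sub f g : bounded_measurable f -> bounded_measurable g ->
  Ex (fun w => f w - g w) = Ex f - Ex g.
Proof. by move=> bf bg; apply: RintegralB => //; exact: bmeas_integrable. Qed.

Lemma Ex_scale (c : R) f : bounded_measurable f ->
  Ex (fun w => c * f w) = c * Ex f.
Proof. by move=> bf; apply: RintegralZl => //; exact: bmeas_integrable. Qed.

Lemma Ex_cst (c : R) : Ex (fun _ => c) = c.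
Proof. rewrite /Ex Rintegral_cst//.
have -> : fine (P setT) = 1 by rewrite probability_setT.
by rewrite mulr1. Qed.

Lemma Ex_le f g : bounded_measurable f -> bounded_measurable g ->
  (forall w, f w <= g w) -> Ex f <= Ex g.
Proof.
move=> bf bg fg; apply: le_Rintegral => //; exact: bmeas_integrable.
Qed.

Lemma normr_Ex_le f g : bounded_measurable f -> bounded_measurable g ->
  (forall w, `|f w| <= g w) -> `|Ex f| <= Ex g.
Proof.
move=> bf bg fg; rewrite ler_norml; apply/andP; split; last first.
  by apply: Ex_le => // w; rewrite (le_trans (ler_norm _)).
rewrite -mulN1r -Ex_scale//; apply: Ex_le => // [|w].
  by apply: bmeas_mul => //; exact: bmeas_cst.
by rewrite mulN1r lerNl (le_trans _ (fg w))// -normrN ler_norm.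
Qed.

Lemma Ex_ge0 f : (forall w, 0 <= f w) -> 0 <= Ex f.
Proof. by move=> f0; apply: Rintegral_ge0. Qed.

Lemma Ex_sum (I : Type) (r : seq I) (f : I -> T -> R) :
  (forall i, bounded_measurable (f i)) ->
  Ex (fun w => \sum_(i <- r) f i w) = \sum_(i <- r) Ex (f i).
Proof.
move=> bf; elim: r => [|i r IH].
  under [in LHS]eq_fun do rewrite big_nil.
  by rewrite big_nil Ex_cst.
under [in LHS]eq_fun do rewrite big_cons.
by rewrite big_cons -IH; apply: Ex_add => //; exact: bmeas_sum.
Qed.

Lemma Ex_indic (A : set T) : measurable A -> Ex (\1_A) = fine (P A).
Proof.
by move=> mA; rewrite /Ex /Rintegral integral_indic// setIT.
Qed.

Lemma prob_fine_le1 (A : set T) : measurable A -> fine (P A) <= 1.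
Proof.
by move=> mA; rewrite -lee_fin fineK ?fin_num_measure// probability_le1.
Qed.

End ExpectationBounded.

(** * Independence of two random variables *)

Section Independence.
Context d (T : measurableType d) (R : realType) (P : probability T R).
Local Open Scope ereal_scope.

Definition joint (U V : {RV P >-> R}) (w : T) : R * R := (U w, V w).

Lemma measurable_joint (U V : {RV P >-> R}) :
  measurable_fun setT (joint U V).
Proof. by apply: measurable_fun_pair; exact: measurable_funPT. Qed.

HB.instance Definition _ (U V : {RV P >-> R}) :=
  isMeasurableFun.Build _ _ _ _ (joint U V) (measurable_joint U V).

(** The two sides are finite measures in [E] that agree on rectangles, and
    rectangles are stable under intersection and generate the product
    sigma-algebra. *)
Lemma joint_extension (U V : {RV P >-> R}) (C : set T) (mC : measurable C) :
  (forall A B, measurable A -> measurable B ->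
     P (U @^-1` A `&` V @^-1` B) = P (U @^-1` A) * P (V @^-1` B)) ->
  (forall A B, measurable A -> measurable B ->
     P (U @^-1` A `&` V @^-1` B `&` C)
       = P (U @^-1` A) * P (V @^-1` B) * P C) ->
  forall E, measurable E ->
    P (joint U V @^-1` E `&` C) = P (joint U V @^-1` E) * P C.
Proof.
move=> UV H E mE.
have PC0 : (0 <= fine (P C))%R by exact: fine_ge0.
have PCE : P C = (fine (P C))%:E by rewrite fineK// fin_num_measure.
pose m1 := pushforward (mrestr P mC) (joint U V).
pose m2 := mscale (NngNum PC0) (distribution P (joint U V)).
have m2E A : m2 A = P (joint U V @^-1` A) * P C.
  by rewrite /m2 /mscale /= -PCE muleC.
rewrite -m2E -[LHS]/(m1 E).
pose G : set (set (R * R)) :=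
  [set C | exists A, measurable A /\ exists B, measurable B /\ C = A `*` B].
have rect A B : joint U V @^-1` (A `*` B) = U @^-1` A `&` V @^-1` B by [].
apply: (measure_unique G (fun _ => setT)) => //.
- rewrite measurable_prod_measurableType //; congr (<<s _ >>).
  rewrite predeqE; split => [[A mA [B mB <-]]|[A [mA [B [mB ->]]]]].
    by exists A; split => //; exists B.
  by exists A => //; exists B.
- move=> _ _ [X1 [mX1 [X2 [mX2 ->]]]] [Y1 [mY1 [Y2 [mY2 ->]]]].
  rewrite -setXI; exists (X1 `&` Y1); split; first exact: measurableI.
  by exists (X2 `&` Y2); split => //; exact: measurableI.
- by move=> n; exists setT; split => //; exists setT; split => //; rewrite setXTT.
- by rewrite bigcup_const.
- by move=> _ [A [mA [B [mB ->]]]]; rewrite [RHS]m2E rect UV// -H//; exact: erefl.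
- move=> _; rewrite -[X in (X < _)%E]/(P (joint U V @^-1` setT `&` C)).
  by rewrite preimage_setT setTI PCE ltry.
Qed.

Lemma measurable_preimage (U : {RV P >-> R}) (A : set R) :
  measurable A -> measurable (U @^-1` A).
Proof.
by move=> mA; rewrite -[X in measurable X]setTI; exact: measurable_funPT.
Qed.

(** The event [U + V \in B] is one about the pair, to which
    [joint_extension] applies. Adding one step at a time, this yields the
    independence of disjoint blocks of a random walk. *)
Lemma sum_indep (U V : {RV P >-> R}) (C : set T) (mC : measurable C) :
  (forall A B, measurable A -> measurable B ->
     P (U @^-1` A `&` V @^-1` B) = P (U @^-1` A) * P (V @^-1` B)) ->
  (forall A B, measurable A -> measurable B ->
     P (U @^-1` A `&` V @^-1` B `&` C)
       = P (U @^-1` A) * P (V @^-1` B) * P C) ->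
  forall B, measurable B ->
    P ((fun w => U w + V w)%R @^-1` B `&` C)
      = P ((fun w => U w + V w)%R @^-1` B) * P C.
Proof.
move=> UV UVC B mB.
have mE : measurable [set x : R * R | B (x.1 + x.2)%R].
  rewrite -[X in measurable X]setTI.
  have : measurable_fun setT (fun x : R * R => x.1 + x.2)%R.
    by apply: measurable_funD; [exact: measurable_fst|exact: measurable_snd].
  by move=> /(_ measurableT B mB).
exact: (joint_extension mC UV UVC mE).
Qed.

Definition indep2 (U V : {RV P >-> R}) : Prop :=
  forall A B, measurable A -> measurable B ->
     P (U @^-1` A `&` V @^-1` B) = P (U @^-1` A) * P (V @^-1` B).

Lemma joint_product (U V : {RV P >-> R}) : indep2 U V ->
  forall E, measurable E ->
    P (joint U V @^-1` E) = (distribution P U \x distribution P V) E.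
Proof.
move=> UV E mE; apply/esym.
by rewrite (@product_measure_unique _ _ _ _ _ (distribution P U)
  (distribution P V) (distribution P (joint U V))).
Qed.

(** Conditioning on [U] freezes the first coordinate of the joint law, so a
    bound on the law of [V] in the sections survives with the factor
    [P (U \in D)]. *)
Lemma joint_section_bound (U V : {RV P >-> R}) (D : set R) (E : set (R * R))
    (q : R) : indep2 U V -> measurable D -> measurable E ->
  (forall u, P (V @^-1` xsection E u) <= q%:E) ->
  P (joint U V @^-1` E `&` U @^-1` D) <= q%:E * P (U @^-1` D).
Proof.
move=> UV mD mE Eq.
have -> : joint U V @^-1` E `&` U @^-1` D
    = joint U V @^-1` (E `&` D `*` setT).
  by rewrite predeqE => w; split => [[]|[? []]].
have mED : measurable (E `&` D `*` setT).
  by apply: measurableI => //; exact: measurableX.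
have q0 : 0 <= q%:E by exact: le_trans (Eq 0%R).
rewrite joint_product//.
apply: (@le_trans _ _ (\int[distribution P U]_u (q * \1_D u)%:E)).
  apply: ge0_le_integral => //.
  - exact: measurable_fun_xsection.
  - apply/measurable_EFinP; apply: measurable_funM => //.
  - move=> u _; rewrite indicE; have [uD|uD] := boolP (u \in D).
      rewrite mulr1; apply: le_trans (Eq u).
      rewrite /distribution /pushforward/= le_measure// ?inE.
      + by apply: measurable_preimage; exact: measurable_xsection.
      + by apply: measurable_preimage; exact: measurable_xsection.
      + by move=> w; rewrite /xsection/= !inE => -[].
    rewrite mulr0 [X in X <= _](_ : _ = 0)//= (_ : xsection _ u = set0) ?measure0//.
    rewrite -subset0 => v; rewrite /xsection/= inE => -[_ []]/= Du _.
    by move: uD; rewrite notin_setE; apply.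
under eq_integral do rewrite EFinM.
rewrite ge0_integralZl//; last by apply/measurable_EFinP; exact: measurable_indic.
by rewrite integral_indic// setIT.
Qed.

Lemma Ex_indep (U V : {RV P >-> R}) (f g : R -> R) : indep2 U V ->
  bounded_measurable f -> bounded_measurable g ->
  Ex P (fun w => f (U w) * g (V w))%R
    = (Ex P (fun w => f (U w)) * Ex P (fun w => g (V w)))%R.
Proof.
move=> UV bf bg.
have bfU : bounded_measurable (fun w => f (U w)).
  by apply: bmeas_comp => //; exact: measurable_funPT.
have bgV : bounded_measurable (fun w => g (V w)).
  by apply: bmeas_comp => //; exact: measurable_funPT.
pose F := fun x : R * R => (f x.1 * g x.2)%:E.
have bF : bounded_measurable (fun x : R * R => f x.1 * g x.2)%R.
  apply: bmeas_mul; apply: bmeas_comp => //.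
have mF : measurable_fun setT F by apply/measurable_EFinP; case: bF.
have iUV : P.-integrable setT (F \o joint U V).
  apply: (bmeas_integrable P (f := fun w => (f (U w) * g (V w))%R)).
  exact: bmeas_mul.
pose m1 := distribution P U; pose m2 := distribution P V.
have iF : (m1 \x m2).-integrable setT F.
  apply: (@measurable_bounded_integrable _ _ _ (m1 \x m2)
    (fun x => f x.1 * g x.2)%R) => //.
  - rewrite -setXTT [X in X < _]product_measure1E//.
    apply: lte_mul_pinfty => //; first exact: (fin_num_measure m1).
    by apply: (le_lt_trans (probability_le1 m2 measurableT)); rewrite ltry.
  - by case: bF.
  - case: bF => _ [M FM]; exists M; split; first by rewrite num_real.
    by move=> x Mx w _ /=; rewrite (le_trans (FM w))// ltW.
have EfE : (Ex P (fun w => f (U w)))%:E = \int[m1]_x (f x)%:E.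
  rewrite integral_distribution//; last first.
  - exact: (bmeas_integrable P bfU).
  - by apply/measurable_EFinP; case: bf.
  by rewrite fineK//; apply: integrable_fin_num => //; exact: bmeas_integrable.
have EgE : (Ex P (fun w => g (V w)))%:E = \int[m2]_x (g x)%:E.
  rewrite integral_distribution//; last first.
  - exact: (bmeas_integrable P bgV).
  - by apply/measurable_EFinP; case: bg.
  by rewrite fineK//; apply: integrable_fin_num => //; exact: bmeas_integrable.
apply: EFin_inj; rewrite EFinM.
transitivity (\int[distribution P (joint U V)]_x F x).
  rewrite integral_distribution// fineK//.
  exact: integrable_fin_num.
rewrite (@eq_measure_integral _ _ _ _ (m1 \x m2)); last first.
  by move=> A mA _; exact: (joint_product UV mA).
rewrite -integral12_prod_meas1//.
transitivity (\int[m1]_x ((Ex P (fun w => g (V w)))%:E * (f x)%:E)).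
  apply: eq_integral => x _; rewrite EgE muleC.
  rewrite -integralZl//; last exact: (bmeas_integrable m2 bg).
by rewrite integralZl ?EfE 1?muleC//; exact: (bmeas_integrable m1 bf).
Qed.

End Independence.

Arguments indep2 {d T R} P U V.

(** * Blocks of a random walk *)

Section Walk.
Context d (T : measurableType d) (R : realType) (P : probability T R).
Variable Xs : nat -> {RV P >-> R}.

(** Partial sums with an offset, so that both halves of a walk have the same
    form. *)
Definition walk (m k : nat) (w : T) : R := \sum_(i < k) Xs (m + i)%N w.

Lemma measurable_walk m k : measurable_fun setT (walk m k).
Proof. by apply: measurable_sum => i; exact: measurable_funPT. Qed.

HB.instance Definition _ m k :=
  isMeasurableFun.Build _ _ _ _ (walk m k) (measurable_walk m k).

Lemma walkS m k : walk m k.+1 = (fun w => walk m k w + Xs (m + k)%N w).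
Proof. by apply/funext => w; rewrite /walk big_ord_recr. Qed.

Lemma walk_cat k l w : walk 0 (k + l) w = walk 0 k w + walk k l w.
Proof. by rewrite /walk big_split_ord. Qed.

Definition cylinder (m N : nat) (B : nat -> set R) : set T :=
  [set w | forall i, (m <= i < N)%N -> B i (Xs i w)].

Lemma cylinder_recl m N B : (m < N)%N ->
  cylinder m N B = Xs m @^-1` B m `&` cylinder m.+1 N B.
Proof.
move=> mN; rewrite predeqE => w; split=> [H|[Hm H] i /andP[mi iN]].
  split; first by apply: H; rewrite leqnn.
  by move=> i /andP[mi iN]; apply: H; rewrite (ltnW mi).
move: mi; rewrite leq_eqVlt => /predU1P[<-//|mi].
by apply: H; rewrite mi.
Qed.

Lemma measurable_cylinder m N B : (forall i, measurable (B i)) ->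
  measurable (cylinder m N B).
Proof.
move=> mB; have [mN|Nm] := leqP m N; last first.
  rewrite (_ : cylinder m N B = setT)// predeqE => w; split=> // _ i.
  by move=> /andP[mi iN]; move: (leq_ltn_trans mi iN); rewrite ltnNge ltnW.
rewrite -(subnKC mN); move: (N - m)%N => k {mN}; elim: k m => [|k IH] m.
  rewrite addn0 (_ : cylinder m m B = setT)// predeqE => w; split=> // _ i.
  by case/andP=> mi /(leq_ltn_trans mi); rewrite ltnn.
rewrite cylinder_recl; last by rewrite addnS ltnS leq_addr.
apply: measurableI; first exact: measurable_preimage.
by rewrite -addSnnS; exact: IH.
Qed.

(** The range of coordinates is bounded above by [N] so that cylinders involve
    finitely many of them; choosing [setT] for some of the sets [B i] frees
    the corresponding coordinates, see [indep_from_weaken]. *)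
Definition indep_from (C : set T) (m N : nat) : Prop :=
  forall B, (forall i, measurable (B i)) ->
    (P (C `&` cylinder m N B) = P C * \prod_(m <= i < N) P (Xs i @^-1` B i))%E.

Lemma indep_from_weaken C m k N : (m <= k)%N -> (k <= N)%N ->
  indep_from C m N -> indep_from C k N.
Proof.
move=> mk kN H B mB.
pose B' i := if (i < k)%N then setT else B i.
have mB' i : measurable (B' i) by rewrite /B'; case: ifP.
have -> : cylinder k N B = cylinder m N B'.
  rewrite predeqE => w; split=> Hw i /andP[h1 h2].
    by rewrite /B'; case: ltnP => // ki; apply: Hw; rewrite ki.
  have := Hw i; rewrite /B' (ltnNge i k) h1/=; apply.
  by rewrite h2 (leq_trans mk h1).
rewrite H// (big_cat_nat mk kN)/=.
rewrite [X in (_ * (X * _))%E]big1_seq ?mul1e.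
  congr (_ * _)%E; apply: eq_big_nat => i /andP[ki _].
  by rewrite /B' ltnNge ki.
move=> i /andP[_]; rewrite mem_index_iota => /andP[_ ik].
by rewrite /B' ik preimage_setT probability_setT.
Qed.

Hypothesis Xs_indep : mutually_independent Xs.

Lemma indep_from_setT m N : (m <= N)%N -> indep_from setT m N.
Proof.
move=> mN; apply: (@indep_from_weaken _ 0) => //.
move=> B mB; rewrite setTI probability_setT mul1e.
pose J := [fset i in iota 0 N]%fset.
have -> : cylinder 0 N B = \bigcap_(i in [set` J]) (Xs i @^-1` B i).
  rewrite predeqE => w; split=> H i /=.
    by rewrite /J !inE/= mem_iota => iN; exact: H.
  by move=> iN; apply: (H i); rewrite /J /= !inE mem_iota.
rewrite Xs_indep//; apply: perm_big; apply: uniq_perm.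
- exact: fset_uniq.
- exact: iota_uniq.
by move=> i; rewrite /J !inE /index_iota subn0.
Qed.

(** Each step moves the first free coordinate from the cylinder into the sum;
    [sum_indep] applies with [C] intersected with the remaining cylinder. *)
Lemma indep_from_walk k : forall C m N, measurable C -> indep_from C m N ->
  (m + k <= N)%N ->
  forall A B, measurable A -> (forall i, measurable (B i)) ->
  (P (walk m k @^-1` A `&` (C `&` cylinder (m + k) N B))
   = P (walk m k @^-1` A) * (P C * \prod_(m + k <= i < N) P (Xs i @^-1` B i)))%E.
Proof.
elim: k => [|k IH] C m N mC HC mkN A B mA mB.
  have -> : walk m 0 = cst 0 by apply/funext => w; rewrite /walk big_ord0.
  rewrite preimage_cst addn0; case: ifPn => A0.
    by rewrite setTI HC// probability_setT mul1e.
  by rewrite set0I measure0 mul0e.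
have mk : (m + k < N)%N by rewrite -addnS.
have mcyl : measurable (cylinder (m + k).+1 N B) by exact: measurable_cylinder.
have CF : (P (C `&` cylinder (m + k).+1 N B) =
    P C * \prod_((m + k).+1 <= i < N) P (Xs i @^-1` B i))%E.
  by apply: (@indep_from_weaken _ m) => //; rewrite leqW// leq_addr.
have key C' : measurable C' -> indep_from C' m N ->
  forall A1 A2, measurable A1 -> measurable A2 ->
   (P (walk m k @^-1` A1 `&` Xs (m + k)%N @^-1` A2 `&`
      (C' `&` cylinder (m + k).+1 N B)) =
   P (walk m k @^-1` A1) * P (Xs (m + k)%N @^-1` A2) *
     (P C' * \prod_((m + k).+1 <= i < N) P (Xs i @^-1` B i)))%E.
  move=> mC' HC' A1 A2 mA1 mA2.
  pose B' i := if i == (m + k)%N then A2 else B i.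
  have mB' i : measurable (B' i) by rewrite /B'; case: ifP.
  have := IH C' m N mC' HC' (ltnW mk) A1 B' mA1 mB'.
  have cylE : cylinder (m + k).+1 N B' = cylinder (m + k).+1 N B.
    rewrite predeqE => w; split=> H i /andP[h1 h2].
      by have := H i; rewrite /B' gtn_eqF// h1 h2 => /(_ isT).
    by rewrite /B' gtn_eqF//; apply: H; rewrite h1.
  rewrite cylinder_recl// cylE big_ltn// {1 2}/B' eqxx => H.
  rewrite (_ : _ `&` _ = walk m k @^-1` A1 `&`
      (C' `&` (Xs (m + k)%N @^-1` A2 `&` cylinder (m + k).+1 N B))); last first.
    by rewrite -!setIA; congr (_ `&` _); rewrite setICA.
  rewrite H.
  rewrite (@eq_big_nat _ _ _ _ _ _ (fun i => P (Xs i @^-1` B i))); last first.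
    by move=> i /andP[h1 _]; rewrite /B' gtn_eqF.
  rewrite -!muleA; congr (_ * _)%E; rewrite muleCA//.
rewrite addnS walkS.
have sum := @sum_indep _ _ _ _ (walk m k) (Xs (m + k)%N)
  (C `&` cylinder (m + k).+1 N B).
rewrite -CF; apply: sum => //; first exact: measurableI.
- move=> A1 A2 mA1 mA2.
  have := IH setT m (m + k).+1 measurableT (indep_from_setT _) _ A1
     (fun _ => A2) mA1 (fun _ => mA2).
  rewrite leqW ?leq_addr// leqnSn => /(_ isT isT).
  rewrite big_nat1 probability_setT mul1e setTI => <-.
  congr (P (_ `&` _)); rewrite predeqE => w; split=> [h i|]; last first.
    by apply; rewrite leqnn ltnS leqnn.
  by rewrite ltnS -eqn_leq => /eqP <-.
- by move=> A1 A2 mA1 mA2; rewrite key// CF.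
Qed.

Lemma indep_walk_next m k : indep2 P (walk m k) (Xs (m + k)%N).
Proof.
move=> A B mA mB.
have := @indep_from_walk k setT m (m + k).+1 measurableT
  (indep_from_setT _) _ A (fun _ => B) mA (fun _ => mB).
rewrite leqW ?leq_addr// leqnSn => /(_ isT isT).
rewrite big_nat1 probability_setT mul1e setTI => <-.
congr (P (_ `&` _)); rewrite predeqE => w; split=> [h i|]; last first.
  by apply; rewrite leqnn ltnS leqnn.
by rewrite ltnS -eqn_leq => /eqP <-.
Qed.

Lemma indep_walk_walk k l : indep2 P (walk 0 k) (walk k l).
Proof.
move=> A B mA mB.
pose N := (k + l)%N.
have mWA : measurable (walk 0 k @^-1` A) by exact: measurable_preimage.
have H1 : indep_from (walk 0 k @^-1` A) k N.
  move=> B' mB'.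
  have := @indep_from_walk k setT 0 N measurableT
    (indep_from_setT _) (leq_addr _ _) A B' mA mB'.
  by rewrite add0n setTI probability_setT mul1e => /(_ isT).
have := @indep_from_walk l _ k N mWA H1 (leqnn _) B (fun _ => setT) mB
  (fun _ => measurableT).
rewrite big_geq// mule1 muleC => <-; rewrite setIC; congr (P (_ `&` _)).
by rewrite predeqE => w; split=> // -[].
Qed.

Lemma indep_pair i j : i != j -> indep2 P (Xs i) (Xs j).
Proof.
move=> ij A B mA mB.
pose C k := if k == i then A else B.
have := @Xs_indep [fset i; j]%fset C.
have mC k : measurable (C k) by rewrite /C; case: ifP.
move=> /(_ mC).
rewrite (_ : \bigcap_(_ in _) _ = Xs i @^-1` A `&` Xs j @^-1` B); last first.
  rewrite predeqE => w; split=> [H|[Ha Hb] k].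
    split; first by have := H i; rewrite /= /C eqxx !inE eqxx; apply.
    by have := H j; rewrite /= /C eq_sym (negbTE ij) !inE eqxx orbT; apply.
  by rewrite /= !inE /C => /orP[/eqP->|/eqP->]; rewrite ?eqxx// eq_sym (negbTE ij).
move=> ->; rewrite big_fsetU1/= ?inE// big_seq_fset1.
by rewrite /C eqxx eq_sym (negbTE ij).
Qed.

End Walk.

(** * Concentration through characteristic functions *)

Section CosSin.
Context (R : realType).

Lemma bmeas_cos (t y : R) : bounded_measurable (fun u : R => cos (t * (u - y))).
Proof.
split; last by exists 1 => u; exact: cos_max.
apply: continuous_measurable_fun => u.
apply: (@continuous_comp _ _ _ (fun v => t * (v - y)) cos); last exact: continuous_cos.
by apply: cvgM; [exact: cvg_cst|apply: cvgB; [exact: cvg_id|exact: cvg_cst]].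
Qed.

Lemma bmeas_sin (t y : R) : bounded_measurable (fun u : R => sin (t * (u - y))).
Proof.
split; last by exists 1 => u; exact: sin_max.
apply: continuous_measurable_fun => u.
apply: (@continuous_comp _ _ _ (fun v => t * (v - y)) sin); last exact: continuous_sin.
by apply: cvgM; [exact: cvg_cst|apply: cvgB; [exact: cvg_id|exact: cvg_cst]].
Qed.

(** Any such [eta] will do; the bound by one is only there to compare scales. *)
Lemma cos_ge_half : exists eta : R, [/\ 0 < eta, eta <= 1 &
  forall u, `|u| <= eta -> 2^-1 <= cos u].
Proof.
have : cos u @[u --> (0 : R)] --> (1 : R) by rewrite -[X in _ --> X]cos0; exact: continuous_cos.
move=> /cvgrPdist_le /(_ 2^-1); rewrite invr_gt0 ltr0n => /(_ isT).
move=> /nbhs_ballP[e /= e0 He]; exists (Num.min 1 (e / 2)); split.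
- by rewrite lt_min ltr01 divr_gt0.
- by rewrite ge_min lexx.
move=> u; rewrite le_min => /andP[_ ue]; have := He u; rewrite /ball/= sub0r normrN.
have : `|u| < e by rewrite (le_lt_trans ue)// gtr_pMr// invf_lt1// ltr1n.
by move=> -> /(_ isT); rewrite ler_norml => /andP[_]; lra.
Qed.

(** By the mean value theorem [v / 2 <= sin v] on the same interval, and
    [1 - cos u] is twice the square of [sin (u / 2)]. *)
Lemma one_sub_cos_ge (eta : R) : (forall u, `|u| <= eta -> 2^-1 <= cos u) ->
  forall u : R, `|u| <= eta -> u ^+ 2 / 8 <= 1 - cos u.
Proof.
move=> H.
have sinlow v : 0 < v -> v <= eta -> v / 2 <= sin v.
  move=> v0 ve.
  have csin : {within `[0, v], continuous (@sin R)}.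
    by apply: continuous_subspaceT => y; exact: continuous_sin.
  have [c] := @MVT R (@sin R) (@cos R) 0 v v0 (fun y _ => is_derive_sin y) csin.
  rewrite in_itv/= => /andP[c0 cv].
  rewrite sin0 !subr0 => ->; rewrite mulrC ler_wpM2r ?(ltW v0)// H//.
  by rewrite ger0_norm; [exact: le_trans (ltW cv) ve|exact: ltW].
move=> u ue.
have -> : 1 - cos u = 2 * sin (`|u| / 2) ^+ 2.
  rewrite -cos_norm (_ : cos `|u| = cos ((`|u| / 2) *+ 2)); last first.
    by congr cos; rewrite -mulr_natr; field.
  by rewrite cos_mulr2n sin2cos2 -mulr_natl; ring.
have [->|u0] := eqVneq u 0; first by rewrite expr0n mul0r mulr_ge0// sqr_ge0.
have v0 : 0 < `|u| / 2 by rewrite divr_gt0// normr_gt0.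
have := sinlow _ v0 _; have -> : `|u| / 2 <= eta.
  by apply: le_trans ue; have := normr_ge0 u; lra.
move=> /(_ isT) h.
have : (`|u| / 2 / 2) ^+ 2 <= sin (`|u| / 2) ^+ 2.
  by rewrite lerXn2r ?nnegrE ?(le_trans _ h)// divr_ge0// ltW.
by rewrite -(real_normK (num_real u)); lra.
Qed.

(** The indices on either side of [l] each run through an initial segment of
    distances. *)
Lemma sum_dist_le (N l : nat) (g : nat -> R) (G : R) : (l < N)%N ->
  (forall i, 0 <= g i) -> \sum_(i < N) g i <= G ->
  \sum_(j < N) g ((j - l) + (l - j))%N <= 2 * G.
Proof.
move=> lN g0 gG.
have sub M : (M <= N)%N -> \sum_(0 <= i < M) g i <= G.
  move=> MN; apply: le_trans gG; rewrite -(big_mkord xpredT).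
  by rewrite (big_cat_nat (leq0n M) MN)/= lerDl sumr_ge0.
rewrite -(big_mkord xpredT (fun j => g ((j - l) + (l - j))%N)).
rewrite (big_cat_nat (leq0n l) (ltnW lN))/=.
rewrite (_ : 2 * G = G + G); last by rewrite mulrDl mul1r.
apply: lerD.
  rewrite big_nat_rev/= add0n.
  apply: le_trans (sub l.+1 lN).
  rewrite big_nat_recl//= -[X in X <= _]add0r lerD//.
  rewrite le_eqVlt; apply/orP; left; apply/eqP; apply: eq_big_nat => i /andP[_ il].
  congr g; lia.
apply: le_trans (sub (N - l)%N (leq_subr _ _)).
rewrite -{1}[l]add0n big_addn.
rewrite le_eqVlt; apply/orP; left; apply/eqP; apply: eq_big_nat => i /andP[_ il].
congr g; lia.
Qed.

End CosSin.

Section Concentration.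
Context d (T : measurableType d) (R : realType) (P : probability T R).

Lemma measurable_dist_le (U : {RV P >-> R}) (y h : R) :
  measurable [set w | `|U w - y| <= h].
Proof.
rewrite (_ : [set w | _] = U @^-1` `[y - h, y + h]).
  by apply: measurable_preimage; exact: measurable_itv.
by rewrite predeqE => w /=; rewrite in_itv/= ler_distl.
Qed.

(** The kernel is a sum of two squares, hence nonnegative, and at the same time
    a trigonometric polynomial. *)
Lemma fejer_kernel (N : nat) (v : R) :
  (\sum_(j < N) cos (j%:R * v)) ^+ 2 + (\sum_(j < N) sin (j%:R * v)) ^+ 2
  = \sum_(l < N) \sum_(j < N) cos ((j%:R - l%:R) * v).
Proof.
rewrite !expr2 !mulr_suml -big_split/=; apply: eq_bigr => l _.
rewrite !mulr_sumr -big_split/=; apply: eq_bigr => j _.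
by rewrite mulrBl cosB mulrC [X in _ + X]mulrC.
Qed.

(** Esseen's inequality on a grid: a Fejer kernel bounds the indicator of the
    interval from above, and its expectation is a sum of values of the
    characteristic function at the grid points. *)
Lemma concentration (U : {RV P >-> R}) (y h delta eta G : R) (N : nat)
    (g : nat -> R) :
  (forall u, `|u| <= eta -> 2^-1 <= cos u) ->
  (0 < N)%N -> 0 <= delta -> N%:R * delta * h <= eta ->
  (forall j, 0 <= g j) -> \sum_(j < N) g j <= G ->
  (forall j, (j < N)%N ->
     `|Ex P (fun w => cos (j%:R * delta * (U w - y)))| <= g j) ->
  fine (P [set w | `|U w - y| <= h]) <= 8 * G / N%:R.
Proof.
move=> heta N0 d0 Nd g0 gG hg.
have NR0 : 0 < N%:R :> R by rewrite ltr0n.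
have mE := measurable_dist_le U y h.
have mU : measurable_fun setT U by exact: measurable_funPT.
have bcos t : bounded_measurable (fun w => cos (t * (U w - y))).
  by apply: (@bmeas_comp _ _ _ U (fun u => cos (t * (u - y)))) => //; exact: bmeas_cos.
pose k w := \sum_(l < N) \sum_(j < N) cos ((j%:R - l%:R) * delta * (U w - y)).
have bk : bounded_measurable k.
  by apply: bmeas_sum => l; apply: bmeas_sum => j; exact: bcos.
have kE w : k w = (\sum_(j < N) cos (j%:R * (delta * (U w - y)))) ^+ 2
    + (\sum_(j < N) sin (j%:R * (delta * (U w - y)))) ^+ 2.
  rewrite fejer_kernel; apply: eq_bigr => l _; apply: eq_bigr => j _.
  by rewrite -mulrA.
have low : (N%:R ^+ 2 / 4) * fine (P [set w | `|U w - y| <= h]) <= Ex P k.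
  rewrite -Ex_indic// -Ex_scale; last exact: bmeas_indic.
  apply: Ex_le => //.
    by apply: bmeas_mul; [exact: bmeas_cst|exact: bmeas_indic].
  move=> w; rewrite indicE; case: (boolP (w \in _)) => [|_]; last first.
    by rewrite mulr0 kE addr_ge0// sqr_ge0.
  rewrite inE/= => Uh; rewrite mulr1 kE.
  apply: (@le_trans _ _ ((\sum_(j < N) cos (j%:R * (delta * (U w - y)))) ^+ 2));
    last by rewrite lerDl sqr_ge0.
  have : N%:R / 2 <= \sum_(j < N) cos (j%:R * (delta * (U w - y))).
    have -> : N%:R / 2 = \sum_(j < N) (2^-1 : R).
      by rewrite sumr_const card_ord -[RHS]mulr_natl.
    apply: ler_sum => j _; apply: heta; apply: le_trans Nd.
    rewrite !normrM (ger0_norm d0) ger0_norm ?ler0n// -mulrA.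
    apply: ler_pM => //; first by rewrite mulr_ge0.
    - by rewrite ler_nat ltnW.
    - by rewrite ler_wpM2l.
  move=> h1; have -> : N%:R ^+ 2 / 4 = (N%:R / 2 : R) ^+ 2 by field.
  by rewrite ler_pXn2r// nnegrE ?divr_ge0// (le_trans _ h1)// divr_ge0.
have up : Ex P k <= N%:R * (2 * G).
  rewrite Ex_sum; last by move=> l; apply: bmeas_sum => j; exact: bcos.
  have -> : N%:R * (2 * G) = \sum_(l < N) (2 * G).
    by rewrite sumr_const card_ord -[RHS]mulr_natl.
  apply: ler_sum => l _; rewrite Ex_sum//.
  apply: le_trans (sum_dist_le (ltn_ord l) g0 gG).
  apply: ler_sum => j _.
  have lt : ((j - l) + (l - j) < N)%N by have := ltn_ord j; have := ltn_ord l; lia.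
  apply: le_trans (hg _ lt); apply: le_trans (ler_norm _).
  rewrite le_eqVlt; apply/orP; left; apply/eqP; congr (Ex P _); apply/funext => w.
  have [jl|lj] := leqP j l.
    rewrite (_ : (j - l)%N = 0)%N ?add0n; last by apply/eqP; rewrite subn_eq0.
    by rewrite natrB// -[RHS]cosN; congr cos; ring.
  rewrite (_ : (l - j)%N = 0)%N ?addn0; last by apply/eqP; rewrite subn_eq0 ltnW.
  by rewrite natrB// ltnW.
have := le_trans low up.
rewrite ler_pdivlMr//.
set p := fine _ => H.
have : N%:R * (p * N%:R) <= N%:R * (8 * G) by nra.
by rewrite ler_pM2l.
Qed.

End Concentration.

Section WalkCharacteristic.
Context d (T : measurableType d) (R : realType) (P : probability T R).
Variables (X : {RV P >-> R}) (Xs : nat -> {RV P >-> R}).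
Hypothesis copies : independent_copies X Xs.

Lemma Ex_copy (f : R -> R) i : bounded_measurable f ->
  Ex P (fun w => f (Xs i w)) = Ex P (fun w => f (X w)).
Proof.
move=> bf; have [_ /(_ i) H] := copies; congr fine.
have mf : measurable_fun setT (EFin \o f) by apply/measurable_EFinP; case: bf.
have b (U : {RV P >-> R}) : P.-integrable setT ((EFin \o f) \o U).
  by apply: (bmeas_integrable P (bmeas_comp _ bf)); exact: measurable_funPT.
rewrite -[LHS](@integral_distribution _ _ _ _ _ P (Xs i) (EFin \o f))//.
rewrite -[RHS](@integral_distribution _ _ _ _ _ P X (EFin \o f))//.
by apply: eq_measure_integral => A mA _; exact: H.
Qed.

(** The squared modulus of the characteristic function of [X]. The difference
    with [0] keeps the integrands in the shape of [bmeas_cos]. *)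
Definition char2 (t : R) : R :=
  Ex P (fun w => cos (t * (X w - 0))) ^+ 2
  + Ex P (fun w => sin (t * (X w - 0))) ^+ 2.

(** Multiplicativity of the characteristic function, in real and imaginary
    parts: one step is a rotation composed with a contraction. *)
Lemma char2_walk t m k :
  Ex P (fun w => cos (t * (walk Xs m k w - 0))) ^+ 2
  + Ex P (fun w => sin (t * (walk Xs m k w - 0))) ^+ 2 = char2 t ^+ k.
Proof.
elim: k => [|k IH].
  have -> : walk Xs m 0 = cst 0 by apply/funext => w; rewrite /walk big_ord0.
  by rewrite /= subr0 mulr0 cos0 sin0 !Ex_cst expr0 expr1n expr0n addr0.
have [Xind _] := copies.
have UV := indep_walk_next Xind m k.
have bc y := bmeas_cos t (y : R); have bs y := bmeas_sin t (y : R).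
have mW : measurable_fun setT (walk Xs m k) by exact: measurable_funPT.
have mX : measurable_fun setT (Xs (m + k)%N) by exact: measurable_funPT.
have bW (f : R -> R) : bounded_measurable f -> bounded_measurable (fun w => f (walk Xs m k w)).
  exact: (bmeas_comp mW).
have bX (f : R -> R) : bounded_measurable f -> bounded_measurable (fun w => f (Xs (m + k)%N w)).
  exact: (bmeas_comp mX).
have step w : t * (walk Xs m k.+1 w - 0)
    = t * (walk Xs m k w - 0) + t * (Xs (m + k)%N w - 0).
  by rewrite walkS; ring.
under eq_fun do rewrite step cosD.
under [X in _ + Ex P X ^+ 2]eq_fun do rewrite step sinD.
have bWX (f g : R -> R) : bounded_measurable f -> bounded_measurable g ->
    bounded_measurable (fun w => f (walk Xs m k w) * g (Xs (m + k)%N w)).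
  by move=> bf bg; apply: bmeas_mul; [exact: bW|exact: bX].
rewrite Ex_sub; [|exact: (bWX _ _ (bc 0) (bc 0))|exact: (bWX _ _ (bs 0) (bs 0))].
rewrite Ex_add; [|exact: (bWX _ _ (bs 0) (bc 0))|exact: (bWX _ _ (bc 0) (bs 0))].
rewrite (Ex_indep UV (bc 0) (bc 0)) (Ex_indep UV (bs 0) (bs 0)).
rewrite (Ex_indep UV (bs 0) (bc 0)) (Ex_indep UV (bc 0) (bs 0)).
rewrite (Ex_copy _ (bc 0)) (Ex_copy _ (bs 0)).
rewrite [RHS]exprS -IH /char2; ring.
Qed.

(** The centre [y] only rotates the characteristic function, which the
    Cauchy-Schwarz inequality in the plane absorbs. *)
Lemma Ex_cos_walk_le t m k y g : 0 <= g -> char2 t ^+ k <= g ^+ 2 ->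
  `|Ex P (fun w => cos (t * (walk Xs m k w - y)))| <= g.
Proof.
move=> g0; rewrite -(char2_walk t m k) => H.
have mW : measurable_fun setT (walk Xs m k) by exact: measurable_funPT.
have bc : bounded_measurable (fun w => cos (t * (walk Xs m k w - 0))).
  exact: (bmeas_comp mW (bmeas_cos t 0)).
have bs : bounded_measurable (fun w => sin (t * (walk Xs m k w - 0))).
  exact: (bmeas_comp mW (bmeas_sin t 0)).
have -> : (fun w => cos (t * (walk Xs m k w - y))) =
    (fun w => cos (t * y) * cos (t * (walk Xs m k w - 0))
              + sin (t * y) * sin (t * (walk Xs m k w - 0))).
  apply/funext => w.
  have -> : t * (walk Xs m k w - y) = t * (walk Xs m k w - 0) - t * y by ring.
  by rewrite cosB; ring.
rewrite Ex_add ?Ex_scale//; last 2 first.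
- by apply: bmeas_mul => //; exact: bmeas_cst.
- by apply: bmeas_mul => //; exact: bmeas_cst.
move: H; set c := Ex _ _; set s := Ex _ _ => H.
rewrite -(@ler_pXn2r _ 2)// ?nnegrE// real_normK ?num_real//.
apply: le_trans H; have := cos2Dsin2 (t * y).
set a := cos _; set b := sin _ => ab.
have : 0 <= (a * s - b * c) ^+ 2 by exact: sqr_ge0.
rewrite -(mulr1 (c ^+ 2 + s ^+ 2)) -ab; nra.
Qed.

(** The squared modulus is the characteristic function of the symmetrised
    law. *)
Lemma char2E t : char2 t =
  Ex P (fun w => cos (t * (Xs 0%N w - Xs 1%N w))).
Proof.
have [Xind _] := copies.
have UV := indep_pair Xind (isT : 0 != 1)%N.
have bc := bmeas_cos t (0 : R); have bs := bmeas_sin t (0 : R).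
have bX i (f : R -> R) : bounded_measurable f -> bounded_measurable (fun w => f (Xs i w)).
  by move=> bf; apply: (bmeas_comp _ bf); exact: measurable_funPT.
have step w : t * (Xs 0%N w - Xs 1%N w)
   = t * (Xs 0%N w - 0) - t * (Xs 1%N w - 0) by ring.
under eq_fun do rewrite step cosB.
rewrite Ex_add.
- rewrite (Ex_indep UV bc bc) (Ex_indep UV bs bs).
  by rewrite !(Ex_copy _ bc) !(Ex_copy _ bs) /char2 !expr2.
- by apply: bmeas_mul; [exact: (bX 0%N _ bc)|exact: (bX 1%N _ bc)].
- by apply: bmeas_mul; [exact: (bX 0%N _ bs)|exact: (bX 1%N _ bs)].
Qed.

End WalkCharacteristic.

(** * Tail and capped second moment *)

(** Comparisons between functions at infinity are proved by following how both
    sides change when the argument doubles; this replaces the integral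
    representations of Karamata's theory. *)
Lemma dyadic_ind (R : realType) (Q : R -> Prop) (x0 : R) : 0 < x0 ->
  (forall y, x0 <= y <= 2 * x0 -> Q y) ->
  (forall y, x0 <= y -> Q y -> Q (2 * y)) ->
  forall x, x0 <= x -> Q x.
Proof.
move=> x00 base step x x0x.
have [n xn] : exists n, x <= 2 ^+ n.+1 * x0.
  have [n /ltW xn] : exists n : nat, x / x0 < n%:R.
    by exists (Num.truncn (x / x0)).+1; exact: truncnS_gt.
  exists n; rewrite -ler_pdivrMr// (le_trans xn)// -natrX ler_nat.
  by rewrite (leq_trans _ (ltnW (ltn_expl _ _)))//.
elim: n x x0x xn => [|n IH] x x0x xn; first by apply: base; rewrite x0x; move: xn; rewrite expr1.
have [x2|x2] := leP x (2 * x0); first by apply: base; rewrite x0x.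
rewrite (_ : x = 2 * (x / 2)); last by field.
have h : x0 <= x / 2 by rewrite ler_pdivlMr// mulrC ltW.
apply: step => //; apply: IH => //.
by rewrite ler_pdivrMr//; move: xn; rewrite (exprS _ n.+1); lra.
Qed.

Lemma contraction_power (R : realType) (s e : R) : 0 <= s -> s < 1 -> 0 < e ->
  exists k : nat, s ^+ k <= e.
Proof.
move=> s0 s1 e0.
have : s ^+ n @[n --> \oo] --> (0 : R) by apply: cvg_expr; rewrite ger0_norm.
move=> /cvgrPdist_le /(_ _ e0) [n _ /(_ n (leqnn n))]/=.
by rewrite sub0r normrN normrX ger0_norm// => ?; exists n.
Qed.

Section Truncation.
Context (R : realType) (mu : probability R R).

(** The window is the half-open interval from [- x] to [x], so that the mean of
    [exceeds x] is exactly the sum of the two prescribed tails. *)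
Definition exceeds (x u : R) : R := if (x < u) || (u <= - x) then 1 else 0.

Definition tail (x : R) : R := Ex mu (exceeds x).

Definition trunc2 (x : R) : R := Ex mu (fun u => u ^+ 2 * (1 - exceeds x u)).

(** Up to constants, both the normalising sequence and the tail bound are
    expressed through this single function; [x ^+ 2 * conc2 x] is the second
    moment capped at level [x]. *)
Definition conc2 (x : R) : R := Ex mu (fun u => Num.min 1 (u ^+ 2 / x ^+ 2)).

Lemma exceeds01 x u : 0 <= exceeds x u <= 1.
Proof. by rewrite /exceeds; case: ifP => _; rewrite ?lexx ler01. Qed.

Lemma exceedsP x u : (exceeds x u = 1 /\ x <= `|u|) \/
  (exceeds x u = 0 /\ `|u| <= x).
Proof.
rewrite /exceeds; case: ifPn => [/orP[xu|ux]|h]; [left|left|right].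
- by split=> //; rewrite (le_trans (ltW xu))// ler_norm.
- by split=> //; rewrite -normrN (le_trans _ (ler_norm _))// lerNr.
- move: h; rewrite negb_or -leNgt -ltNge => /andP[h1 h2].
  by rewrite ler_norml h1 ltW.
Qed.

Lemma exceeds_le x y u : x <= y -> exceeds y u <= exceeds x u.
Proof.
move=> xy; rewrite /exceeds; case: ifPn => [h|]; last by case: ifP.
rewrite ifT//; case/orP: h => h; apply/orP; [left|right].
  exact: le_lt_trans h.
by rewrite (le_trans h)// lerN2.
Qed.

Lemma measurable_exceeds x : measurable_fun setT (exceeds x).
Proof.
rewrite (_ : exceeds x = \1_(`]x, +oo[ `|` `]-oo, - x])); last first.
  apply/funext => u; rewrite /exceeds indicE; case: ifPn => [h|h].
    by rewrite mem_set//= !in_itv/= andbT; apply/orP.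
  by rewrite memNset//= !in_itv/= andbT; apply/orP.
by apply: measurable_indic; apply: measurableU; exact: measurable_itv.
Qed.

Lemma bmeas_exceeds x : bounded_measurable (exceeds x).
Proof.
split; first exact: measurable_exceeds.
by exists 1 => u; have /andP[h0 h1] := exceeds01 x u; rewrite ger0_norm.
Qed.

Lemma bmeas_inside (f : R -> R) x M : measurable_fun setT f ->
  (forall u, `|u| <= x -> `|f u| <= M) ->
  bounded_measurable (fun u : R => f u * (1 - exceeds x u)).
Proof.
move=> mf fM; split.
  apply: measurable_funM => //; apply: measurable_funB => //.
  exact: measurable_exceeds.
exists `|M| => u; have [[-> _]|[-> ux]] := exceedsP x u.
  by rewrite subrr mulr0 normr0.
by rewrite subr0 mulr1 (le_trans (fM u ux))// ler_norm.
Qed.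

Lemma bmeas_sqr_inside (x : R) : bounded_measurable (fun u : R => u ^+ 2 * (1 - exceeds x u)).
Proof.
apply: (@bmeas_inside _ _ (x ^+ 2)); first exact: exprn_measurable.
move=> u ux; rewrite normrX lerXn2r ?nnegrE//.
by rewrite (le_trans _ ux).
Qed.

Lemma bmeas_cap (x : R) : bounded_measurable (fun u : R => Num.min 1 (u ^+ 2 / x ^+ 2)).
Proof.
split.
  apply: (@measurable_minr _ _ _ setT (cst 1) (fun u : R => u ^+ 2 / x ^+ 2)) => //.
  apply: (@measurable_funM _ _ _ setT (fun u : R => u ^+ 2) (cst (x ^+ 2)^-1)).
    exact: exprn_measurable.
  exact: measurable_cst.
exists 1 => u; rewrite ger0_norm ?ge_min ?lexx//.
by rewrite le_min ler01 divr_ge0// sqr_ge0.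
Qed.

(** Capping differs from truncating only outside the window, where it leaves
    the constant [x ^+ 2]. *)
Lemma cap_split x u : 0 < x ->
  x ^+ 2 * Num.min 1 (u ^+ 2 / x ^+ 2)
  = u ^+ 2 * (1 - exceeds x u) + x ^+ 2 * exceeds x u.
Proof.
move=> x0; have x20 : 0 < x ^+ 2 by rewrite exprn_gt0.
have [[-> xu]|[-> ux]] := exceedsP x u.
  rewrite subrr mulr0 add0r min_l// ler_pdivlMr// mul1r.
  by rewrite -(real_normK (num_real u)) lerXn2r ?nnegrE// ltW.
rewrite mulr0 subr0 mulr1 addr0 min_r; first by field; rewrite gt_eqF.
rewrite ler_pdivrMr// mul1r -(real_normK (num_real u)) lerXn2r ?nnegrE//.
exact: ltW.
Qed.

Lemma conc2_split x : 0 < x -> x ^+ 2 * conc2 x = trunc2 x + x ^+ 2 * tail x.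
Proof.
move=> x0; rewrite /conc2 -Ex_scale; last exact: bmeas_cap.
under eq_fun do rewrite cap_split//.
rewrite Ex_add; first by rewrite Ex_scale//; exact: bmeas_exceeds.
- exact: bmeas_sqr_inside.
- by apply: bmeas_mul; [exact: bmeas_cst|exact: bmeas_exceeds].
Qed.

Lemma tail_ge0 x : 0 <= tail x.
Proof. by apply: Ex_ge0 => u; case/andP: (exceeds01 x u). Qed.

Lemma tail_le x y : x <= y -> tail y <= tail x.
Proof.
by move=> xy; apply: Ex_le => *; [exact: bmeas_exceeds..|exact: exceeds_le].
Qed.

Lemma conc2_ge0 x : 0 <= conc2 x.
Proof.
by apply: Ex_ge0 => u; rewrite le_min ler01 divr_ge0// sqr_ge0.
Qed.

Lemma conc2_le1 x : conc2 x <= 1.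
Proof.
rewrite -(Ex_cst mu 1); apply: Ex_le => [||u].
- exact: bmeas_cap.
- exact: bmeas_cst.
- by rewrite ge_min lexx.
Qed.

Lemma conc2_le x y : 0 < x -> x <= y -> conc2 y <= conc2 x.
Proof.
move=> x0 xy; apply: Ex_le => [||u]; [exact: bmeas_cap..|].
rewrite le_min ge_min lexx/= ge_min; apply/orP; right.
have y0 : 0 < y by exact: lt_le_trans xy.
rewrite ler_wpM2l ?sqr_ge0// lef_pV2 ?posrE ?exprn_gt0//.
by rewrite lerXn2r ?nnegrE// ltW.
Qed.

Lemma conc2_scale c x : 1 <= c -> 0 < x -> conc2 x <= c ^+ 2 * conc2 (c * x).
Proof.
move=> c1 x0; have c0 : 0 < c by exact: lt_le_trans c1.
rewrite /conc2 -Ex_scale; last exact: bmeas_cap.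
apply: Ex_le => [||u].
- exact: bmeas_cap.
- by apply: bmeas_mul; [exact: bmeas_cst|exact: bmeas_cap].
have c2 : 1 <= c ^+ 2 by rewrite exprn_ege1.
rewrite minr_pMr ?sqr_ge0// mulr1 le_min ge_min c2/= ge_min; apply/orP; right.
rewrite le_eqVlt; apply/orP; left; apply/eqP; field.
by rewrite !gt_eqF.
Qed.

Lemma tail_le_conc2 x : 0 < x -> tail x <= conc2 x.
Proof.
move=> x0; have := conc2_split x0.
have : 0 <= trunc2 x.
  apply: Ex_ge0 => u; rewrite mulr_ge0 ?sqr_ge0// subr_ge0.
  by case/andP: (exceeds01 x u).
have x20 : 0 < x ^+ 2 by rewrite exprn_gt0.
by move=> h1 h2; rewrite -(ler_pM2l x20) h2 lerDr.
Qed.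

Lemma trunc2_le x y : x <= y -> trunc2 x <= trunc2 y.
Proof.
move=> xy; apply: Ex_le => [||u]; [exact: bmeas_sqr_inside..|].
by rewrite ler_wpM2l ?sqr_ge0// lerD2l lerN2 exceeds_le.
Qed.

(** The part of the law between the two windows sits at distance at least
    [x]. *)
Lemma trunc2_ge_shell x y : 0 <= x -> x <= y ->
  x ^+ 2 * (tail x - tail y) <= trunc2 y.
Proof.
move=> x0 xy; rewrite /tail -Ex_sub; [|exact: bmeas_exceeds..].
rewrite -Ex_scale; last by apply: bmeas_sub; exact: bmeas_exceeds.
apply: Ex_le => [||u].
- by apply: bmeas_mul; [exact: bmeas_cst|apply: bmeas_sub; exact: bmeas_exceeds].
- exact: bmeas_sqr_inside.
have [[-> h1]|[-> h1]] := exceedsP y u.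
  rewrite subrr mulr0 mulr_ge0_le0 ?sqr_ge0// subr_le0.
  by case/andP: (exceeds01 x u).
rewrite !subr0 mulr1; have [[-> h2]|[-> h2]] := exceedsP x u.
  by rewrite mulr1 -(real_normK (num_real u)) lerXn2r ?nnegrE.
by rewrite mulr0 sqr_ge0.
Qed.

(** When the level doubles, the capped square changes only outside the window
    of radius [x], and there by at most [3 * x ^+ 2]; outside the window of
    radius [2 * x] it changes by exactly that much. *)
Lemma capped2_double_le x : 0 < x ->
  (2 * x) ^+ 2 * conc2 (2 * x) <= x ^+ 2 * conc2 x + 3 * x ^+ 2 * tail x.
Proof.
move=> x0; have x20 : 0 < 2 * x by rewrite mulr_gt0.
have bc : bounded_measurable (fun u : R => x ^+ 2 * Num.min 1 (u ^+ 2 / x ^+ 2)).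
  by apply: bmeas_mul; [exact: bmeas_cst|exact: bmeas_cap].
have be : bounded_measurable (fun u : R => 3 * x ^+ 2 * exceeds x u).
  by apply: bmeas_mul; [exact: bmeas_cst|exact: bmeas_exceeds].
rewrite /conc2 /tail -!Ex_scale; [|exact: bmeas_exceeds|exact: bmeas_cap..].
rewrite -Ex_add//; apply: Ex_le => [||u].
- by apply: bmeas_mul; [exact: bmeas_cst|exact: bmeas_cap].
- exact: bmeas_add.
rewrite !cap_split//.
have -> : u ^+ 2 = `|u| ^+ 2 by rewrite real_normK// num_real.
have un := normr_ge0 u.
have [[-> h1]|[-> h1]] := exceedsP x u; have [[-> h2]|[-> h2]] := exceedsP (2 * x) u; nra.
Qed.

Lemma capped2_double_ge x : 0 < x ->
  x ^+ 2 * conc2 x + 3 * x ^+ 2 * tail (2 * x) <= (2 * x) ^+ 2 * conc2 (2 * x).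
Proof.
move=> x0; have x20 : 0 < 2 * x by rewrite mulr_gt0.
have bc : bounded_measurable (fun u : R => x ^+ 2 * Num.min 1 (u ^+ 2 / x ^+ 2)).
  by apply: bmeas_mul; [exact: bmeas_cst|exact: bmeas_cap].
have be : bounded_measurable (fun u : R => 3 * x ^+ 2 * exceeds (2 * x) u).
  by apply: bmeas_mul; [exact: bmeas_cst|exact: bmeas_exceeds].
rewrite /conc2 /tail -!Ex_scale; [|exact: bmeas_cap|exact: bmeas_exceeds|exact: bmeas_cap].
rewrite -Ex_add//; apply: Ex_le => [||u].
- exact: bmeas_add.
- by apply: bmeas_mul; [exact: bmeas_cst|exact: bmeas_cap].
rewrite !cap_split//.
have -> : u ^+ 2 = `|u| ^+ 2 by rewrite real_normK// num_real.
have un := normr_ge0 u.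
have [[-> h1]|[-> h1]] := exceedsP x u; have [[-> h2]|[-> h2]] := exceedsP (2 * x) u; nra.
Qed.

Lemma conc2_drop x : 0 < x ->
  3 / 4 * trunc2 x <= x ^+ 2 * (conc2 x - conc2 (2 * x)).
Proof.
move=> x0; have h1 := capped2_double_le x0; have h2 := conc2_split x0.
have -> : x ^+ 2 * (conc2 x - conc2 (2 * x))
  = x ^+ 2 * conc2 x - 4^-1 * ((2 * x) ^+ 2 * conc2 (2 * x)) by field.
lra.
Qed.

End Truncation.

(** * Consequences of a geometric decay of the tail *)

Section TailDecay.
Context (R : realType) (mu : probability R R).
Local Notation tail := (tail mu).
Local Notation trunc2 := (trunc2 mu).
Local Notation conc2 := (conc2 mu).

Lemma tail_iter (s x0 : R) : 0 <= s -> 0 < x0 ->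
  (forall x, x0 <= x -> tail (2 * x) <= s * tail x) ->
  forall k x, x0 <= x -> tail (2 ^+ k * x) <= s ^+ k * tail x.
Proof.
move=> s0 x00 H; elim=> [|k IH] x xx0; first by rewrite !expr0 !mul1r.
have h : x0 <= 2 ^+ k * x.
  by rewrite (le_trans xx0)// ler_peMl ?(le_trans (ltW x00))// exprn_ege1// ler1n.
rewrite !exprS -!mulrA; apply: (le_trans (H _ h)).
by rewrite ler_wpM2l// IH.
Qed.

(** A geometric decay of the tail keeps a fixed part of the capped second
    moment inside the truncation window, after a constant enlargement. *)
Lemma capped2_le_trunc2 (s x0 : R) : 0 <= s -> s < 1 -> 0 < x0 ->
  (forall x, x0 <= x -> tail (2 * x) <= s * tail x) ->
  exists2 lam : R, 1 <= lam &
    forall x, x0 <= x -> x ^+ 2 * conc2 x <= 4 * trunc2 (lam * x).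
Proof.
move=> s0 s1 x00 H.
have [k sk] := contraction_power s0 s1 (ltac:(lra) : 0 < 2^-1 :> R).
have l1 : 1 <= 2 ^+ k :> R by rewrite exprn_ege1// ler1n.
exists (2 ^+ k) => // x xx0.
have xgt0 : 0 < x by exact: lt_le_trans xx0.
have xl : x <= 2 ^+ k * x by rewrite ler_peMl// ltW.
have h1 : tail (2 ^+ k * x) <= 2^-1 * tail x.
  apply: (le_trans (tail_iter s0 x00 H k xx0)).
  by rewrite ler_wpM2r// tail_ge0.
have h2 := trunc2_ge_shell mu (ltW xgt0) xl.
have h3 := trunc2_le mu xl.
have h4 := conc2_split mu xgt0.
have t0 := tail_ge0 mu x.
have x2 : 0 < x ^+ 2 by rewrite exprn_gt0.
have : x ^+ 2 * (2^-1 * tail x) <= x ^+ 2 * (tail x - tail (2 ^+ k * x)).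
  by rewrite ler_wpM2l ?(ltW x2)//; lra.
have : 0 <= x ^+ 2 * tail x by rewrite mulr_ge0 ?(ltW x2).
lra.
Qed.

(** Doubling the level loses three quarters of the truncated second moment
    relative to the level, and by [capped2_le_trunc2] this is a fixed fraction
    of [conc2]. *)
Lemma conc2_contract (s x0 : R) : 0 <= s -> s < 1 -> 0 < x0 ->
  (forall x, x0 <= x -> tail (2 * x) <= s * tail x) ->
  exists theta y0 : R, [/\ 0 <= theta, theta < 1, 0 < y0 &
    forall y, y0 <= y -> conc2 (2 * y) <= theta * conc2 y].
Proof.
move=> s0 s1 x00 H.
have [lam l1 Hl] := capped2_le_trunc2 s0 s1 x00 H.
have l0 : 0 < lam by exact: lt_le_trans l1.
pose c := 3 / (16 * lam ^+ 2).
have l2 : 1 <= lam ^+ 2 by rewrite exprn_ege1.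
have c0 : 0 < c by rewrite divr_gt0// mulr_gt0// (lt_le_trans _ l2).
have c1 : c <= 1.
  by rewrite /c ler_pdivrMr ?mul1r; [lra|rewrite mulr_gt0// (lt_le_trans _ l2)].
exists (1 - c), (lam * x0); split; [lra|lra|by rewrite mulr_gt0|].
move=> y yx0.
have y0 : 0 < y by rewrite (lt_le_trans _ yx0)// mulr_gt0.
pose x := y / lam.
have yE : y = lam * x by rewrite /x; field; rewrite gt_eqF.
have xx0 : x0 <= x by rewrite /x ler_pdivlMr// mulrC.
have xgt0 : 0 < x by exact: lt_le_trans xx0.
have h1 := Hl _ xx0; have h2 := conc2_drop mu y0.
have h3 : conc2 y <= conc2 x by apply: conc2_le => //; rewrite yE ler_peMl// ltW.
rewrite -yE in h1.
have h4 : y ^+ 2 * (c * conc2 y) <= 3 / 4 * trunc2 y.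
  have -> : y ^+ 2 * (c * conc2 y) = 3 / 16 * (x ^+ 2 * conc2 y).
    by rewrite yE /c; field; rewrite gt_eqF.
  have : x ^+ 2 * conc2 y <= x ^+ 2 * conc2 x by rewrite ler_wpM2l ?sqr_ge0.
  lra.
have : y ^+ 2 * (c * conc2 y) <= y ^+ 2 * (conc2 y - conc2 (2 * y)).
  exact: le_trans h4 h2.
rewrite ler_pM2l ?exprn_gt0//; lra.
Qed.

Lemma conc2_iter (theta y0 : R) : 0 <= theta -> 0 < y0 ->
  (forall y, y0 <= y -> conc2 (2 * y) <= theta * conc2 y) ->
  forall k y, y0 <= y -> conc2 (2 ^+ k * y) <= theta ^+ k * conc2 y.
Proof.
move=> s0 x00 H; elim=> [|k IH] x xx0; first by rewrite !expr0 !mul1r.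
have h : y0 <= 2 ^+ k * x.
  by rewrite (le_trans xx0)// ler_peMl ?(le_trans (ltW x00))// exprn_ege1// ler1n.
rewrite !exprS -!mulrA; apply: (le_trans (H _ h)).
by rewrite ler_wpM2l// IH.
Qed.

(** A high enough power of the contraction factor beats the factor four by which
    [y ^+ 2] grows in a doubling. The quadratic decay makes the sum of the
    characteristic function over a grid converge. *)
Lemma conc2_power_decay (theta y0 : R) : 0 <= theta -> theta < 1 -> 0 < y0 ->
  (forall y, y0 <= y -> conc2 (2 * y) <= theta * conc2 y) ->
  exists r : nat, (0 < r)%N /\ forall x y, y0 <= x -> x <= y ->
    y ^+ 2 * conc2 y ^+ r <= 4 * (x ^+ 2 * conc2 x ^+ r).
Proof.
move=> t0 t1 y00 H.
have [r tr] := contraction_power t0 t1 (ltac:(lra) : 0 < 4^-1 :> R).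
have tr1 : theta ^+ r.+1 <= 4^-1.
  by apply: le_trans tr; rewrite exprS ler_piMl ?exprn_ge0// ltW.
exists r.+1; split => // x y xy0 xy.
have x0 : 0 < x by exact: lt_le_trans xy0.
apply: (@dyadic_ind _ (fun y => y ^+ 2 * conc2 y ^+ r.+1
   <= 4 * (x ^+ 2 * conc2 x ^+ r.+1)) x) => // {xy}{}y.
  move=> /andP[xy y2x].
  have y0' : 0 < y by exact: lt_le_trans xy.
  rewrite mulrA; apply: ler_pM.
  - exact: sqr_ge0.
  - by rewrite exprn_ge0// conc2_ge0.
  - rewrite (_ : 4 * x ^+ 2 = (2 * x) ^+ 2); last by ring.
    by rewrite lerXn2r ?nnegrE// ?mulr_ge0// ltW.
  - by rewrite lerXn2r ?nnegrE ?conc2_ge0// conc2_le.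
move=> xy; apply: le_trans.
have yy0 : y0 <= y by exact: le_trans xy.
have h : conc2 (2 * y) ^+ r.+1 <= 4^-1 * conc2 y ^+ r.+1.
  apply: (@le_trans _ _ ((theta * conc2 y) ^+ r.+1)).
    by rewrite lerXn2r ?nnegrE ?mulr_ge0 ?conc2_ge0// H.
  by rewrite exprMn ler_wpM2r// exprn_ge0// conc2_ge0.
rewrite (_ : (2 * y) ^+ 2 = y ^+ 2 * 4); last by ring.
rewrite -mulrA ler_wpM2l ?sqr_ge0//; lra.
Qed.

(** Karamata's theorem below exponent two, where a doubling divides the tail
    by less than four: a doubling adds at most [3 * x ^+ 2 * tail x] to
    [x ^+ 2 * conc2 x]. *)
Lemma conc2_le_tail (s x0 : R) : 4^-1 < s -> 0 < x0 ->
  (forall x, 0 < tail x) ->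
  (forall x, x0 <= x -> s * tail x <= tail (2 * x)) ->
  exists2 A : R, 0 < A & forall x, x0 <= x -> conc2 x <= A * tail x.
Proof.
move=> s4 x00 tpos H.
pose A := (tail (2 * x0))^-1 + 3 / (4 * s - 1).
have s41 : 0 < 4 * s - 1 by lra.
have i0 : 0 < (tail (2 * x0))^-1 by rewrite invr_gt0.
have j0 : 0 < 3 / (4 * s - 1) by rewrite divr_gt0.
have A0 : 0 < A by rewrite addr_gt0.
exists A => //.
have A1 : 3 <= A * (4 * s - 1).
  by rewrite /A mulrDl divfK ?gt_eqF// lerDr mulr_ge0// ltW.
apply: dyadic_ind => // y.
  move=> /andP[h1 h2]; apply: (le_trans (conc2_le1 mu y)).
  apply: (@le_trans _ _ (A * tail (2 * x0))).
    by rewrite /A mulrDl mulVf ?gt_eqF// lerDl mulr_ge0 ?ltW.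
  by rewrite ler_pM2l// tail_le.
move=> yx0 IH.
have y0 : 0 < y by exact: lt_le_trans yx0.
have h := capped2_double_le mu y0.
have y2 : 0 < y ^+ 2 by rewrite exprn_gt0.
have h' : 4 * conc2 (2 * y) <= conc2 y + 3 * tail y.
  rewrite -(ler_pM2l y2); apply: le_trans (le_trans h _); last lra.
  by rewrite le_eqVlt; apply/orP; left; apply/eqP; ring.
have h2 := H _ yx0; have ty := tpos y.
have : (A + 3) * tail y <= 4 * A * s * tail y.
  by rewrite ler_wpM2r; [|exact: ltW|lra].
have : 4 * A * (s * tail y) <= 4 * A * tail (2 * y).
  by rewrite ler_wpM2l//; lra.
lra.
Qed.

End TailDecay.

(** * First moments over shells *)

Section FirstMoments.
Context (R : realType) (mu : probability R R).
Local Notation tail := (tail mu).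

(** The first absolute moment carried by the annulus between the windows of
    radii [a] and [x]; for [a < 0] the inner window is empty. *)
Definition shell1 (a x : R) : R :=
  Ex mu (fun u => `|u| * exceeds a u * (1 - exceeds x u)).

Lemma bmeas_shell (a x : R) :
  bounded_measurable (fun u : R => `|u| * exceeds a u * (1 - exceeds x u)).
Proof.
apply: (@bmeas_inside _ (fun u => `|u| * exceeds a u) x x).
  apply: measurable_funM; last exact: measurable_exceeds.
  exact: normr_measurable.
move=> u ux; rewrite normrM normr_id (le_trans _ ux)// ler_piMr//.
by have /andP[h0 h1] := exceeds01 a u; rewrite ger0_norm.
Qed.

Lemma shell1_le_tail a x : 0 <= x -> shell1 a x <= x * tail a.
Proof.
move=> x0; rewrite /tail -Ex_scale; last exact: bmeas_exceeds.
apply: Ex_le => [||u].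
- exact: bmeas_shell.
- by apply: bmeas_mul; [exact: bmeas_cst|exact: bmeas_exceeds].
have /andP[h0 h1] := exceeds01 a u.
have [[-> h2]|[-> h2]] := exceedsP x u; first by rewrite subrr mulr0 mulr_ge0.
by rewrite subr0 mulr1 ler_wpM2r.
Qed.

Lemma shell1_double a x : 0 <= x -> shell1 a (2 * x) <= shell1 a x + 2 * x * tail x.
Proof.
move=> x0; rewrite /tail -Ex_scale; last exact: bmeas_exceeds.
rewrite -Ex_add; [|exact: bmeas_shell|by apply: bmeas_mul; [exact: bmeas_cst|exact: bmeas_exceeds]].
apply: Ex_le => [||u].
- exact: bmeas_shell.
- apply: bmeas_add; first exact: bmeas_shell.
  by apply: bmeas_mul; [exact: bmeas_cst|exact: bmeas_exceeds].
have /andP[h0 h1] := exceeds01 a u.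
have un := normr_ge0 u.
have [[-> h2]|[-> h2]] := exceedsP x u; have [[-> h3]|[-> h3]] := exceedsP (2 * x) u.
- by rewrite subrr !mulr0 add0r mulr1 mulr_ge0.
- rewrite subrr subr0 mulr0 add0r !mulr1 (le_trans _ h3)// ler_piMr//.
- by rewrite subrr subr0 !mulr0 !mulr1 addr0 mulr_ge0.
- by rewrite !subr0 mulr0 !mulr1 addr0.
Qed.

Lemma shell1_cat a x y : a <= x -> x <= y ->
  shell1 a y = shell1 a x + shell1 x y.
Proof.
move=> ax xy; rewrite /shell1 -Ex_add; [|exact: bmeas_shell..].
congr (Ex _ _); apply/funext => u.
have := exceeds_le u ax; have := exceeds_le u xy.
rewrite /exceeds; do 3 case: ifP => _; rewrite ?ler10//; move=> _ _; ring.
Qed.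

(** When the tail decays more slowly than [1 / x], the outermost dyadic shell
    carries a fixed part of the truncated first moment. *)
Lemma shell1_slow (s x0 : R) : 2^-1 < s -> 0 < x0 ->
  (forall x, 0 < tail x) ->
  (forall x, x0 <= x -> s * tail x <= tail (2 * x)) ->
  exists2 A : R, 0 < A &
    forall a x, x0 <= x -> shell1 a x <= A * (x * tail x).
Proof.
move=> s2 x00 tpos H.
have s21 : 0 < 2 * s - 1 by lra.
pose A := 2 * (tail (2 * x0))^-1 + 2 / (2 * s - 1).
have i0 : 0 < (tail (2 * x0))^-1 by rewrite invr_gt0.
have j0 : 0 < 2 / (2 * s - 1) by rewrite divr_gt0.
have A0 : 0 < A by rewrite addr_gt0// mulr_gt0.
have A1 : 2 <= A * (2 * s - 1).
  by rewrite /A mulrDl divfK ?gt_eqF// lerDr !mulr_ge0// ltW.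
exists A => // a; apply: dyadic_ind => // y.
  move=> /andP[h1 h2].
  have y0 : 0 < y by exact: lt_le_trans h1.
  apply: (le_trans (shell1_le_tail a (ltW y0))).
  have : tail a <= 1.
    rewrite -(Ex_cst mu 1); apply: Ex_le => [||u].
    - exact: bmeas_exceeds.
    - exact: bmeas_cst.
    - by case/andP: (exceeds01 a u).
  have : 1 <= A * tail y.
    apply: (@le_trans _ _ (A * tail (2 * x0))); last by rewrite ler_pM2l// tail_le.
    by rewrite /A mulrDl -mulrA mulVf ?gt_eqF//; have := mulr_gt0 j0 (tpos (2 * x0)); lra.
  move=> h3 h4; rewrite (mulrCA A) ler_pM2l//; exact: le_trans h3.
move=> yx0 IH.
have y0 : 0 < y by exact: lt_le_trans yx0.
apply: (le_trans (shell1_double a (ltW y0))).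
have h2 := H _ yx0; have ty := tpos y.
have h3 : (A + 2) * tail y <= 2 * A * s * tail y.
  by rewrite ler_wpM2r; [|exact: ltW|lra].
have h4 : 2 * A * (s * tail y) <= 2 * A * tail (2 * y).
  by rewrite ler_wpM2l//; lra.
have : y * ((A + 2) * tail y) <= y * (2 * A * tail (2 * y)).
  by rewrite ler_pM2l//; lra.
lra.
Qed.

(** At the critical exponent the first moment of a shell need not be of the
    order of [x * tail x]; the geometric mean of the tails at both ends is still a
    bound, and it suffices. *)
Lemma shell1_critical (s x0 : R) : 4^-1 < s -> 0 < x0 ->
  (forall x, 0 < tail x) ->
  (forall x, x0 <= x -> s * tail x <= tail (2 * x)) ->
  exists2 A : R, 0 < A & forall a x, x0 <= a -> a <= x ->
    shell1 a x <= A * (x * Num.sqrt (tail x * tail a)).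
Proof.
move=> s4 x00 tpos H.
pose q := Num.sqrt s.
have s0 : 0 < s by lra.
have q2 : q ^+ 2 = s by rewrite sqr_sqrtr// ltW.
have q0 : 0 < q by rewrite sqrtr_gt0.
have q12 : 2^-1 < q by rewrite -(@ltr_pXn2r _ 2)// ?nnegrE ?ltW// q2; lra.
have q21 : 0 < 2 * q - 1 by lra.
pose A := q^-1 + 2 / (2 * q - 1).
have i0 : 0 < q^-1 by rewrite invr_gt0.
have j0 : 0 < 2 / (2 * q - 1) by rewrite divr_gt0.
have A0 : 0 < A by rewrite addr_gt0.
have A1 : 2 <= A * (2 * q - 1).
  by rewrite /A mulrDl divfK ?gt_eqF// lerDr mulr_ge0// ltW.
exists A => // a x ax0 ax.
have a0 : 0 < a by exact: lt_le_trans ax0.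
pose g y := Num.sqrt (tail y * tail a).
have g0 y : 0 < g y by rewrite sqrtr_gt0 mulr_gt0.
have gstep y : x0 <= y -> q * g y <= g (2 * y).
  move=> yx0; rewrite /g /q -(sqrtrM _ (ltW s0)).
  by apply: ler_wsqrtr; rewrite mulrA ler_pM2r// H.
have gtail y : a <= y -> tail y <= g y.
  move=> ay; have ty := ltW (tpos y).
  rewrite -[X in X <= _](ger0_norm ty) -sqrtr_sqr expr2; apply: ler_wsqrtr.
  by rewrite ler_wpM2l// tail_le.
apply: (@dyadic_ind _ (fun x => shell1 a x <= A * (x * g x)) a) => // {ax}{}x.
  move=> /andP[h1 h2].
  have y0 : 0 < x by exact: lt_le_trans h1.
  apply: (le_trans (shell1_le_tail a (ltW y0))).
  rewrite (mulrCA A) ler_pM2l//.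
  have h3 : g (2 * a) <= g x.
    by apply: ler_wsqrtr; rewrite ler_pM2r// tail_le.
  have h4 := gstep _ ax0.
  have h5 : g a = tail a by rewrite /g -expr2 sqrtr_sqr ger0_norm// ltW.
  rewrite -h5; apply: (@le_trans _ _ (q^-1 * g x)).
    by rewrite mulrC ler_pdivlMr// mulrC (le_trans h4).
  by rewrite ler_pM2r// lerDl ltW.
move=> yx0 IH.
have y0 : 0 < x by exact: lt_le_trans yx0.
apply: (le_trans (shell1_double a (ltW y0))).
have h2 := gstep _ (le_trans ax0 yx0); have ty := g0 x; have h5 := gtail _ yx0.
have h3 : (A + 2) * g x <= 2 * A * q * g x.
  by rewrite ler_wpM2r; [|exact: ltW|lra].
have h4 : 2 * A * (q * g x) <= 2 * A * g (2 * x).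
  by rewrite ler_wpM2l//; lra.
have : x * ((A + 2) * g x) <= x * (2 * A * g (2 * x)).
  by rewrite ler_pM2l//; lra.
have : x * tail x <= x * g x by rewrite ler_pM2l.
lra.
Qed.

(** When the tail decays faster than [1 / x], the innermost dyadic shell
    carries a fixed part of the first moment outside the window. *)
Lemma shell1_fast (s x0 : R) : 0 <= s -> s < 2^-1 -> 0 < x0 ->
  (forall x, x0 <= x -> tail (2 * x) <= s * tail x) ->
  exists2 A : R, 0 < A & forall n x, x0 <= x ->
    shell1 x (2 ^+ n * x) <= A * (x * tail x).
Proof.
move=> s0 s2 x00 H.
have s21 : 0 < 1 - 2 * s by lra.
pose A := 2 / (1 - 2 * s).
have A0 : 0 < A by rewrite divr_gt0.
have A1 : A * (1 - 2 * s) = 2 by rewrite /A divfK// gt_eqF.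
exists A => //; elim=> [|n IH] x xx0.
  have x0' : 0 < x by exact: lt_le_trans xx0.
  rewrite expr0 mul1r /shell1.
  rewrite (_ : (fun _ => _) = cst 0); last first.
    by apply/funext => u /=; rewrite /exceeds; case: ifP => _; ring.
  rewrite Ex_cst; apply: mulr_ge0; first exact: ltW.
  by apply: mulr_ge0; [exact: ltW|exact: tail_ge0].
have x0' : 0 < x by exact: lt_le_trans xx0.
have x2 : x <= 2 * x by lra.
have p1 : 1 <= 2 ^+ n :> R by rewrite exprn_ege1// ler1n.
rewrite exprSr -mulrA (@shell1_cat x (2 * x))//; last first.
  by rewrite ler_peMl//; lra.
have h1 : shell1 x (2 * x) <= 2 * x * tail x.
  by apply: shell1_le_tail; lra.
have h2 := IH (2 * x) (le_trans xx0 x2).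
have h3 : A * (2 * x * tail (2 * x)) <= A * (2 * x * (s * tail x)).
  by rewrite !ler_pM2l ?H// mulr_gt0.
have : A * (x * tail x) = A * (2 * x * (s * tail x)) + 2 * x * tail x.
  by rewrite -[X in _ = _ + X * _ * _]A1; ring.
lra.
Qed.

(** Fatou's lemma along the truncation windows passes from bounded functions to
    a nonnegative one. *)
Lemma integral_le_trunc (f : R -> R) (B : R) : measurable_fun setT f ->
  (forall u, 0 <= f u) ->
  (forall n : nat, exists2 x : R, n%:R <= x &
     bounded_measurable (fun u => f u * (1 - exceeds x u)) /\
     Ex mu (fun u => f u * (1 - exceeds x u)) <= B) ->
  (\int[mu]_u (f u)%:E <= B%:E)%E.
Proof.
move=> mf f0 H.
pose g n u := (f u * (1 - exceeds (n%:R : R) u))%:E.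
have mg n : measurable_fun setT (g n).
  apply/measurable_EFinP; apply: measurable_funM => //.
  by apply: measurable_funB => //; exact: measurable_exceeds.
have g0 n u : (0 <= g n u)%E.
  rewrite lee_fin mulr_ge0// subr_ge0.
  by case/andP: (exceeds01 (n%:R : R) u).
have gB n : (\int[mu]_u g n u <= B%:E)%E.
  have [x nx bBx] := H n; have [bx Bx] := bBx.
  have fE : (\int[mu]_u (f u * (1 - exceeds x u))%:E =
      (Ex mu (fun u => f u * (1 - exceeds x u)))%:E)%E.
    by rewrite fineK//; apply: integrable_fin_num => //; exact: bmeas_integrable.
  apply: (@le_trans _ _ (\int[mu]_u (f u * (1 - exceeds x u))%:E)%E); last first.
    by rewrite fE lee_fin.
  apply: ge0_le_integral => //.
  - by apply/measurable_EFinP; case: bx.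
  - by move=> u _; rewrite lee_fin ler_wpM2l// lerD2l lerN2 exceeds_le.
have -> : (\int[mu]_u (f u)%:E = \int[mu]_u limn_einf (g^~ u))%E.
  apply: eq_integral => u _.
  have : g^~ u @ \oo --> (f u)%:E.
    apply: cvg_near_cst.
    exists (Num.truncn `|u|).+1 => // n /= un.
    have un' : `|u| < n%:R.
      by rewrite (lt_le_trans (truncnS_gt _))// ler_nat.
    rewrite /g; have [[_ h]|[-> _]] := exceedsP (n%:R : R) u.
      by move: un'; rewrite ltNge h.
    by rewrite subr0 mulr1.
  move=> h; rewrite is_cvg_limn_einfE; last by apply/cvg_ex; exists (f u)%:E.
  by apply/esym/cvg_lim.
apply: (le_trans (fatou mu measurableT mg (fun n u _ => g0 n u))).
rewrite limn_einf_lim; apply: lime_le; first exact: is_cvg_einfs.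
apply: nearW => n; apply: le_trans (gB n).
by apply: ereal_inf_lbound; exists n => /=.
Qed.

Lemma trunc2_unbounded (B : R) :
  (\int[mu]_u (u ^+ 2)%:E = +oo)%E ->
  exists2 x0 : R, 0 < x0 & forall x, x0 <= x -> B <= trunc2 mu x.
Proof.
move=> Hoo; apply: contrapT => H.
suff : (\int[mu]_u (u ^+ 2)%:E <= B%:E)%E by rewrite Hoo leye_eq.
apply: integral_le_trunc.
- exact: exprn_measurable.
- by move=> u; exact: sqr_ge0.
move=> n; apply: contrapT => H1; apply: H.
exists n.+1%:R => // x nx.
rewrite leNgt; apply/negP => xB; apply: H1; exists x.
  by rewrite (le_trans _ nx)// ler_nat.
by split; [exact: bmeas_sqr_inside|exact: ltW].
Qed.

Lemma conc2_gt0 x : (\int[mu]_u (u ^+ 2)%:E = +oo)%E -> 0 < x -> 0 < conc2 mu x.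
Proof.
move=> Hoo x0; have [y0 y00 Hy] := trunc2_unbounded 1 Hoo.
pose y := x + y0.
have y0' : 0 < y by rewrite addr_gt0.
have xy : x <= y by rewrite lerDl ltW.
apply: (@lt_le_trans _ _ (conc2 mu y)); last exact: conc2_le.
have h := conc2_split mu y0'.
have : 1 <= trunc2 mu y by apply: Hy; rewrite lerDr ltW.
have y2 : 0 < y ^+ 2 by rewrite exprn_gt0.
have t := tail_ge0 mu y.
have : 0 <= y ^+ 2 * tail y by rewrite mulr_ge0// ltW.
move=> h1 h2; rewrite -(pmulr_rgt0 _ y2) h; lra.
Qed.

End FirstMoments.

(** * The local bound *)

Section LocalBound.
Context d (T : measurableType d) (R : realType) (P : probability T R).
Variables (X : {RV P >-> R}) (Xs : nat -> {RV P >-> R}).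
Hypothesis copies : independent_copies X Xs.
Let mu : probability R R := distribution P X.

Lemma Ex_law (f : R -> R) : bounded_measurable f ->
  Ex P (fun w => f (X w)) = Ex mu f.
Proof.
move=> bf; congr fine.
have mf : measurable_fun setT (EFin \o f) by apply/measurable_EFinP; case: bf.
rewrite (@integral_distribution _ _ _ _ _ P X (EFin \o f))//.
by apply: (bmeas_integrable P (bmeas_comp _ bf)); exact: measurable_funPT.
Qed.

Lemma Ex_copy_law (f : R -> R) i : bounded_measurable f ->
  Ex P (fun w => f (Xs i w)) = Ex mu f.
Proof. by move=> bf; rewrite (Ex_copy copies _ bf) Ex_law. Qed.

(** Keeping one copy in a fixed bounded set and letting the other range over
    the truncation window bounds the symmetrised law from below. *)
Lemma char2_gap (s x0 : R) : 0 <= s -> s < 1 -> 0 < x0 ->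
  (forall x, x0 <= x -> tail mu (2 * x) <= s * tail mu x) ->
  (\int[mu]_u (u ^+ 2)%:E = +oo)%E ->
  exists c y1 : R, [/\ 0 < c, 0 < y1 &
    forall x, y1 <= x -> c * conc2 mu x <= 1 - char2 X x^-1].
Proof.
move=> s0 s1 x00 H Hoo.
have [eta [e0 e1 Heta]] := cos_ge_half R.
have Hcos := one_sub_cos_ge Heta.
have [lam l1 Hl] := capped2_le_trunc2 s0 s1 x00 H.
have lgt0 : 0 < lam by exact: lt_le_trans l1.
have [k sk] := contraction_power s0 s1 (ltac:(lra) : 0 < 2^-1 :> R).
pose A := 2 ^+ k * x0.
have A0 : 0 < A by rewrite mulr_gt0// exprn_gt0.
have tA : tail mu A <= 2^-1.
  apply: (le_trans (tail_iter s0 x00 H k (lexx _))).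
  apply: le_trans sk; rewrite ler_piMr// ?exprn_ge0//.
  rewrite -(Ex_cst mu 1); apply: Ex_le => [||u].
  - exact: bmeas_exceeds.
  - exact: bmeas_cst.
  - by case/andP: (exceeds01 x0 u).
have [x2 x20 Hx2] := trunc2_unbounded (8 * A ^+ 2) Hoo.
pose kap := eta / (2 * lam).
have k0 : 0 < kap by rewrite divr_gt0// mulr_gt0.
have k1 : kap <= 1.
  by rewrite /kap ler_pdivrMr ?mul1r ?mulr_gt0//; lra.
pose y1 := x0 / kap + 2 * A / eta + 2 * x2 / eta.
exists (kap ^+ 2 / (32 * 16)), y1; split.
- by apply: divr_gt0; [exact: exprn_gt0|exact: mulr_gt0].
- by rewrite !addr_gt0// ?divr_gt0// mulr_gt0.
move=> x yx.
have p1 : 0 < x0 / kap by rewrite divr_gt0.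
have p2 : 0 < 2 * A / eta by rewrite divr_gt0// mulr_gt0.
have p3 : 0 < 2 * x2 / eta by rewrite divr_gt0// mulr_gt0.
have q1 : x0 <= kap * x by rewrite mulrC -ler_pdivrMr//; rewrite /y1 in yx; lra.
have q2 : 2 * A <= eta * x.
  by rewrite (mulrC eta) -ler_pdivrMr//; rewrite /y1 in yx; lra.
have q3 : 2 * x2 <= eta * x.
  by rewrite (mulrC eta) -ler_pdivrMr//; rewrite /y1 in yx; lra.
have x0' : 0 < x by rewrite /y1 in yx; lra.
pose r := eta * x / 2.
have rE : r = lam * (kap * x) by rewrite /r /kap; field; rewrite gt_eqF.
have kx0 : 0 < kap * x by rewrite mulr_gt0.
have h1 := Hl _ q1; rewrite -rE in h1.
have h2 : 8 * A ^+ 2 <= trunc2 mu r by apply: Hx2; rewrite /r; lra.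
have h3 : conc2 mu x <= conc2 mu (kap * x).
  by apply: conc2_le => //; rewrite ler_piMl// ltW.
pose phi u := u ^+ 2 * exceeds (2 * A) u * (1 - exceeds r u).
pose psi v := 1 - exceeds A v.
have bphi : bounded_measurable phi.
  apply: (@bmeas_inside _ (fun u => u ^+ 2 * exceeds (2 * A) u) r (r ^+ 2)).
    apply: measurable_funM; last exact: measurable_exceeds.
    exact: exprn_measurable.
  move=> u ur; have /andP[g0 g1] := exceeds01 (2 * A) u.
  rewrite normrM (ger0_norm g0) normrX.
  apply: (@le_trans _ _ (`|u| ^+ 2)); first by rewrite ler_piMr// sqr_ge0.
  by rewrite lerXn2r ?nnegrE// (le_trans _ ur).
have bpsi : bounded_measurable psi.
  by apply: bmeas_sub; [exact: bmeas_cst|exact: bmeas_exceeds].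
have Epsi : 2^-1 <= Ex mu psi.
  rewrite /psi Ex_sub ?Ex_cst; [|exact: bmeas_cst|exact: bmeas_exceeds].
  by move: tA; rewrite /tail; lra.
have Ephi : trunc2 mu r / 2 <= Ex mu phi.
  have : trunc2 mu r - (2 * A) ^+ 2 <= Ex mu phi.
    rewrite -(Ex_cst mu ((2 * A) ^+ 2)) -Ex_sub; [|exact: bmeas_sqr_inside|exact: bmeas_cst].
    apply: Ex_le => [||u] //.
      by apply: bmeas_sub; [exact: bmeas_sqr_inside|exact: bmeas_cst].
    rewrite /phi; have /andP[g0 g1] := exceeds01 r u.
    have [[-> f1]|[-> f1]] := exceedsP (2 * A) u.
      by rewrite mulr1 gerBl sqr_ge0.
    rewrite mulr0 mul0r subr_le0 -(real_normK (num_real u)).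
    apply: (@le_trans _ _ (`|u| ^+ 2)).
      by rewrite ler_piMr ?sqr_ge0//; lra.
    by rewrite lerXn2r ?nnegrE// mulr_ge0// ltW.
  by lra.
(* On the event that [psi] and [phi] select, the two copies differ by at least
   half of the first one and by at most [eta * x]. *)
have main : (32 * x ^+ 2)^-1 * (Ex mu phi * Ex mu psi) <= 1 - char2 X x^-1.
  have [Xind _] := copies.
  have UV := indep_pair Xind (isT : 0 != 1)%N.
  have bphi0 : bounded_measurable (fun w => phi (Xs 0%N w) * psi (Xs 1%N w)).
    by apply: bmeas_mul; [apply: (bmeas_comp _ bphi)|apply: (bmeas_comp _ bpsi)];
      exact: measurable_funPT.
  have bcos : bounded_measurable (fun w => cos (x^-1 * (Xs 0%N w - Xs 1%N w))).
    have mD : measurable_fun setT (fun w => Xs 0%N w - Xs 1%N w).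
      by apply: measurable_funB; exact: measurable_funPT.
    have := bmeas_comp mD (bmeas_cos x^-1 0).
    by under [X in bounded_measurable X]eq_fun do rewrite subr0.
  rewrite -(Ex_copy_law 0 bphi) -(Ex_copy_law 1 bpsi) -(Ex_indep UV bphi bpsi).
  have -> : 1 - char2 X x^-1
      = Ex P (fun w => 1 - cos (x^-1 * (Xs 0%N w - Xs 1%N w))).
    by rewrite (char2E copies) Ex_sub ?Ex_cst//; exact: bmeas_cst.
  rewrite -Ex_scale//; apply: Ex_le => [||w].
  - by apply: bmeas_mul => //; exact: bmeas_cst.
  - by apply: bmeas_sub => //; exact: bmeas_cst.
  set u := Xs 0%N w; set v := Xs 1%N w.
  have cle : 0 <= 1 - cos (x^-1 * (u - v)) by rewrite subr_ge0 cos_le1.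
  rewrite /phi /psi.
  have [[-> f1]|[-> f1]] := exceedsP A v; first by rewrite subrr !mulr0.
  have [[-> f2]|[-> f2]] := exceedsP r u; first by rewrite subrr !(mulr0, mul0r).
  have [[-> f3]|[-> f3]] := exceedsP (2 * A) u; last by rewrite !(mulr0, mul0r).
  rewrite !subr0 !mulr1.
  have uv : `|u| / 2 <= `|u - v|.
    by have := lerB_dist u v; lra.
  have uvr : `|x^-1 * (u - v)| <= eta.
    rewrite normrM gtr0_norm ?invr_gt0// mulrC ler_pdivrMr//.
    by have := ler_normB u v; rewrite /r in f2; lra.
  apply: le_trans (Hcos _ uvr).
  have -> : (x^-1 * (u - v)) ^+ 2 / 8 = (32 * x ^+ 2)^-1 * (4 * `|u - v| ^+ 2).
    rewrite real_normK ?num_real//; field; by rewrite gt_eqF.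
  rewrite ler_pM2l ?invr_gt0 ?mulr_gt0 ?exprn_gt0//.
  rewrite -(real_normK (num_real u)).
  have : (`|u| / 2) ^+ 2 <= `|u - v| ^+ 2 by rewrite lerXn2r ?nnegrE// divr_ge0.
  by lra.
apply: le_trans main.
have E1 : (kap * x) ^+ 2 * conc2 mu x / 16 <= Ex mu phi * Ex mu psi.
  have : (kap * x) ^+ 2 * conc2 mu x <= (kap * x) ^+ 2 * conc2 mu (kap * x).
    by rewrite ler_wpM2l ?sqr_ge0.
  move=> h4.
  have Ap : 0 <= A ^+ 2 by rewrite sqr_ge0.
  have : trunc2 mu r / 2 * 2^-1 <= Ex mu phi * Ex mu psi.
    by apply: ler_pM => //; lra.
  by lra.
have -> : kap ^+ 2 / (32 * 16) * conc2 mu x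
   = (32 * x ^+ 2)^-1 * ((kap * x) ^+ 2 * conc2 mu x / 16).
  by field; rewrite gt_eqF.
by rewrite ler_pM2l// invr_gt0 mulr_gt0// exprn_gt0.
Qed.

Lemma sum_inv_sqr_le (N : nat) : \sum_(j < N) ((j.+1)%:R ^+ 2)^-1 <= 2 :> R.
Proof.
have : \sum_(j < N.+1) ((j.+1)%:R ^+ 2)^-1 <= 2 - (N.+1%:R)^-1 :> R.
  elim: N => [|N IH]; first by rewrite big_ord_recr big_ord0/= add0r expr1n invr1; lra.
  rewrite big_ord_recr/=; apply: (@le_trans _ _ (2 - N.+1%:R^-1 + (N.+2%:R ^+ 2)^-1)).
    by rewrite lerD2r.
  have n1 : 0 < N.+1%:R :> R by rewrite ltr0n.
  have -> : N.+2%:R = N.+1%:R + 1 :> R by rewrite -addn1 natrD.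
  set x : R := N.+1%:R in n1 *.
  rewrite -subr_ge0.
  have -> : 2 - (x + 1)^-1 - (2 - x^-1 + ((x + 1) ^+ 2)^-1)
     = (x * (x + 1) ^+ 2)^-1.
    by field; apply/andP; split; rewrite gt_eqF//; lra.
  by rewrite invr_ge0 mulr_ge0 ?sqr_ge0// ltW.
rewrite big_ord_recr/= => h; apply: le_trans (le_trans h _).
  by rewrite lerDl invr_ge0 sqr_ge0.
by rewrite gerBl invr_ge0.
Qed.

(** The local bound: on the grid of mesh [1 / a] the [k]-th power of the
    characteristic function decays like [1 / j ^ 2], so the concentration of
    the sum at a fixed scale is of order [1 / a]. *)
Lemma local_bound (c y1 theta y0 h c0 : R) :
  0 < c -> 0 < y1 ->
  (forall x, y1 <= x -> c * conc2 mu x <= 1 - char2 X x^-1) ->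
  0 <= theta -> theta < 1 -> 0 < y0 ->
  (forall y, y0 <= y -> conc2 mu (2 * y) <= theta * conc2 mu y) ->
  (forall x, 0 < x -> 0 < conc2 mu x) ->
  0 < h -> 0 < c0 ->
  exists2 C : R, 0 < C & forall (a : R) (k m : nat) (y : R), 0 < a ->
    c0 <= k%:R * conc2 mu a ->
    fine (P [set w | `|walk Xs m k w - y| <= h]) <= C / a.
Proof.
move=> cpos y1pos Hgap t0 t1 y0pos Hcon Kpos h0 c00.
have [eta [e0 _ Heta]] := cos_ge_half R.
have [r [r0 Hr]] := conc2_power_decay t0 t1 y0pos Hcon.
pose z := y0 + y1.
have z0 : 0 < z by rewrite addr_gt0.
pose tau := Num.min (eta / h) z^-1.
have tau0 : 0 < tau by rewrite lt_min divr_gt0//= invr_gt0.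
pose e : R := c / (2 * r%:R).
have rR : 0 < r%:R :> R by rewrite ltr0n.
have epos : 0 < e by rewrite divr_gt0// mulr_gt0.
pose B := 4 / (e * c0) ^+ r.
have ec : 0 < (e * c0) ^+ r by rewrite exprn_gt0// mulr_gt0.
have B0 : 0 < B by rewrite divr_gt0.
pose D := 1 + 4 * B.
have D0 : 0 < D by rewrite /D; lra.
exists (32 * D / tau + tau^-1).
  by rewrite addr_gt0 ?invr_gt0// divr_gt0// mulr_gt0.
move=> a k m y a0 kc.
have ta0 : 0 < (32 * D / tau) / a by rewrite !divr_gt0// mulr_gt0.
have [ta1|ta1] := ltP (tau * a) 1.
  rewrite mulrDl -[X in X <= _]add0r; apply: (@le_trans _ _ (32 * D / tau / a + 1)).
    apply: lerD; first exact: ltW.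
    by apply: prob_fine_le1; exact: measurable_dist_le.
  by rewrite lerD2l -invfM invf_ge1 ?mulr_gt0// ltW.
(* The grid stops at a fixed frequency [tau]: small enough for the kernel to see
   the scale [h], and for [a / j] to stay where [conc2] contracts. *)
pose N := Num.truncn (tau * a).
have NE : N%:R <= tau * a < N.+1%:R.
  by apply: truncn_itv; rewrite mulr_ge0// ltW.
have N0 : (0 < N)%N.
  rewrite lt0n; apply/eqP => N0; move: NE => /andP[_]; rewrite N0.
  by move=> /(le_lt_trans ta1); rewrite ltxx.
have NR : 0 < N%:R :> R by rewrite ltr0n.
have NR1 : 1 <= N%:R :> R by rewrite ler1n.
have Nlow : tau * a <= 2 * N%:R.
  by case/andP: NE => _; rewrite -addn1 natrD; lra.
have Nup : N%:R <= tau * a by case/andP: NE.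
pose g (j : nat) : R := D * ((j.+1)%:R ^+ 2)^-1.
have gpos j : 0 <= g j.
  by rewrite /g mulr_ge0 ?(ltW D0)// invr_ge0 sqr_ge0.
have gsum : \sum_(j < N) g j <= D * 2.
  by rewrite /g -mulr_sumr ler_pM2l// sum_inv_sqr_le.
(* [exp (- v) <= (r / v) ^+ r] turns the decay of the [r]-th power of [conc2]
   into that of the characteristic function; the shift in [g] covers [j = 0]. *)
have key j : (j < N)%N -> char2 X (j%:R * a^-1) ^+ k <= g j ^+ 2.
  case: j => [_|j jN].
    rewrite mul0r (_ : char2 X 0 = 1); last first.
      rewrite /char2; under eq_fun do rewrite mul0r cos0.
      under [X in _ + Ex P X ^+ 2]eq_fun do rewrite mul0r sin0.
      by rewrite !Ex_cst expr1n expr0n addr0.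
    rewrite expr1n exprn_ege1// /g expr1n invr1 mulr1 /D; lra.
  have jR : 0 < j.+1%:R :> R by rewrite ltr0n.
  have jR1 : 1 <= j.+1%:R :> R by rewrite ler1n.
  pose x := a / j.+1%:R.
  have x0 : 0 < x by rewrite divr_gt0.
  have xE : j.+1%:R * a^-1 = x^-1 by rewrite /x invf_div mulrC.
  have xz : z <= x.
    rewrite /x ler_pdivlMr//.
    have jt : j.+1%:R <= tau * a.
      by apply: le_trans Nup; rewrite ler_nat ltnW.
    have tz : tau <= z^-1 by rewrite ge_min lexx orbT.
    have : z * (tau * a) <= a.
      have : z * tau <= z * z^-1 by rewrite ler_pM2l.
      by rewrite mulfV ?gt_eqF// mulrA => zt; rewrite ler_piMl ?(ltW a0).
    by apply: le_trans; rewrite ler_wpM2l// ltW.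
  have xy0 : y0 <= x by apply: le_trans xz; rewrite lerDl ltW.
  have xy1 : y1 <= x by apply: le_trans xz; rewrite lerDr ltW.
  have xa : x <= a by rewrite /x ler_pdivrMr// ler_peMr// ltW.
  have dec := Hr _ _ xy0 xa.
  have Kx := Kpos _ x0; have Ka := Kpos _ a0.
  pose w := k%:R * conc2 mu x.
  have wpow : j.+1%:R ^+ 2 / 4 * c0 ^+ r <= w ^+ r.
    have h1 : c0 ^+ r <= k%:R ^+ r * conc2 mu a ^+ r.
      by rewrite -exprMn lerXn2r ?nnegrE ?mulr_ge0// ltW.
    have h2 : j.+1%:R ^+ 2 / 4 * conc2 mu a ^+ r <= conc2 mu x ^+ r.
      have x2 : 0 < x ^+ 2 by rewrite exprn_gt0.
      rewrite -(ler_pM2l x2); move: dec.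
      have -> : a ^+ 2 = x ^+ 2 * j.+1%:R ^+ 2.
        by rewrite -exprMn /x divfK// gt_eqF.
      by lra.
    rewrite /w exprMn.
    have h3 : k%:R ^+ r * (j.+1%:R ^+ 2 / 4 * conc2 mu a ^+ r)
       <= k%:R ^+ r * conc2 mu x ^+ r by rewrite ler_wpM2l// exprn_ge0.
    apply: le_trans h3.
    rewrite mulrCA ler_wpM2l// divr_ge0// sqr_ge0.
  rewrite xE.
  have c2 : char2 X x^-1 <= expR (- (c * conc2 mu x)).
    by apply: le_trans (expR_ge1Dx _); have := Hgap _ xy1; lra.
  have c20 : 0 <= char2 X x^-1 by rewrite addr_ge0// sqr_ge0.
  have w0 : 0 <= w by rewrite mulr_ge0// ltW.
  pose E := expR (e * w) ^+ r.
  have E0 : 0 < E by rewrite exprn_gt0// expR_gt0.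
  have Ew : (e * w) ^+ r <= E.
    have ew0 : 0 <= e * w by rewrite mulr_ge0// ltW.
    rewrite lerXn2r ?nnegrE ?expR_ge0//.
    by apply: le_trans (expR_ge1Dx _); rewrite lerDr.
  have EE : (E ^-1) ^+ 2 = expR (- (c * conc2 mu x)) ^+ k.
    rewrite /E -!expRM_natl -expRN -expRM_natl; congr expR.
    by rewrite /w /e; field; rewrite gt_eqF.
  apply: (@le_trans _ _ ((E^-1) ^+ 2)).
    rewrite EE lerXn2r ?nnegrE// expR_ge0//.
  rewrite lerXn2r ?nnegrE ?invr_ge0 ?(ltW E0)//.
  have jpos : 0 < j.+1%:R ^+ 2 :> R by rewrite exprn_gt0.
  have EB : j.+1%:R ^+ 2 / B <= E.
    apply: le_trans Ew; rewrite exprMn /B invf_div exprMn.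
    have : e ^+ r * (j.+1%:R ^+ 2 / 4 * c0 ^+ r) <= e ^+ r * w ^+ r.
      by rewrite ler_wpM2l// exprn_ge0// ltW.
    by lra.
  have : E^-1 <= B / j.+1%:R ^+ 2.
    by rewrite -[X in _ <= X]invf_div lef_pV2// posrE divr_gt0.
  move=> h1; apply: (le_trans h1).
  rewrite /g; apply: (@le_trans _ _ ((4 * B) * (j.+2%:R ^+ 2)^-1)); last first.
    by rewrite ler_wpM2r ?invr_ge0 ?sqr_ge0// /D; lra.
  have j2pos : 0 < j.+2%:R ^+ 2 :> R by rewrite exprn_gt0.
  have jj : j.+2%:R ^+ 2 <= 4 * j.+1%:R ^+ 2 :> R.
    have -> : 4 * j.+1%:R ^+ 2 = (2 * j.+1%:R) ^+ 2 :> R by rewrite exprMn; ring.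
    rewrite lerXn2r ?nnegrE ?mulr_ge0//.
    by rewrite -(addn1 j.+1) natrD; lra.
  rewrite ler_pdivrMr// mulrAC ler_pdivlMr//.
  have : B * j.+2%:R ^+ 2 <= B * (4 * j.+1%:R ^+ 2) by rewrite ler_pM2l.
  by lra.
have := @concentration _ _ _ P (walk Xs m k) y h a^-1 eta (D * 2) N g Heta N0.
rewrite invr_ge0 (ltW a0) => /(_ isT).
have -> : N%:R * a^-1 * h <= eta.
  rewrite mulrAC ler_pdivrMr//.
  have th : tau <= eta / h by rewrite ge_min lexx.
  move: th; rewrite ler_pdivlMr// => th.
  apply: (@le_trans _ _ (tau * a * h)); first by rewrite ler_pM2r.
  by rewrite mulrAC ler_pM2r.
move=> /(_ isT gpos gsum) => H1.
apply: (le_trans (H1 _)).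
  by move=> j jN; apply: (Ex_cos_walk_le copies) => //; exact: key.
apply: (@le_trans _ _ (32 * D / tau / a)); last first.
  by rewrite ler_pM2r ?invr_gt0// lerDl invr_ge0 ltW.
rewrite ler_pdivrMr//.
have -> : 32 * D / tau / a * N%:R = (16 * D) * (2 * N%:R / (tau * a)).
  by field; apply/andP; split; rewrite gt_eqF.
have : 1 <= 2 * N%:R / (tau * a) by rewrite ler_pdivlMr ?mulr_gt0// mul1r.
move=> h1; have : 16 * D * 1 <= 16 * D * (2 * N%:R / (tau * a)).
  by rewrite ler_pM2l// mulr_gt0.
by lra.
Qed.

End LocalBound.

(** * Deviations by truncation *)

Section Deviation.
Context d (T : measurableType d) (R : realType) (P : probability T R).
Variables (X : {RV P >-> R}) (Xs : nat -> {RV P >-> R}).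
Hypothesis copies : independent_copies X Xs.
Let mu : probability R R := distribution P X.

Definition trunc1 (nu : probability R R) (x : R) : R :=
  Ex nu (fun u => u * (1 - exceeds x u)).

Lemma bmeas_id_inside (x : R) :
  bounded_measurable (fun u : R => u * (1 - exceeds x u)).
Proof. by apply: (@bmeas_inside _ id x x) => //. Qed.

Lemma trunc_variance_le (x : R) : 0 < x ->
  Ex mu (fun u => (u * (1 - exceeds x u) - trunc1 mu x) ^+ 2)
    <= x ^+ 2 * conc2 mu x.
Proof.
move=> x0; set m1 := trunc1 mu x.
have bt := bmeas_id_inside x.
have -> : (fun u => (u * (1 - exceeds x u) - m1) ^+ 2) =
   (fun u => u ^+ 2 * (1 - exceeds x u)
      + (m1 ^+ 2 - 2 * m1 * (u * (1 - exceeds x u)))).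
  apply/funext => u; rewrite /exceeds; case: ifP => _; ring.
have b2 : bounded_measurable (fun u : R => 2 * m1 * (u * (1 - exceeds x u))).
  by apply: bmeas_mul => //; exact: bmeas_cst.
rewrite Ex_add; [|exact: bmeas_sqr_inside|apply: bmeas_sub => //; exact: bmeas_cst].
rewrite Ex_sub//; last exact: bmeas_cst.
rewrite Ex_cst Ex_scale// -/(trunc1 mu x) -/m1 conc2_split// -/(trunc2 mu x).
have : 0 <= m1 ^+ 2 by exact: sqr_ge0.
have : 0 <= x ^+ 2 * tail mu x by rewrite mulr_ge0 ?sqr_ge0// tail_ge0.
lra.
Qed.

(** The copies are pairwise uncorrelated after centring. *)
Lemma Ex_sum_sqr (g : R -> R) (m k : nat) : bounded_measurable g ->
  Ex mu g = 0 ->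
  Ex P (fun w => (\sum_(i < k) g (Xs (m + i)%N w)) ^+ 2)
    = k%:R * Ex mu (fun u => g u ^+ 2).
Proof.
move=> bg g0.
have bgX i : bounded_measurable (fun w => g (Xs i w)).
  by apply: (bmeas_comp _ bg); exact: measurable_funPT.
have [Xind _] := copies.
under eq_fun do rewrite expr2 mulr_suml.
under eq_fun do under eq_bigr do rewrite mulr_sumr.
rewrite Ex_sum; last by move=> i; apply: bmeas_sum => j; exact: bmeas_mul.
rewrite (_ : _ * _ = \sum_(i < k) Ex mu (fun u => g u ^+ 2)); last first.
  by rewrite sumr_const card_ord -[RHS]mulr_natl.
apply: eq_bigr => i _; rewrite Ex_sum; last by move=> j; exact: bmeas_mul.
rewrite (bigD1 i)//= big1 ?addr0.
  under eq_fun do rewrite -expr2.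
  exact: (Ex_copy_law copies _ (bmeas_sqr bg)).
move=> j ji; have UV : indep2 P (Xs (m + i)%N) (Xs (m + j)%N).
  apply: (indep_pair Xind); rewrite eqn_add2l; apply: contra ji => /eqP ij.
  by apply/eqP/val_inj.
by rewrite (Ex_indep UV bg bg) (Ex_copy_law copies _ bg) g0 mul0r.
Qed.

Lemma measurable_dist_ge (U : {RV P >-> R}) (y h : R) :
  measurable [set w | h <= `|U w - y|].
Proof.
have mf : measurable_fun setT (fun u : R => `|u - y|).
  by apply: measurableT_comp => //; apply: measurable_funB.
rewrite (_ : [set w | _] = U @^-1` ((fun u => `|u - y|) @^-1` `[h, +oo[)).
  apply: measurable_preimage; rewrite -[X in measurable X]setTI.
  by apply: mf => //; exact: measurable_itv.
by rewrite predeqE => w /=; rewrite in_itv/= andbT.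
Qed.

(** Either some step leaves the window, which costs [k * tail x], or the walk
    equals its truncation, to which Chebyshev's inequality applies: the bias
    takes half of [x / 3] and leaves [x / 6], whence the factor [36]. *)
Lemma deviation_bound (m k : nat) (x b : R) : 0 < x ->
  k%:R * `|trunc1 mu x - b| <= x / 6 ->
  fine (P [set w | x / 3 <= `|walk Xs m k w - k%:R * b|])
    <= 37 * k%:R * conc2 mu x.
Proof.
move=> x0 bias; set m1 := trunc1 mu x in bias.
have x2 : 0 < x ^+ 2 by rewrite exprn_gt0.
pose g u := u * (1 - exceeds x u) - m1.
have bg : bounded_measurable g.
  by apply: bmeas_sub; [exact: bmeas_id_inside|exact: bmeas_cst].
have g0 : Ex mu g = 0.
  rewrite /g Ex_sub; [|exact: bmeas_id_inside|exact: bmeas_cst].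
  by rewrite Ex_cst subrr.
have bgX i : bounded_measurable (fun w => g (Xs i w)).
  by apply: (bmeas_comp _ bg); exact: measurable_funPT.
have beX i : bounded_measurable (fun w => exceeds x (Xs i w)).
  by apply: (bmeas_comp _ (bmeas_exceeds x)); exact: measurable_funPT.
pose Z w := \sum_(i < k) g (Xs (m + i)%N w).
have bZ2 : bounded_measurable (fun w => Z w ^+ 2).
  by apply: bmeas_sqr; exact: bmeas_sum.
pose N w := \sum_(i < k) exceeds x (Xs (m + i)%N w).
have bN : bounded_measurable N by apply: bmeas_sum.
have bcZ : bounded_measurable (fun w => 36 / x ^+ 2 * Z w ^+ 2).
  by apply: bmeas_mul => //; exact: bmeas_cst.
apply: (@le_trans _ _ (Ex P (fun w => N w + 36 / x ^+ 2 * Z w ^+ 2))).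
  rewrite -Ex_indic; last exact: measurable_dist_ge.
  apply: Ex_le => [||w].
  - by apply: bmeas_indic; exact: measurable_dist_ge.
  - exact: bmeas_add.
  have Z0 : 0 <= 36 / x ^+ 2 * Z w ^+ 2.
    by rewrite mulr_ge0 ?sqr_ge0// divr_ge0// ltW.
  have e0 i : 0 <= exceeds x (Xs (m + i)%N w).
    by case/andP: (exceeds01 x (Xs (m + i)%N w)).
  have N0 : 0 <= N w by apply: sumr_ge0.
  rewrite indicE; have [|_] := boolP (w \in _); last by rewrite addr_ge0.
  rewrite inE/= => dev.
  have [[i ei]|noexc] := pselect (exists i : 'I_k, exceeds x (Xs (m + i)%N w) = 1).
    rewrite -[X in X <= _]addr0 lerD// /N (bigD1 i)//= ei lerDl.
    by apply: sumr_ge0.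
  have e00 (i : 'I_k) : exceeds x (Xs (m + i)%N w) = 0.
    have [[h _]|[h _]] := exceedsP x (Xs (m + i)%N w) => //.
    by exfalso; apply: noexc; exists i.
  have WZ : walk Xs m k w = Z w + k%:R * m1.
    rewrite /Z /walk (_ : k%:R * m1 = \sum_(i < k) m1); last first.
      by rewrite sumr_const card_ord -[RHS]mulr_natl.
    rewrite -big_split/=; apply: eq_bigr => i _.
    by rewrite /g e00 subr0 mulr1 subrK.
  have Zx : x / 6 <= `|Z w|.
    have : `|walk Xs m k w - k%:R * b| <= `|Z w| + k%:R * `|m1 - b|.
      rewrite WZ (_ : _ - _ = Z w + k%:R * (m1 - b)); last by ring.
      by rewrite (le_trans (ler_normD _ _))// normrM ger0_norm.
    by lra.
  rewrite -[X in X <= _]add0r lerD//.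
  rewrite -(real_normK (num_real (Z w))) mulrAC ler_pdivlMr// mul1r.
  have : (x / 6) ^+ 2 <= `|Z w| ^+ 2.
    by rewrite lerXn2r ?nnegrE// divr_ge0// ltW.
  by lra.
rewrite Ex_add// Ex_scale// Ex_sum//.
rewrite (@Ex_sum_sqr g m k bg g0).
have -> : \sum_(i < k) Ex P (fun w => exceeds x (Xs (m + i)%N w))
    = k%:R * tail mu x.
  rewrite (eq_bigr (fun _ => tail mu x)).
    by rewrite sumr_const card_ord -[LHS]mulr_natl.
  by move=> i _; exact: (Ex_copy_law copies _ (bmeas_exceeds x)).
have h1 := tail_le_conc2 mu x0; have h2 := trunc_variance_le x0.
have h3 : k%:R * tail mu x <= k%:R * conc2 mu x by rewrite ler_wpM2l.
have h4 : 36 / x ^+ 2 * (k%:R * Ex mu (fun u => g u ^+ 2))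
   <= 36 / x ^+ 2 * (k%:R * (x ^+ 2 * conc2 mu x)).
  by rewrite ler_wpM2l ?divr_ge0// ?(ltW x2)// ler_wpM2l.
have h5 : 36 / x ^+ 2 * (k%:R * (x ^+ 2 * conc2 mu x)) = 36 * k%:R * conc2 mu x.
  by field; rewrite gt_eqF.
lra.
Qed.

(** If the sum is far from its centre, one of the two halves is; the other
    half is independent of it and spread out. *)
Lemma halves_bound (k l : nat) (x y b h q : R) :
  2 * x / 3 + h <= `|y - (k + l)%:R * b| ->
  (forall z, fine (P [set w | `|walk Xs 0 k w - z| <= h]) <= q) ->
  (forall z, fine (P [set w | `|walk Xs k l w - z| <= h]) <= q) ->
  fine (P [set w | `|walk Xs 0 (k + l) w - y| <= h])
  <= q * (fine (P [set w | x / 3 <= `|walk Xs 0 k w - k%:R * b|])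
        + fine (P [set w | x / 3 <= `|walk Xs k l w - l%:R * b|])).
Proof.
move=> xy qk ql; have [Xind _] := copies.
have UV := indep_walk_walk Xind k l.
have VU : indep2 P (walk Xs k l) (walk Xs 0 k).
  by move=> A B mA mB; rewrite setIC UV// muleC.
pose E := [set p : R * R | `|p.1 + p.2 - y| <= h].
have mE : measurable E.
  have mf : measurable_fun setT (fun p : R * R => `|p.1 + p.2 - y|).
    apply: measurableT_comp => //; apply: measurable_funB => //.
    by apply: measurable_funD; [exact: measurable_fst|exact: measurable_snd].
  rewrite (_ : E = (fun p : R * R => `|p.1 + p.2 - y|) @^-1` `]-oo, h]).
    rewrite -[X in measurable X]setTI.
    by apply: mf => //; exact: measurable_itv.
  by rewrite predeqE => p /=; rewrite in_itv.
have mD c : measurable [set u : R | x / 3 <= `|u - c|].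
  have mf : measurable_fun setT (fun u : R => `|u - c|).
    by apply: measurableT_comp => //; apply: measurable_funB.
  rewrite (_ : [set u | _] = (fun u => `|u - c|) @^-1` `[x / 3, +oo[).
    rewrite -[X in measurable X]setTI.
    by apply: mf => //; exact: measurable_itv.
  by rewrite predeqE => u /=; rewrite in_itv/= andbT.
have sec (V : {RV P >-> R}) :
    (forall z, fine (P [set w | `|V w - z| <= h]) <= q) ->
    forall u, (P (V @^-1` xsection E u) <= q%:E)%E.
  move=> qV u; have := qV (y - u).
  rewrite -lee_fin fineK ?fin_num_measure//; last exact: measurable_dist_le.
  apply: le_trans; rewrite le_eqVlt; apply/orP; left; apply/eqP; congr (P _).
  rewrite predeqE => w; rewrite /xsection/= inE /E/=.
  by rewrite (_ : u + V w - y = V w - (y - u)); last by ring.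
have b1 := joint_section_bound UV (mD (k%:R * b)) mE (sec _ ql).
have b2 := joint_section_bound VU (mD (l%:R * b)) mE (sec _ qk).
have mEw : measurable [set w | `|walk Xs 0 (k + l) w - y| <= h].
  exact: measurable_dist_le.
have mj (U V : {RV P >-> R}) : measurable (joint U V @^-1` E).
  by rewrite -[X in measurable X]setTI; exact: measurable_joint.
have mp (U : {RV P >-> R}) c : measurable (U @^-1` [set u | x / 3 <= `|u - c|]).
  exact: measurable_preimage.
rewrite -lee_fin fineK ?fin_num_measure// EFinM EFinD.
rewrite !fineK ?fin_num_measure//; [|exact: measurable_dist_ge..].
rewrite ge0_muleDr//.
apply: le_trans (leeD b1 b2).
apply: le_trans (measureU2 _ _ _); [|exact: measurableI..].
apply: le_measure; rewrite ?inE//; first by apply: measurableU; exact: measurableI.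
move=> w /=; rewrite walk_cat /joint/= => Ew.
have [d1|d1] := leP (x / 3) `|walk Xs 0 k w - k%:R * b|.
  by left; split.
right; split; first by rewrite /E/= (addrC (walk Xs k l w)).
rewrite leNgt; apply/negP => d2.
have : `|y - (k + l)%:R * b| <= `|walk Xs 0 k w - k%:R * b|
   + `|walk Xs k l w - l%:R * b| + `|walk Xs 0 k w + walk Xs k l w - y|.
  rewrite (_ : y - (k + l)%:R * b = (walk Xs 0 k w - k%:R * b)
    + (walk Xs k l w - l%:R * b) - (walk Xs 0 k w + walk Xs k l w - y)).
    by rewrite (le_trans (ler_normB _ _))// lerD2r ler_normD.
  by rewrite natrD; ring.
by lra.
Qed.

End Deviation.

(** * Regular variation of the tail *)

Section NearInfinity.
Context (R : realType).

Lemma near_pinftyP (Q : R -> Prop) : (\forall x \near +oo, Q x) ->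
  exists2 M : R, 0 < M & forall x, M <= x -> Q x.
Proof.
move=> [M [_ HM]]; exists (`|M| + 1); first by rewrite ltr_wpDl.
move=> x Mx; apply: HM; rewrite (lt_le_trans _ Mx)//.
by rewrite (le_lt_trans (ler_norm M))// ltrDl.
Qed.

Lemma near_pinfty_ge (Q : R -> Prop) (M : R) : (forall x, M <= x -> Q x) ->
  \forall x \near +oo, Q x.
Proof.
by move=> HM; exists M; split; [exact: num_real|move=> x /ltW; exact: HM].
Qed.

Lemma near_double (Q : R -> Prop) : (\forall x \near +oo, Q x) ->
  \forall x \near +oo, Q (2 * x).
Proof.
move=> /near_pinftyP[M M0 HM]; apply: (@near_pinfty_ge _ M) => x Mx.
by apply: HM; lra.
Qed.

Lemma eventually_lower_bound (u : nat -> R) (n0 : nat) :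
  (forall n, (1 <= n)%N -> 0 < u n) ->
  forall c : R, 0 < c ->
  (forall n, (n0 <= n)%N -> c <= u n) ->
  exists2 c' : R, 0 < c' & forall n, (1 <= n)%N -> c' <= u n.
Proof.
move=> u0; elim: n0 => [|n0 IH] c c0 H; first by exists c => // n _; exact: H.
have [n00|n0pos] := posnP n0.
  by exists c => // n n1; apply: H; rewrite n00.
apply: (IH (Num.min c (u n0))); first by rewrite lt_min c0 u0.
move=> n; rewrite leq_eqVlt => /predU1P[<-|/H h]; first by rewrite ge_min lexx orbT.
by rewrite ge_min h.
Qed.

End NearInfinity.

Section RegularVariation.
Context d (T : measurableType d) (R : realType) (P : probability T R).
Variables (X : {RV P >-> R}) (alpha p q : R) (ell : R -> R).
Hypotheses (alpha_gt0 : 0 < alpha) (alpha_le2 : alpha <= 2).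
Hypothesis X_sq : ('E_P[fun w => (X w ^+ 2)%R] = +oo)%E.
Hypothesis ell_gt0 : forall x : R, 0 <= x -> 0 < ell x.
Hypothesis ell_cont : {within `[0, +oo[, continuous ell}.
Hypothesis ell_sv : slowly_varying ell.
Hypothesis pq_gt0 : 0 < p + q.
Hypothesis right_tail : asymp_cst (fun x => fine (P [set w | x < X w])) p
                            (fun x => ell x * x `^ (- alpha)).
Hypothesis left_tail : asymp_cst (fun x => fine (P [set w | X w <= - x])) q
                            (fun x => ell x * x `^ (- alpha)).
Let mu : probability R R := distribution P X.

Lemma tail_split (x : R) : 0 < x ->
  tail mu x = fine (P [set w | x < X w]) + fine (P [set w | X w <= - x]).
Proof.
move=> x0.
have m1 : measurable [set w | x < X w].
  rewrite (_ : [set w | _] = X @^-1` `]x, +oo[); first by apply: measurable_preimage; exact: measurable_itv.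
  by rewrite predeqE => w /=; rewrite in_itv/= andbT.
have m2 : measurable [set w | X w <= - x].
  rewrite (_ : [set w | _] = X @^-1` `]-oo, -x]); first by apply: measurable_preimage; exact: measurable_itv.
  by rewrite predeqE => w /=; rewrite in_itv/=.
rewrite /tail -(Ex_law X (bmeas_exceeds x)) -!Ex_indic// -Ex_add//;
  [|exact: bmeas_indic..].
congr (Ex P _); apply/funext => w; rewrite !indicE /exceeds.
have [xX|Xx] := ltP x (X w) => /=.
  rewrite mem_set// memNset ?addr0//= => Xx; lra.
rewrite (memNset (A := [set w | x < X w])) ?add0r//=; last by apply/negP; rewrite -leNgt.
have [Xx'|xX'] := leP (X w) (- x); first by rewrite mem_set.
by rewrite memNset//=; apply/negP; rewrite -ltNge.
Qed.

Lemma tail_asymp : asymp_cst (tail mu) (p + q) (fun x => ell x * x `^ (- alpha)).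
Proof.
have [e1 [e1c e1E]] := right_tail; have [e2 [e2c e2E]] := left_tail.
exists (fun x => e1 x + e2 x); split.
  by rewrite -[X in _ --> X]addr0; exact: cvgD.
have p0 : \forall x \near +oo, 0 < x :> R.
  by apply: (@near_pinfty_ge _ _ 1) => x; lra.
near=> x.
rewrite tail_split; last by near: x.
rewrite (near e1E x)// (near e2E x)//; ring.
Unshelve. all: by end_near.
Qed.

(** Up to constants the slowly varying function is given by the monotone
    function [tail]; monotonicity stands in for the uniform convergence
    theorem. *)
Lemma tail_comparable : exists c1 c2 x1 : R, [/\ 0 < c1, 0 < c2, 0 < x1 &
  forall x, x1 <= x -> c1 * tail mu x <= ell x * x `^ (- alpha) /\
                       ell x * x `^ (- alpha) <= c2 * tail mu x].
Proof.
have [e [ec eE]] := tail_asymp.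
pose c := p + q; have c0 : 0 < c by []; rewrite -/c in eE.
have c2 : 0 < c / 2 by rewrite divr_gt0.
move/cvgrPdist_le : ec => /(_ _ c2) ec.
have [M M0 HM] := near_pinftyP (filterI eE ec).
exists (2 * c)^-1, (2 / c), M; split => //.
- by rewrite invr_gt0 mulr_gt0.
- by rewrite divr_gt0.
move=> x Mx; have [-> ] := HM x Mx.
rewrite sub0r normrN ler_norml => /andP[h1 h2].
have x0 : 0 < x by exact: lt_le_trans Mx.
have g0 : 0 < ell x * x `^ (- alpha) by rewrite mulr_gt0 ?ell_gt0 ?powR_gt0// ltW.
set g := ell x * _ in g0 *; split.
  rewrite mulrA ler_piMl ?(ltW g0)// ler_pdivrMl ?mulr_gt0//; lra.
rewrite mulrA ler_peMl ?(ltW g0)// mulrAC ler_pdivlMr//; lra.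
Qed.

Lemma tail_gt0 x : 0 < tail mu x.
Proof.
have [c1 [c2 [x1 [c10 c20 x10 H]]]] := tail_comparable.
pose y := Num.max x x1.
have x1y : x1 <= y by rewrite le_max lexx orbT.
have y0 : 0 < y by exact: lt_le_trans x1y.
have [_ h] := H y x1y.
apply: (@lt_le_trans _ _ (tail mu y)); last by apply: (tail_le mu); rewrite le_max lexx.
rewrite -(pmulr_rgt0 _ c20); apply: lt_le_trans h.
by rewrite mulr_gt0 ?ell_gt0 ?powR_gt0// ltW.
Qed.

Lemma tail_ratio : tail mu (2 * x) / tail mu x @[x --> +oo] --> 2 `^ (- alpha).
Proof.
have [e [ec eE]] := tail_asymp.
have e2c : e (2 * x) @[x --> +oo] --> (0 : R).
  apply/cvgrPdist_le => d0 d00.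
  apply: (@near_double _ (fun x => `|0 - e x| <= d0)).
  by move/cvgrPdist_le : ec => /(_ _ d00).
pose c := p + q; have c0 : 0 < c by []; rewrite -/c in eE.
have cn0 : c != 0 by rewrite gt_eqF.
have cD (f : R -> R) : f x @[x --> +oo] --> (0 : R) -> c + f x @[x --> +oo] --> c.
  move=> f0; rewrite -[X in _ --> X]addr0.
  by apply: cvgD => //; exact: cvg_cst.
have l1 : (c + e (2 * x)) / (c + e x) @[x --> +oo] --> c / c.
  exact: cvgM (cD (fun x => e (2 * x)) e2c) (cvgV cn0 (cD e ec)).
have l2 : ell (2 * x) / ell x @[x --> +oo] --> (1 : R) by exact: ell_sv.
have lim : ((c + e (2 * x)) / (c + e x)) * (ell (2 * x) / ell x) * 2 `^ (- alpha)
    @[x --> +oo] --> 2 `^ (- alpha).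
  have := cvgM (cvgM l1 l2) (cvg_cst (2 `^ (- alpha))).
  rewrite mulfV// !mul1r => h; exact: h.
apply: cvg_trans lim; apply: near_eq_cvg.
have [M M0 HM] := near_pinftyP eE.
apply: (@near_pinfty_ge _ _ M) => x Mx.
have x0 : 0 < x by exact: lt_le_trans Mx.
have tx := tail_gt0 x.
have h1 := HM x Mx; have h2 : tail mu (2 * x) = _ := HM (2 * x) (ltac:(lra)).
rewrite h2; rewrite h1 in tx *.
have gx : 0 < ell x by rewrite ell_gt0// ltW.
have pw : 0 < x `^ (- alpha) by rewrite powR_gt0.
have cex : c + e x != 0.
  by apply: contraTneq tx => ->; rewrite mul0r ltxx.
rewrite powRM ?ltW//; field.
by rewrite cex !gt_eqF.
Qed.

Lemma tail_ratio_lt (s : R) : 2 `^ (- alpha) < s ->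
  exists2 x0 : R, 0 < x0 & forall x, x0 <= x -> tail mu (2 * x) <= s * tail mu x.
Proof.
move=> hs; have [M M0 HM] := near_pinftyP (cvgr_le _ tail_ratio _ hs).
by exists M => // x /HM; rewrite ler_pdivrMr// tail_gt0.
Qed.

Lemma tail_ratio_gt (s : R) : s < 2 `^ (- alpha) ->
  exists2 x0 : R, 0 < x0 & forall x, x0 <= x -> s * tail mu x <= tail mu (2 * x).
Proof.
move=> hs; have [M M0 HM] := near_pinftyP (cvgr_ge _ tail_ratio _ hs).
by exists M => // x /HM; rewrite ler_pdivlMr// tail_gt0.
Qed.

Lemma pow2_lt (b c : R) : b < c -> 2 `^ b < 2 `^ c :> R.
Proof.
by move=> bc; rewrite /powR; rewrite (_ : (2 == 0 :> R) = false) ?pnatr_eq0//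
  ltr_expR ltr_pM2r// ln_gt0// ltr1n.
Qed.

Lemma law_sq : (\int[mu]_u (u ^+ 2)%:E = +oo)%E.
Proof.
rewrite -X_sq unlock ge0_integral_distribution//.
- by apply/measurable_EFinP; exact: exprn_measurable.
- by move=> u; rewrite lee_fin sqr_ge0.
Qed.

(** * The capped second moment against [tilde_ell] *)

Lemma ell_div_continuous (b : R) :
  {within `[1, b], continuous (fun u => ell u / u)}.
Proof.
have cl : {within `[1, b], continuous ell}.
  apply: continuous_subspaceW ell_cont => u /=; rewrite !in_itv/= andbT.
  by move=> /andP[u1 _]; lra.
have ci : {within `[1, b], continuous (fun u : R => u^-1)}.
  apply: continuous_in_subspaceT => u; rewrite inE/= in_itv/= => /andP[u1 _].
  by apply: inv_continuous; rewrite gt_eqF//; lra.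
by move=> u; apply: cvgM; [exact: cl|exact: ci].
Qed.

Lemma ell_div_integrable (b : R) :
  (@lebesgue_measure R).-integrable `[1, b] (EFin \o (fun u => ell u / u)).
Proof.
apply: continuous_compact_integrable; first exact: segment_compact.
exact: ell_div_continuous.
Qed.

Lemma ell_div_increment (x m M : R) : 0 <= x ->
  (forall u, 1 + x <= u <= 1 + 2 * x -> m <= ell u / u <= M) ->
  m * x <= \int[@lebesgue_measure R]_(u in `[1, 1 + 2 * x]) (ell u / u)
         - \int[@lebesgue_measure R]_(u in `[1, 1 + x]) (ell u / u) <= M * x.
Proof.
move=> x0 H.
rewrite Rintegral_itvB; [|exact: ell_div_integrable|by rewrite bnd_simp; lra..].
have mD : measurable (`](1 + x)%R, (1 + 2 * x)%R] : set R) by exact: measurable_itv.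
have muD : fine (@lebesgue_measure R `](1 + x)%R, (1 + 2 * x)%R]) = x.
  rewrite lebesgue_measure_itv/= lte_fin.
  case: ifPn => [_|h]; first by rewrite -EFinD/=; ring.
  by rewrite -leNgt in h; rewrite [LHS](_ : _ = 0)//; lra.
have fD : (@lebesgue_measure R `](1 + x)%R, (1 + 2 * x)%R] < +oo)%E.
  by rewrite lebesgue_measure_itv/= lte_fin; case: ifP => _; rewrite ?ltry// -EFinD ltry.
have ic (c : R) : (@lebesgue_measure R).-integrable
    `](1 + x)%R, (1 + 2 * x)%R] (EFin \o (fun _ => c)).
  apply: measurable_bounded_integrable => //.
  by exists `|c|; split => [|y cy u _ /=]; [rewrite num_real|exact: ltW].
have il : (@lebesgue_measure R).-integrable
    `](1 + x)%R, (1 + 2 * x)%R] (EFin \o (fun u => ell u / u)).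
  apply: (integrableS _ _ _ (ell_div_integrable (1 + 2 * x))) => // u /=.
  by rewrite !in_itv/= => /andP[h1 h2]; rewrite h2 andbT; lra.
have cE (c : R) : \int[@lebesgue_measure R]_(u in `](1 + x)%R, (1 + 2 * x)%R]) c = c * x.
  by rewrite Rintegral_cst// [X in _ * X]muD.
rewrite -(cE m) -(cE M); apply/andP; split; apply: le_Rintegral => // u /=;
  rewrite in_itv/= => /andP[h1 h2].
- by have /andP[] := H u (ltac:(by rewrite h2 (ltW h1))).
- by have /andP[] := H u (ltac:(by rewrite h2 (ltW h1))).
Qed.

Local Notation L := (tilde_ell alpha ell).

Lemma tilde_ell_ge1 x : alpha = 2 -> 0 <= x -> 1 <= L x.
Proof.
move=> a2 x0; rewrite /tilde_ell a2 eqxx lerDl; apply: Rintegral_ge0 => u /=.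
rewrite in_itv/= => /andP[u1 _]; rewrite divr_ge0 ?(ltW (ell_gt0 _))//; lra.
Qed.

Lemma tilde_ell_lower x1 : 0 <= x1 ->
  exists2 m : R, 0 < m & forall x, 0 <= x <= x1 -> m <= L x.
Proof.
move=> x10; have [a2|a2] := eqVneq alpha 2.
  by exists 1 => // x /andP[x0 _]; exact: tilde_ell_ge1.
have cl : {within `[0, x1], continuous ell}.
  apply: continuous_subspaceW ell_cont => u /=; rewrite !in_itv/= andbT.
  by move=> /andP[].
have [c /[!in_itv]/= /andP[c0 _] Hc] := EVT_min x10 cl.
exists (ell c); first exact: ell_gt0.
by move=> x xx1; rewrite /tilde_ell (negbTE a2); apply: Hc; rewrite in_itv.
Qed.

Lemma tilde_ell_gt0 x : 0 <= x -> 0 < L x.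
Proof.
by move=> x0; have [m m0 H] := tilde_ell_lower x0; apply: (lt_le_trans m0 (H x _)); rewrite x0 lexx.
Qed.

(** Karamata's theorem at exponent two: both sides have comparable increments
    over dyadic blocks. *)
Lemma conc2_tilde_ell_eq2 : alpha = 2 ->
  exists A B x1 : R, [/\ 0 < A, 0 < B, 0 < x1 & forall x, x1 <= x ->
    x ^+ 2 * conc2 mu x <= A * L x /\ L x <= B * (x ^+ 2 * conc2 mu x)].
Proof.
move=> a2.
have [c1 [c2 [x1 [c10 c20 x10 H]]]] := tail_comparable.
have h8 : 8^-1 < 2 `^ (- alpha) :> R.
  rewrite a2 powR_invn// ltf_pV2 ?posrE//; lra.
have [x2 x20 H8] := tail_ratio_gt h8.
pose x0 := x1 + x2 + 1.
have x00 : 0 < x0 by rewrite /x0; lra.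
have sq (u : R) : 0 < u -> u `^ (- alpha) = (u ^+ 2)^-1.
  by move=> u0; rewrite a2 powR_invn// ltW.
have LE x : L x = 1 + \int[@lebesgue_measure R]_(u in `[1, 1 + x]) (ell u / u).
  by rewrite /tilde_ell a2 eqxx.
have inc x : x0 <= x ->
   c1 / 64 * (x ^+ 2 * tail mu x) <= L (2 * x) - L x <= 4 * c2 * (x ^+ 2 * tail mu x).
  move=> xx0.
  have xp : 0 < x by exact: lt_le_trans xx0.
  have x11 : 1 <= x by rewrite /x0 in xx0; lra.
  have t4 : tail mu x / 64 <= tail mu (4 * x).
    have e1 := H8 x (ltac:(rewrite /x0 in xx0; lra)).
    have := H8 (2 * x) (ltac:(rewrite /x0 in xx0; lra)).
    by rewrite (_ : 2 * (2 * x) = 4 * x); [lra|ring].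
  have hyp u : 1 + x <= u <= 1 + 2 * x ->
      c1 * x * tail mu (4 * x) <= ell u / u <= c2 * (4 * x) * tail mu x.
    move=> /andP[u1 u2].
    have u0 : 0 < u by lra.
    have [g1 g2] := H u (ltac:(rewrite /x0 in xx0; lra)).
    rewrite sq// in g1 g2.
    have -> : ell u / u = u * (ell u * (u ^+ 2)^-1) by field; rewrite gt_eqF.
    have tu : tail mu (4 * x) <= tail mu u by apply: tail_le; lra.
    have tu' : tail mu u <= tail mu x by apply: tail_le; lra.
    have t0 := tail_ge0 mu (4 * x); have t0' := tail_ge0 mu u.
    apply/andP; split.
      apply: (@le_trans _ _ (x * (c1 * tail mu u))).
        rewrite [X in X <= _](_ : _ = x * (c1 * tail mu (4 * x))); last by ring.
        by rewrite ler_pM2l// ler_pM2l.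
      apply: ler_pM => //; [exact: ltW|by rewrite mulr_ge0// ltW|lra].
    apply: (@le_trans _ _ (4 * x * (c2 * tail mu u))).
      apply: ler_pM => //; [exact: ltW| |lra].
      by rewrite mulr_ge0 ?invr_ge0 ?sqr_ge0// ltW// ell_gt0// ltW.
    rewrite [X in _ <= X](_ : _ = 4 * x * (c2 * tail mu x)); last by ring.
    by rewrite ler_pM2l ?mulr_gt0// ler_pM2l.
  have /andP[h1 h2] := ell_div_increment (ltW xp) hyp.
  have -> : L (2 * x) - L x
      = \int[@lebesgue_measure R]_(u in `[1, 1 + 2 * x]) (ell u / u)
      - \int[@lebesgue_measure R]_(u in `[1, 1 + x]) (ell u / u).
    by rewrite !LE; ring.
  have xx2 : 0 <= c1 * x ^+ 2 by rewrite mulr_ge0 ?sqr_ge0// ltW.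
  apply/andP; split; last by lra.
  apply: le_trans h1.
  have : c1 * x ^+ 2 * (tail mu x / 64) <= c1 * x ^+ 2 * tail mu (4 * x).
    by rewrite ler_wpM2l.
  by lra.
have Lmono x : x0 <= x -> L x <= L (2 * x).
  move=> /[dup] xx0 /inc /andP[h _].
  have : 0 <= c1 / 64 * (x ^+ 2 * tail mu x).
    apply: mulr_ge0; first by rewrite divr_ge0// ltW.
    by rewrite mulr_ge0 ?sqr_ge0// tail_ge0.
  lra.
have L1 x : 0 <= x -> 1 <= L x by exact: tilde_ell_ge1.
pose U x := x ^+ 2 * conc2 mu x.
have Upos : 0 < U x0.
  by rewrite /U mulr_gt0 ?exprn_gt0// conc2_gt0// law_sq.
have Umono x y : 0 < x -> x <= y -> U x <= U y.
  move=> x_0 xy; have y_0 : 0 < y by exact: lt_le_trans xy.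
  rewrite /U /conc2 -!Ex_scale; [|exact: bmeas_cap..].
  apply: Ex_le => [||u].
  - by apply: bmeas_mul; [exact: bmeas_cst|exact: bmeas_cap].
  - by apply: bmeas_mul; [exact: bmeas_cst|exact: bmeas_cap].
  have xy2 : x ^+ 2 <= y ^+ 2 by rewrite lerXn2r ?nnegrE// ltW.
  rewrite !minr_pMr ?sqr_ge0// !mulr1 le_min; apply/andP; split.
    by rewrite ge_min xy2.
  rewrite !(mulrCA _ (u ^+ 2)) !mulfV ?mulr1 ?expf_neq0 ?gt_eqF//.
  by rewrite ge_min lexx orbT.
pose A := 4 * x0 ^+ 2 + 192 / c1.
have j0 : 0 < 192 / c1 by rewrite divr_gt0.
have x02 : 0 < x0 ^+ 2 by rewrite exprn_gt0.
have A0 : 0 < A by rewrite /A; lra.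
have Ac : 192 <= A * c1.
  by rewrite /A mulrDl divfK ?gt_eqF// lerDr !mulr_ge0// ltW.
have [Lm Lm0 HLm] : exists2 M : R, 0 < M & forall x, x0 <= x <= 2 * x0 -> L x <= M.
  exists (L (2 * x0)); first by apply: lt_le_trans (L1 _ _) => //; lra.
  move=> x /andP[h1 h2]; rewrite !LE lerD2l.
  rewrite -subr_ge0 Rintegral_itvB; [|exact: ell_div_integrable|by rewrite bnd_simp; lra..].
  apply: Rintegral_ge0 => u /=; rewrite in_itv/= => /andP[h3 h4].
  by rewrite divr_ge0 ?(ltW (ell_gt0 _))//; lra.
pose B := Lm / U x0 + 32 * c2 / 3.
have i0 : 0 < Lm / U x0 by rewrite divr_gt0.
have B0 : 0 < B by rewrite /B; lra.
exists A, B, x0; split => // x xx0; split.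
  apply: (@dyadic_ind _ (fun x => x ^+ 2 * conc2 mu x <= A * L x) x0) => // {xx0}{}x.
    move=> /andP[h1 h2].
    apply: (@le_trans _ _ (x ^+ 2 * 1)); first by rewrite ler_wpM2l ?sqr_ge0// conc2_le1.
    rewrite mulr1; apply: (@le_trans _ _ (4 * x0 ^+ 2)).
      rewrite (_ : 4 * x0 ^+ 2 = (2 * x0) ^+ 2); last by ring.
      by rewrite lerXn2r ?nnegrE//; lra.
    apply: (@le_trans _ _ (A * 1)); first by rewrite /A; lra.
    by rewrite ler_pM2l// L1//; lra.
  move=> xx0 IH; have x_0 : 0 < x by exact: lt_le_trans xx0.
  have /andP[h1 _] := inc _ xx0.
  have h2 := capped2_double_le mu x_0.
  have t0 : 0 <= x ^+ 2 * tail mu x by rewrite mulr_ge0 ?sqr_ge0// tail_ge0.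
  have : A * (c1 / 64 * (x ^+ 2 * tail mu x)) <= A * (L (2 * x) - L x).
    by rewrite ler_pM2l.
  have : 192 * (x ^+ 2 * tail mu x) <= A * c1 * (x ^+ 2 * tail mu x).
    by rewrite ler_wpM2r.
  by lra.
apply: (@dyadic_ind _ (fun x => L x <= B * (x ^+ 2 * conc2 mu x)) x0) => // {xx0}{}x.
  move=> h; have /andP[h1 h2] := h; apply: (le_trans (HLm _ h)).
  have UU : U x0 <= x ^+ 2 * conc2 mu x by exact: Umono.
  apply: (@le_trans _ _ (B * U x0)); last by rewrite ler_pM2l.
  by rewrite /B mulrDl divfK ?gt_eqF// lerDl mulr_ge0 ?(ltW Upos)//; lra.
move=> xx0 IH; have x_0 : 0 < x by exact: lt_le_trans xx0.
have /andP[_ h1] := inc _ xx0.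
have h2 := capped2_double_ge mu x_0.
have t2 : 0 <= x ^+ 2 * tail mu (2 * x) by rewrite mulr_ge0 ?sqr_ge0// tail_ge0.
have h3 : x ^+ 2 * tail mu x <= 8 * (x ^+ 2 * tail mu (2 * x)).
  have := H8 x (ltac:(rewrite /x0 in xx0; lra)).
  move=> e1; have : x ^+ 2 * (8^-1 * tail mu x) <= x ^+ 2 * tail mu (2 * x).
    by rewrite ler_wpM2l ?sqr_ge0.
  by lra.
have h4 : B * (x ^+ 2 * conc2 mu x + 3 * x ^+ 2 * tail mu (2 * x))
   <= B * ((2 * x) ^+ 2 * conc2 mu (2 * x)) by rewrite ler_pM2l.
have h5 : 32 * c2 / 3 * (3 * (x ^+ 2 * tail mu (2 * x)))
   <= B * (3 * (x ^+ 2 * tail mu (2 * x))).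
  have t6 : 0 <= 3 * (x ^+ 2 * tail mu (2 * x)) by rewrite mulr_ge0.
  by rewrite ler_wpM2r// /B; lra.
have h6 : 4 * c2 * (x ^+ 2 * tail mu x) <= 4 * c2 * (8 * (x ^+ 2 * tail mu (2 * x))).
  by rewrite ler_wpM2l ?mulr_ge0// ltW.
by lra.
Qed.

Lemma conc2_comparable : exists A B x1 : R, [/\ 0 < A, 0 < B, 0 < x1 &
  forall x, x1 <= x -> conc2 mu x <= A * (L x / x `^ alpha) /\
                       L x / x `^ alpha <= B * conc2 mu x].
Proof.
have [a2|an2] := eqVneq alpha 2.
  have [A [B [x1 [A0 B0 x10 H]]]] := conc2_tilde_ell_eq2 a2.
  exists A, B, x1; split => // x xx1; have [h1 h2] := H x xx1.
  have x0 : 0 < x by exact: lt_le_trans xx1.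
  have x2 : 0 < x ^+ 2 by rewrite exprn_gt0.
  have -> : x `^ alpha = x ^+ 2 by rewrite a2 powR_mulrn// ltW.
  split; first by rewrite mulrA ler_pdivlMr// mulrC.
  by rewrite ler_pdivrMr// -mulrA (mulrC (conc2 _ _)).
have a2 : alpha < 2 by rewrite lt_neqAle an2.
have [c1 [c2 [x1 [c10 c20 x10 H]]]] := tail_comparable.
have h4 : 4^-1 < 2 `^ (- alpha) :> R.
  rewrite (_ : 4^-1 = 2 `^ (- 2)); last by rewrite powR_invn// -natrX.
  by apply: pow2_lt; rewrite ltrN2.
pose s : R := (4^-1 + 2 `^ (- alpha)) / 2.
have s1 : 4^-1 < s by rewrite /s; lra.
have s2 : s < 2 `^ (- alpha) by rewrite /s; lra.
have [x2 x20 Hs] := tail_ratio_gt s2.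
have [A A0 HA] := conc2_le_tail s1 x20 tail_gt0 Hs.
exists (A / c1), c2, (x1 + x2); split => //; [exact: divr_gt0|exact: addr_gt0|].
move=> x xx.
have x0 : 0 < x by lra.
have -> : L x / x `^ alpha = ell x * x `^ (- alpha).
  by rewrite /tilde_ell (negbTE an2) powRN.
have [h1 h2] := H x (ltac:(lra)); have h3 := HA x (ltac:(lra)).
split.
  apply: (le_trans h3); rewrite -mulrA ler_pM2l// ler_pdivlMl//.
apply: (le_trans h2); rewrite ler_pM2l//; exact: tail_le_conc2.
Qed.

(** The shift by one makes the comparison uniform down to the origin. *)
Lemma conc2_le_tilde_ell : exists2 C : R, 0 < C &
  forall x, 0 <= x -> conc2 mu (1 + x) <= C * (L x / (1 + x `^ alpha)).
Proof.
have [A [B [x1 [A0 B0 x10 H]]]] := conc2_comparable.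
pose x2 := x1 + 1.
have x20 : 0 <= x2 by rewrite /x2; lra.
have [m m0 Hm] := tilde_ell_lower x20.
have D0 (x : R) : 0 < 1 + x `^ alpha by rewrite ltr_pwDl// powR_ge0.
pose C := (1 + x2 `^ alpha) / m + 2 * A.
have i0 : 0 < (1 + x2 `^ alpha) / m by rewrite divr_gt0.
exists C; first by rewrite /C; lra.
move=> x x0; have [xx2|x2x] := leP x x2.
  apply: (le_trans (conc2_le1 _ _)); rewrite mulrA ler_pdivlMr// mul1r.
  apply: (@le_trans _ _ (1 + x2 `^ alpha)).
    by rewrite lerD2l ge0_ler_powR ?nnegrE// ltW.
  apply: (@le_trans _ _ (C * m)).
    by rewrite /C mulrDl divfK ?gt_eqF// lerDl mulr_ge0 ?(ltW m0)//; lra.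
  by rewrite ler_pM2l ?Hm ?x0//; rewrite /C; lra.
have [h1 _] := H x (ltac:(rewrite /x2 in x2x; lra)).
have xp : 0 < x by lra.
have Lx := tilde_ell_gt0 x0.
apply: (@le_trans _ _ (conc2 mu x)); first by apply: conc2_le => //; lra.
apply: (le_trans h1); apply: (@le_trans _ _ (2 * A * (L x / (1 + x `^ alpha)))); last first.
  by rewrite ler_wpM2r ?divr_ge0 ?(ltW Lx) ?(ltW (D0 _))// /C; lra.
rewrite [X in _ <= X](_ : _ = A * (2 * (L x / (1 + x `^ alpha)))); last by ring.
rewrite ler_pM2l// mulrCA ler_pM2l//.
have pa : 1 <= x `^ alpha.
  rewrite -(powRr0 x) -[X in X <= _]/(x `^ 0) ler_powR//; [|exact: ltW].
  by rewrite /x2 in x2x; lra.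
have pp : 0 < x `^ alpha by lra.
by rewrite ler_pdivlMr// mulrC ler_pdivrMr//; lra.
Qed.

(** * The norming sequence *)

Variable a : nat -> R.
Hypothesis a_gt0 : forall n, (1 <= n)%N -> 0 < a n.
Hypothesis a_lim : n%:R * L (a n) / a n `^ alpha @[n --> \oo] --> (1 : R).

(** On bounded sets [tilde_ell] stays away from zero, so a bounded subsequence
    of [a] would make the normalised sequence unbounded. *)
Lemma norming_large (M : R) : 0 < M ->
  exists n0, forall n, (n0 <= n)%N -> (1 <= n)%N /\ M <= a n.
Proof.
move=> M0; have [m m0 Hm] := tilde_ell_lower (ltW M0).
have [N _ HN] := cvgr_le _ a_lim 2 (ltac:(lra)).
have PM : 0 < M `^ alpha by rewrite powR_gt0.
pose N1 := (Num.truncn (2 * M `^ alpha / m)).+1.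
exists (maxn N N1).+1 => n; rewrite gtn_max => /andP[Nn N1n].
have n1 : (1 <= n)%N by exact: leq_ltn_trans Nn.
split => //; rewrite leNgt; apply/negP => anM.
have an0 := a_gt0 n1.
have := HN n (ltnW Nn); rewrite /= ler_pdivrMr ?powR_gt0//.
apply/negP; rewrite -ltNge.
apply: (@le_lt_trans _ _ (2 * M `^ alpha)).
  by rewrite ler_pM2l// ge0_ler_powR ?nnegrE// ltW.
apply: (@lt_le_trans _ _ (n%:R * m)).
  rewrite -ltr_pdivrMr//; apply: (lt_trans (truncnS_gt _)).
  by rewrite ltr_nat.
by rewrite ler_pM2l ?ltr0n// Hm// (ltW an0) ltW.
Qed.

Lemma norming_lower : exists2 amin : R, 0 < amin &
  forall n, (1 <= n)%N -> amin <= a n.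
Proof.
have [n0 Hn] := norming_large ltr01.
apply: (@eventually_lower_bound _ a n0 a_gt0 1) => // n /Hn; by case.
Qed.

Lemma norming_conc2 : exists c0 C0 : R, [/\ 0 < c0, 0 < C0 &
  forall n, (1 <= n)%N -> c0 <= n%:R * conc2 mu (a n) <= C0].
Proof.
have [A [B [x1 [A0 B0 x10 H]]]] := conc2_comparable.
have [n0 Hn] := norming_large x10.
have [N1 _ HN1] := cvgr_le _ a_lim 2 (ltac:(lra)).
have [N2 _ HN2] := cvgr_ge _ a_lim 2^-1 (ltac:(lra)).
have upos n : (1 <= n)%N -> 0 < n%:R * conc2 mu (a n).
  by move=> n1; rewrite mulr_gt0 ?ltr0n// conc2_gt0 ?a_gt0// law_sq.
pose n3 := maxn n0 (maxn N1 N2).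
have b1 n : (n3 <= n)%N -> (2 * B)^-1 <= n%:R * conc2 mu (a n) /\
    (2 * A)^-1 <= (n%:R * conc2 mu (a n))^-1.
  rewrite !geq_max => /and3P[g0 g1 g2].
  have [n1 an] := Hn n g0; have [h1 h2] := H _ an.
  have h3 := HN1 n g1; have h4 := HN2 n g2; rewrite /= -mulrA in h3 h4.
  have nR : 0 < n%:R :> R by rewrite ltr0n.
  split.
    rewrite -(ler_pM2l nR) in h2; rewrite invfM ler_pdivrMr//; lra.
  rewrite lef_pV2 ?posrE; [|by rewrite mulr_gt0|exact: upos].
  rewrite -(ler_pM2l nR) in h1; apply: (le_trans h1); rewrite mulrCA.
  have : A * (n%:R * (L (a n) / a n `^ alpha)) <= A * 2 by rewrite ler_pM2l.
  by lra.
have iB : 0 < (2 * B)^-1 by rewrite invr_gt0 mulr_gt0.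
have iA : 0 < (2 * A)^-1 by rewrite invr_gt0 mulr_gt0.
have ipos n : (1 <= n)%N -> 0 < (n%:R * conc2 mu (a n))^-1.
  by move=> n1; rewrite invr_gt0 upos.
have [c0 c00 Hc] := eventually_lower_bound upos iB (fun n h => (b1 n h).1).
have [c1 c10 Hc1] := eventually_lower_bound ipos iA (fun n h => (b1 n h).2).
exists c0, c1^-1; split => //; first by rewrite invr_gt0.
move=> n n1; rewrite Hc//= -[X in X <= _]invrK lef_pV2 ?posrE ?invr_gt0 ?upos//.
exact: Hc1.
Qed.

(** * The bias of truncation *)

Definition step_centering (n : nat) : R :=
  if alpha < 1 then 0
  else if alpha == 1 then
    fine 'E_P[fun w => X w * \1_[set v | `|X v| <= a n] w]
  else fine 'E_P[X].

Lemma centeringE n : centering X alpha a n = n%:R * step_centering n.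
Proof.
by rewrite /centering /step_centering; case: ifP => _; [rewrite mulr0|case: ifP].
Qed.

Lemma tail_contracts : exists s x0 : R, [/\ 0 <= s, s < 1, 0 < x0 &
  forall x, x0 <= x -> tail mu (2 * x) <= s * tail mu x].
Proof.
have r1 : 2 `^ (- alpha) < 1 :> R.
  have an : - alpha < 0 by rewrite oppr_lt0.
  by have := pow2_lt an; rewrite powRr0.
have r0 : 0 <= 2 `^ (- alpha) :> R by exact: powR_ge0.
pose s : R := (1 + 2 `^ (- alpha)) / 2.
have rs : 2 `^ (- alpha) < s by rewrite /s; lra.
have [x0 x00 H] := tail_ratio_lt rs.
by exists s, x0; split => //; rewrite /s; lra.
Qed.

(** Starting from [n * conc2 (a n)], which is bounded, finitely many
    contractions reach any prescribed level. *)
Lemma conc2_small (e x0 : R) : 0 < e ->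
  exists2 K1 : R, 1 <= K1 & forall n x, (1 <= n)%N -> K1 * a n <= x ->
    x0 <= x /\ n%:R * conc2 mu x <= e.
Proof.
move=> e0; have [s [z [s0 s1 z0 Hs]]] := tail_contracts.
have [theta [y0 [t0 t1 y00 Hc]]] := conc2_contract s0 s1 z0 Hs.
have [amin am0 Ham] := norming_lower.
have [c0 [C0 [c00 C00 HC]]] := norming_conc2.
have [k tk] := contraction_power t0 t1 (divr_gt0 e0 C00).
pose M := 1 + y0 / amin + `|x0| / amin.
have p1 : 0 < y0 / amin by rewrite divr_gt0.
have p2 : 0 <= `|x0| / amin by rewrite divr_ge0// ltW.
have M1 : 1 <= M by rewrite /M; lra.
have M0 : 0 < M by lra.
have k1 : 1 <= 2 ^+ k :> R by rewrite exprn_ege1// ler1n.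
have k0 : 0 < 2 ^+ k :> R by lra.
exists (2 ^+ k * M); first by rewrite -[X in X <= _]mulr1 ler_pM.
move=> n x n1; rewrite -mulrA => kx.
have an := a_gt0 n1; have aa := Ham n n1.
have Ma : M * amin <= M * a n by rewrite ler_pM2l.
have Ma0 : 0 < M * a n by rewrite mulr_gt0.
have MaE : M * amin = amin + y0 + `|x0|.
  by rewrite /M !mulrDl mul1r !divfK// gt_eqF.
have kMa : M * a n <= 2 ^+ k * (M * a n) by rewrite ler_peMl// ltW.
have x0n := ler_norm x0; have x0p := normr_ge0 x0.
split; first by lra.
have h1 := conc2_iter t0 y00 Hc k (ltac:(lra) : y0 <= M * a n).
have h2 : conc2 mu (M * a n) <= conc2 mu (a n).
  by apply: conc2_le => //; rewrite ler_peMl// ltW.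
have h3 : conc2 mu x <= conc2 mu (2 ^+ k * (M * a n)).
  by apply: conc2_le => //; rewrite mulr_gt0.
have tk0 : 0 <= theta ^+ k by rewrite exprn_ge0.
have h4 : conc2 mu x <= theta ^+ k * conc2 mu (a n).
  by apply: (le_trans h3); apply: (le_trans h1); rewrite ler_wpM2l.
have /andP[_ h5] := HC n n1.
apply: (@le_trans _ _ (n%:R * (theta ^+ k * conc2 mu (a n)))).
  by rewrite ler_wpM2l.
rewrite mulrCA; apply: (@le_trans _ _ (e / C0 * C0)).
  by apply: ler_pM => //; rewrite mulr_ge0// conc2_ge0.
by rewrite divfK// gt_eqF.
Qed.

(** The truncated mean is at most of order [x * tail x], and [n * tail x] is
    small far from the bulk. *)
Lemma bias_lt1 : alpha < 1 -> exists2 K1 : R, 1 <= K1 &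
  forall n x, (1 <= n)%N -> K1 * a n <= x ->
    n%:R * `|trunc1 mu x - step_centering n| <= x / 6.
Proof.
move=> a1.
have h2 : 2^-1 < 2 `^ (- alpha) :> R.
  rewrite (_ : 2^-1 = 2 `^ (- 1)); last by rewrite powR_inv1.
  by apply: pow2_lt; rewrite ltrN2.
pose s : R := (2^-1 + 2 `^ (- alpha)) / 2.
have s1 : 2^-1 < s by rewrite /s; lra.
have s2 : s < 2 `^ (- alpha) by rewrite /s; lra.
have [x0 x00 Hs] := tail_ratio_gt s2.
have [A A0 HA] := shell1_slow s1 x00 tail_gt0 Hs.
have [K1 K11 HK] := @conc2_small (6 * A)^-1 x0 (ltac:(by rewrite invr_gt0 mulr_gt0)).
exists K1 => // n x n1 Kx; have [xx0 small] := HK n x n1 Kx.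
have xp : 0 < x by exact: lt_le_trans xx0.
rewrite /step_centering a1 subr0.
have h3 : `|trunc1 mu x| <= shell1 mu (-1) x.
  apply: normr_Ex_le => [||u]; [exact: bmeas_id_inside|exact: bmeas_shell|].
  have /andP[e0 e1] := exceeds01 x u.
  rewrite normrM (ger0_norm (_ : 0 <= 1 - _)) ?subr_ge0//.
  rewrite [X in _ <= _ * X * _](_ : _ = 1) ?mulr1// /exceeds opprK.
  by rewrite ifT//; have [//|h] := ltP (-1) u; rewrite /=; lra.
have h4 := HA (-1) x xx0.
have h5 : n%:R * `|trunc1 mu x| <= n%:R * (A * (x * conc2 mu x)).
  rewrite ler_wpM2l//; apply: (le_trans h3); apply: (le_trans h4).
  by rewrite ler_pM2l// ler_pM2l// tail_le_conc2.
apply: (le_trans h5).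
have -> : n%:R * (A * (x * conc2 mu x)) = (A * x) * (n%:R * conc2 mu x) by ring.
apply: (@le_trans _ _ (A * x * (6 * A)^-1)); first by rewrite ler_pM2l// mulr_gt0.
by rewrite le_eqVlt; apply/orP; left; apply/eqP; field; rewrite gt_eqF.
Qed.

Lemma measurable_norm_le (c : R) : measurable [set v : R | `|v| <= c].
Proof.
rewrite (_ : [set v | _] = [set` `[- c, c]]); first exact: measurable_itv.
by apply/seteqP; split => u /=; rewrite in_itv/= ler_norml.
Qed.

(** The two truncated means differ by the shell between [a n] and [x]. Its part
    below [M * a n] contributes a multiple of [a n] only; on the rest
    [shell1_critical] applies, and the geometric mean of the tails at [x] and
    [M * a n] is small relative to [1 / n]. *)
Lemma bias_eq1 : alpha = 1 -> exists2 K1 : R, 1 <= K1 &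
  forall n x, (1 <= n)%N -> K1 * a n <= x ->
    n%:R * `|trunc1 mu x - step_centering n| <= x / 6.
Proof.
move=> a1.
have h2 : 3^-1 < 2 `^ (- alpha) :> R.
  by rewrite a1 powR_inv1// ltf_pV2 ?posrE//; lra.
have s1 : 4^-1 < 3^-1 :> R by rewrite ltf_pV2 ?posrE//; lra.
have [x0 x00 Hs] := tail_ratio_gt h2.
have [A A0 HA] := shell1_critical s1 x00 tail_gt0 Hs.
have [c0 [C0 [c00 C00 HC]]] := norming_conc2.
have [amin am0 Ham] := norming_lower.
pose M := 1 + x0 / amin.
have p1 : 0 < x0 / amin by rewrite divr_gt0.
have M0 : 0 < M by rewrite /M; lra.
pose e := (12 * A) ^- 2 / C0.
have e0 : 0 < e by rewrite divr_gt0// invr_gt0 exprn_gt0// mulr_gt0.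
have [K1 K11 HK] := @conc2_small e x0 e0.
pose K2 := K1 + M + 12 * M * C0 + 1.
have q1 : 0 < 12 * M * C0 by rewrite !mulr_gt0.
exists K2; first by rewrite /K2; lra.
move=> n x n1 Kx.
have an := a_gt0 n1; have aa := Ham n n1.
have nR : 0 < n%:R :> R by rewrite ltr0n.
have Kx' : K1 * a n + M * a n + 12 * M * C0 * a n + a n <= x.
  by move: Kx; rewrite /K2 !mulrDl mul1r.
have q2 : 0 < K1 * a n by rewrite mulr_gt0//; lra.
have q3 : 0 < M * a n by rewrite mulr_gt0.
have q4 : 0 < 12 * M * C0 * a n by rewrite mulr_gt0.
have [xx0 small] := HK n x n1 (ltac:(lra)).
have xp : 0 < x by exact: lt_le_trans xx0.
have aMa : a n <= M * a n by rewrite ler_peMl ?(ltW an)// /M; lra.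
have MaE : x0 <= M * a n.
  have -> : M * a n = a n + x0 / amin * a n by rewrite /M mulrDl mul1r.
  have : x0 / amin * amin <= x0 / amin * a n by rewrite ler_pM2l.
  by rewrite divfK ?gt_eqF//; lra.
have ax : a n < x by lra.
have bin : bounded_measurable (fun u : R => u * \1_[set v | `|v| <= a n] u).
  have mS := measurable_norm_le (a n).
  split; first by apply: measurable_funM => //; exact: measurable_indic.
  exists (a n) => u; rewrite indicE; case: (boolP (u \in _)) => [|_].
    by rewrite inE/= mulr1.
  by rewrite mulr0 normr0 ltW.
have cE : step_centering n = Ex mu (fun u => u * \1_[set v | `|v| <= a n] u).
  by rewrite /step_centering a1 ltxx eqxx -(Ex_law X bin) unlock.
have h3 : `|trunc1 mu x - step_centering n| <= shell1 mu (a n) x.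
  rewrite cE /trunc1 -Ex_sub//; last exact: bmeas_id_inside.
  apply: normr_Ex_le => [||u].
  - by apply: bmeas_sub => //; exact: bmeas_id_inside.
  - exact: bmeas_shell.
  rewrite indicE; case: (boolP (u \in _)) => [|].
    rewrite inE/= => ua.
    have [[-> xu]|[-> xu]] := exceedsP x u; first by lra.
    rewrite subr0 !mulr1 subrr normr0; apply: mulr_ge0 => //.
    by case/andP: (exceeds01 (a n) u).
  rewrite notin_setE/= => /negP; rewrite -ltNge => ua.
  have [[-> _]|[_ h]] := exceedsP (a n) u; last by lra.
  rewrite mulr0 subr0 mulr1; have /andP[g0 g1] := exceeds01 x u.
  by rewrite normrM (ger0_norm (_ : 0 <= 1 - _)) ?subr_ge0.
have h4 : shell1 mu (a n) x = shell1 mu (a n) (M * a n) + shell1 mu (M * a n) x.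
  by apply: shell1_cat => //; lra.
have /andP[_ HCn] := HC n n1.
have ta : n%:R * tail mu (a n) <= C0.
  by apply: le_trans HCn; rewrite ler_pM2l// tail_le_conc2.
have h5 : n%:R * shell1 mu (a n) (M * a n) <= M * a n * C0.
  apply: (@le_trans _ _ (n%:R * (M * a n * tail mu (a n)))).
    by rewrite ler_pM2l// shell1_le_tail// ltW.
  by rewrite mulrCA ler_pM2l.
have h6 : n%:R * shell1 mu (M * a n) x <= x / 12.
  have Max : M * a n <= x by lra.
  apply: (@le_trans _ _ (n%:R * (A * (x * Num.sqrt (tail mu x * tail mu (M * a n)))))).
    by rewrite ler_pM2l// HA.
  have sq : Num.sqrt (tail mu x * tail mu (M * a n)) <= (12 * A * n%:R)^-1.
    have i0 : 0 <= (12 * A * n%:R)^-1 by rewrite invr_ge0 !mulr_ge0// ltW.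
    rewrite -[X in _ <= X](ger0_norm i0) -sqrtr_sqr; apply: ler_wsqrtr.
    have t1 : n%:R * tail mu x <= e.
      by apply: le_trans small; rewrite ler_pM2l// tail_le_conc2.
    have t2 : n%:R * tail mu (M * a n) <= C0.
      by apply: le_trans ta; rewrite ler_pM2l// tail_le.
    have t3 : (n%:R * tail mu x) * (n%:R * tail mu (M * a n)) <= e * C0.
      by apply: ler_pM => //; rewrite mulr_ge0// tail_ge0.
    have t4 : e * C0 = (12 * A) ^- 2 by rewrite /e divfK// gt_eqF.
    rewrite exprVn exprMn invfM -t4 ler_pdivlMr ?exprn_gt0//.
    by apply: le_trans t3; rewrite le_eqVlt; apply/orP; left; apply/eqP; ring.
  have : n%:R * (A * (x * Num.sqrt (tail mu x * tail mu (M * a n))))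
     <= n%:R * (A * (x * (12 * A * n%:R)^-1)) by rewrite !ler_pM2l.
  move=> h; apply: (le_trans h); rewrite le_eqVlt; apply/orP; left; apply/eqP.
  by field; rewrite !gt_eqF.
have : n%:R * `|trunc1 mu x - step_centering n| <= n%:R * shell1 mu (a n) x.
  by rewrite ler_pM2l.
rewrite h4 mulrDr; lra.
Qed.

(** The full mean differs from the truncated one by the first moment outside
    the window. *)
Lemma bias_gt1 : 1 < alpha -> exists2 K1 : R, 1 <= K1 &
  forall n x, (1 <= n)%N -> K1 * a n <= x ->
    n%:R * `|trunc1 mu x - step_centering n| <= x / 6.
Proof.
move=> a1.
have h2 : 2 `^ (- alpha) < 2^-1 :> R.
  rewrite (_ : 2^-1 = 2 `^ (- 1)); last by rewrite powR_inv1.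
  by apply: pow2_lt; rewrite ltrN2.
have r0 : 0 <= 2 `^ (- alpha) :> R by exact: powR_ge0.
pose s : R := (2^-1 + 2 `^ (- alpha)) / 2.
have s1 : s < 2^-1 by rewrite /s; lra.
have s2 : 2 `^ (- alpha) < s by rewrite /s; lra.
have s0 : 0 <= s by rewrite /s; lra.
have [x0 x00 Hs] := tail_ratio_lt s2.
have [A A0 HA] := shell1_fast s0 s1 x00 Hs.
have fast x : x0 <= x ->
    (\int[mu]_u (`|u| * exceeds x u)%:E <= (A * (x * tail mu x))%:E)%E.
  move=> xx0; have xp : 0 < x by exact: lt_le_trans xx0.
  apply: integral_le_trunc.
  - by apply: measurable_funM; [exact: normr_measurable|exact: measurable_exceeds].
  - by move=> u; rewrite mulr_ge0//; case/andP: (exceeds01 x u).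
  move=> n; exists (2 ^+ (Num.truncn (n%:R / x)).+1 * x); last first.
    by split; [exact: bmeas_shell|exact: HA].
  rewrite -ler_pdivrMr// (le_trans (ltW (truncnS_gt _)))//.
  by rewrite -natrX ler_nat ltnW// ltn_expl.
have ix x : x0 <= x -> mu.-integrable setT (EFin \o (fun u => u * exceeds x u)).
  move=> xx0; apply/integrableP; split.
    apply/measurable_EFinP; apply: measurable_funM => //; exact: measurable_exceeds.
  apply: (@le_lt_trans _ _ (A * (x * tail mu x))%:E); last by rewrite ltry.
  apply: le_trans (fast x xx0); apply: ge0_le_integral => //.
  - apply: measurableT_comp => //; apply/measurable_EFinP.
    by apply: measurable_funM => //; exact: measurable_exceeds.
  - apply/measurable_EFinP; apply: measurable_funM; [exact: normr_measurable|exact: measurable_exceeds].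
  - move=> u _; rewrite lee_fin normrM.
    by have /andP[g0 g1] := exceeds01 x u; rewrite (ger0_norm g0).
have [K1 K11 HK] := @conc2_small (6 * A)^-1 x0 (ltac:(by rewrite invr_gt0 mulr_gt0)).
exists K1 => // n x n1 Kx; have [xx0 small] := HK n x n1 Kx.
have xp : 0 < x by exact: lt_le_trans xx0.
have iin : mu.-integrable setT (EFin \o (fun u => u * (1 - exceeds x u))).
  exact: (bmeas_integrable mu (bmeas_id_inside x)).
have iid : mu.-integrable setT (EFin : R -> \bar R).
  apply: (eq_integrable _ _ _ _ (integrableD measurableT iin (ix x xx0))) => // u _.
  by rewrite /= -EFinD; congr EFin; ring.
have cE : step_centering n = trunc1 mu x + \int[mu]_u (u * exceeds x u).
  have -> : step_centering n = \int[mu]_u u.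
    rewrite /step_centering ltNge (ltW a1)/= gt_eqF// unlock; congr fine.
    rewrite -[LHS](@integral_distribution _ _ _ _ _ P X EFin)//.
    apply/integrableP; split; first by apply/measurable_EFinP; exact: measurable_funPT.
    rewrite -(@ge0_integral_distribution _ _ _ _ _ P X (abse \o EFin))//.
    - by case/integrableP : iid.
    - exact: measurableT_comp.
    - by move=> u; exact: abse_ge0.
  apply: etrans (RintegralD measurableT iin (ix x xx0)).
  by apply: eq_Rintegral => u _; ring.
have h3 : `|trunc1 mu x - step_centering n| <= A * (x * tail mu x).
  rewrite cE opprD addrA subrr add0r normrN.
  rewrite -lee_fin EFin_normr_Rintegral//; last exact: ix.
  apply: (@le_trans _ _ (\int[mu]_u `|(u * exceeds x u)%:E|)%E).
    by apply: le_abse_integral => //; case/integrableP : (ix x xx0).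
  apply: le_trans (fast x xx0).
  rewrite le_eqVlt; apply/orP; left; apply/eqP; apply: eq_integral => u _.
  rewrite /= normrM; have /andP[g0 _] := exceeds01 x u.
  by rewrite (ger0_norm g0).
have h5 : n%:R * `|trunc1 mu x - step_centering n| <= n%:R * (A * (x * conc2 mu x)).
  rewrite ler_wpM2l//; apply: (le_trans h3).
  by rewrite ler_pM2l// ler_pM2l// tail_le_conc2.
apply: (le_trans h5).
have -> : n%:R * (A * (x * conc2 mu x)) = (A * x) * (n%:R * conc2 mu x) by ring.
apply: (@le_trans _ _ (A * x * (6 * A)^-1)); first by rewrite ler_pM2l// mulr_gt0.
by rewrite le_eqVlt; apply/orP; left; apply/eqP; field; rewrite gt_eqF.
Qed.

Lemma bias_bound : exists2 K1 : R, 1 <= K1 &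
  forall n x, (1 <= n)%N -> K1 * a n <= x ->
    n%:R * `|trunc1 mu x - step_centering n| <= x / 6.
Proof.
by case: (ltgtP alpha 1) => [/bias_lt1|/bias_gt1|/bias_eq1].
Qed.

End RegularVariation.

(** * The local large deviation estimate *)

Lemma half_bounds (n : nat) :
  [/\ (n./2 <= n)%N, (n <= (2 * n./2).+1)%N & (n <= (2 * (n - n./2)).+1)%N].
Proof. by split; lia. Qed.

Lemma double_succ_le (n k : nat) : (0 < k)%N -> (n <= (2 * k).+1)%N ->
  (n <= 3 * k)%N.
Proof. by lia. Qed.

Section LocalLargeDeviation.
Context d (T : measurableType d) (R : realType) (P : probability T R).
Variables (X : {RV P >-> R}) (Xs : nat -> {RV P >-> R}).
Hypothesis copies : independent_copies X Xs.
Let mu : probability R R := distribution P X.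
Variables (a b : nat -> R) (h c0 amin K1 C1 : R).
Hypotheses (h_gt0 : 0 < h) (amin_gt0 : 0 < amin).
Hypothesis C1_gt0 : 0 < C1.
Hypothesis a_ge : forall n, (1 <= n)%N -> amin <= a n.
Hypothesis a_conc2 : forall n, (1 <= n)%N -> c0 <= n%:R * conc2 mu (a n).
Hypothesis bias : forall n x, (1 <= n)%N -> K1 * a n <= x ->
  n%:R * `|trunc1 mu x - b n| <= x / 6.
Hypothesis local : forall (r : R) (k m : nat) (y : R), 0 < r ->
  c0 / 3 <= k%:R * conc2 mu r ->
  fine (P [set w | `|walk Xs m k w - y| <= h]) <= C1 / r.

(** A block of half the length still has the local bound of the whole walk. The
    summand [a 1] covers the empty half of a walk of length one. *)
Lemma local_bound_blocks n m k y : (1 <= n)%N -> (n <= (2 * k).+1)%N ->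
  fine (P [set w | `|walk Xs m k w - y| <= h]) <= (C1 + a 1) / a n.
Proof.
move=> n1 nk.
have an : 0 < a n by apply: (lt_le_trans amin_gt0); exact: a_ge.
have a1 : 0 < a 1 by apply: (lt_le_trans amin_gt0); exact: a_ge.
have [k0|kpos] := posnP k.
  have -> : n = 1%N by apply/eqP; rewrite eqn_leq n1 andbT; move: nk; rewrite k0.
  apply: (@le_trans _ _ 1); first by apply: prob_fine_le1; exact: measurable_dist_le.
  by rewrite ler_pdivlMr// mul1r lerDr ltW.
apply: (@le_trans _ _ (C1 / a n)); last by rewrite ler_pM2r ?invr_gt0// lerDl ltW.
apply: local => //.
have h1 := a_conc2 n1; have Kn := conc2_ge0 mu (a n).
have n3k : n%:R <= 3 * k%:R :> R by rewrite -natrM ler_nat double_succ_le.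
have : n%:R * conc2 mu (a n) <= 3 * k%:R * conc2 mu (a n) by rewrite ler_wpM2r.
by lra.
Qed.

(** Away from the bulk one half of the walk must deviate, at a cost given by
    Chebyshev's inequality, while the other half contributes the local
    bound. *)
Lemma far_bound n (x : R) : (1 <= n)%N -> K1 * a n <= `|x| -> 3 * h <= `|x| ->
  fine (P [set w | `|walk Xs 0 n w - (n%:R * b n + x)| <= h])
  <= (C1 + a 1) / a n * (37 * n%:R * conc2 mu `|x|).
Proof.
move=> n1; set r : R := `|x|; move=> Kx hx.
have an : 0 < a n by apply: (lt_le_trans amin_gt0); exact: a_ge.
have a1 : 0 < a 1 by apply: (lt_le_trans amin_gt0); exact: a_ge.
have hpos := h_gt0; have x0 : 0 < r by lra.
pose k := n./2; pose l := (n - k)%N.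
have [kn nk nl] := half_bounds n; rewrite -/k -/l in kn nk nl.
have nE : n = (k + l)%N by rewrite /l subnKC.
have nb := bias n1 Kx.
have sub j : (j <= n)%N -> j%:R * `|trunc1 mu r - b n| <= r / 6.
  by move=> jn; apply: le_trans nb; rewrite ler_wpM2r// ler_nat.
have dk := deviation_bound copies 0 x0 (sub k kn).
have dl := deviation_bound copies k x0 (sub l (leq_subr _ _)).
have q0 : 0 < (C1 + a 1) / a n by rewrite divr_gt0// addr_gt0.
have := @halves_bound _ _ _ _ X Xs copies k l r (n%:R * b n + x) (b n) h
  ((C1 + a 1) / a n).
rewrite -nE => H; apply: (le_trans (H _ _ _)).
- by rewrite (_ : n%:R * b n + x - n%:R * b n = x); [rewrite -/r; lra|ring].
- by move=> z; exact: local_bound_blocks.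
- by move=> z; exact: local_bound_blocks.
rewrite ler_pM2l//; apply: (le_trans (lerD dk dl)).
rewrite -mulrDl -mulrDr -natrD -nE//.
Qed.

End LocalLargeDeviation.

Theorem theorem1p1 (R : realType) (d : measure_display) (T : measurableType d)
    (P : probability T R) (X : {RV P >-> R}) (Xs : nat -> {RV P >-> R})
    (alpha p q : R) (ell : R -> R) (a : nat -> R)
    (alpha_gt0 : 0 < alpha) (alpha_le2 : alpha <= 2)
    (X_sq : ('E_P[fun w => (X w ^+ 2)%R] = +oo)%E)
    (ell_gt0 : forall x : R, 0 <= x -> 0 < ell x)
    (ell_cont : {within `[0, +oo[, continuous ell})
    (ell_sv : slowly_varying ell)
    (p_ge0 : 0 <= p) (q_ge0 : 0 <= q) (pq_gt0 : 0 < p + q)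
    (right_tail : asymp_cst (fun x => fine (P [set w | x < X w])) p
                            (fun x => ell x * x `^ (- alpha)))
    (left_tail : asymp_cst (fun x => fine (P [set w | X w <= - x])) q
                           (fun x => ell x * x `^ (- alpha)))
    (copies : independent_copies X Xs)
    (a_gt0 : forall n, (1 <= n)%N -> 0 < a n)
    (a_lim : n%:R * tilde_ell alpha ell (a n) / a n `^ alpha
               @[n --> \oo] --> (1 : R)) :
  (forall h : R, 0 < h ->
     exists2 C : R, 0 < C &
       forall (n : nat) (x : R), (1 <= n)%N ->
         (P [set w | (x - h < partial_sum Xs n w - centering X alpha a n
                        <= x + h)%R]
          <= (C * (n%:R / a n) *
              (tilde_ell alpha ell `|x| / (1 + `|x| `^ alpha)))%:E)%E)
  /\
  (P [set w | X w \is a Num.int] = 1%E ->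
     exists2 C : R, 0 < C &
       forall (n : nat) (N : int), (1 <= n)%N ->
         (P [set w | (partial_sum Xs n w
                        - (Num.floor (centering X alpha a n))%:~R
                      = N%:~R :> R)%R]
          <= (C * (n%:R / a n) *
              (tilde_ell alpha ell `|N%:~R|
                / (1 + `|N%:~R| `^ alpha)))%:E)%E).
Proof.
have main : forall h : R, 0 < h ->
     exists2 C : R, 0 < C &
       forall (n : nat) (x : R), (1 <= n)%N ->
         (P [set w | (x - h < partial_sum Xs n w - centering X alpha a n
                        <= x + h)%R]
          <= (C * (n%:R / a n) *
              (tilde_ell alpha ell `|x| / (1 + `|x| `^ alpha)))%:E)%E.
  move=> h h0.
  pose mu : probability R R := distribution P X.
  have Hoo := law_sq X_sq.
  have [s [z [s0 s1 z0 Hs]]] := tail_contracts alpha_gt0 ell_gt0 ell_sv pq_gt0 right_tail left_tail.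
  have [c [y1 [cpos y1pos Hgap]]] := char2_gap copies s0 s1 z0 Hs Hoo.
  have [theta [y0 [t0 t1 y0pos Hcon]]] := conc2_contract s0 s1 z0 Hs.
  have Kpos x : 0 < x -> 0 < conc2 mu x by exact: conc2_gt0.
  have [c0 [C0 [c00 C00 HC]]] := norming_conc2 alpha_gt0 alpha_le2 X_sq ell_gt0 ell_cont
    ell_sv pq_gt0 right_tail left_tail a_gt0 a_lim.
  have [amin am0 Ham] := norming_lower alpha_gt0 ell_gt0 ell_cont a_gt0 a_lim.
  have [K1 K11 Hbias] := bias_bound alpha_gt0 alpha_le2 X_sq ell_gt0 ell_cont
    ell_sv pq_gt0 right_tail left_tail a_gt0 a_lim.
  have [C2 C20 Htil] := conc2_le_tilde_ell alpha_gt0 alpha_le2 X_sq ell_gt0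
    ell_cont ell_sv pq_gt0 right_tail left_tail.
  have c03 : 0 < c0 / 3 by rewrite divr_gt0.
  have [C1 C10 Hloc] := local_bound copies cpos y1pos Hgap t0 t1 y0pos Hcon
    Kpos h0 c03.
  have HC' n : (1 <= n)%N -> c0 <= n%:R * conc2 mu (a n).
    by move=> n1; have /andP[] := HC n n1.
  pose D := C1 + a 1.
  have D0 : 0 < D by rewrite addr_gt0// a_gt0.
  pose K2 := K1 + (3 * h + 1) / amin.
  have p1 : 0 < (3 * h + 1) / amin by rewrite divr_gt0//; lra.
  pose K3 := 1 + amin^-1 + K2.
  have p2 : 0 < amin^-1 by rewrite invr_gt0.
  have K31 : 1 <= K3 by rewrite /K3 /K2; lra.
  have n3 : 0 < K3 ^+ 2 by rewrite exprn_gt0//; lra.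
  pose C := D * (K3 ^+ 2 * C2 / c0) + D * (4 * 37 * C2).
  have q1 : 0 < D * (K3 ^+ 2 * C2 / c0) by rewrite mulr_gt0// divr_gt0// mulr_gt0.
  have q2 : 0 < D * (4 * 37 * C2) by rewrite !mulr_gt0.
  have CC1 : D * (K3 ^+ 2 * C2 / c0) <= C by apply: ler_wpDr => //; exact: ltW.
  have CC2 : D * (4 * 37 * C2) <= C by apply: ler_wpDl => //; exact: ltW.
  exists C; first exact: lt_le_trans CC1.
  move=> n x n1.
  have an := a_gt0 n n1; have aa := Ham n n1.
  have nR : 0 < n%:R :> R by rewrite ltr0n.
  pose y := centering X alpha a n + x.
  have mE : measurable [set w | `|walk Xs 0 n w - y| <= h].
    exact: measurable_dist_le.
  apply: (@le_trans _ _ (P [set w | `|walk Xs 0 n w - y| <= h])).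
    apply: le_measure; rewrite ?inE//.
      rewrite (_ : [set w | _] = walk Xs 0 n @^-1`
          [set` `](centering X alpha a n + (x - h)), (centering X alpha a n + (x + h))]]).
        by apply: (@measurable_preimage _ _ _ P (walk Xs 0 n)); exact: measurable_itv.
      apply/seteqP; split => w /=; rewrite in_itv/= ltrBrDl lerBlDl//.
    move=> w /= /andP[w1 w2]; rewrite ler_distl /y -/(partial_sum Xs n w).
    by apply/andP; split; rewrite /walk; rewrite /partial_sum in w1 w2; lra.
  rewrite -[X in (X <= _)%E]fineK ?fin_num_measure// lee_fin.
  have [r rE] : exists r : R, r = `|x| by exists `|x|.
  rewrite -rE; have r0 : 0 <= r by rewrite rE normr_ge0.
  set W := tilde_ell alpha ell r / _.
  have W0 : conc2 mu (1 + r) <= C2 * W by exact: Htil.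
  have Wpos : 0 < W by rewrite -(pmulr_rgt0 _ C20); apply: lt_le_trans W0; apply: Kpos; lra.
  have na : 0 < n%:R / a n by rewrite divr_gt0.
  (* In the bulk the right-hand side is of order [1 / a n], as [n * conc2] is
     bounded below there. *)
  have [rn|rf] := ltP r (K2 * a n).
    apply: (@le_trans _ _ (D / a n)).
      apply: (@local_bound_blocks _ _ _ _ X Xs a h c0 amin C1) => //.
      by rewrite ltnW// ltnS leq_pmull.
    have e1 : conc2 mu (a n) <= K3 ^+ 2 * (C2 * W).
      apply: (le_trans (conc2_scale mu K31 an)); rewrite ler_pM2l//.
      apply: le_trans W0; apply: conc2_le; first by lra.
      have -> : K3 * a n = (a n + amin^-1 * a n) + K2 * a n by rewrite /K3; ring.
      apply: lerD; last exact: ltW.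
      by rewrite ler_wpDl ?(ltW an)// mulrC ler_pdivlMr// mul1r.
    have e2 : c0 <= n%:R * (K3 ^+ 2 * (C2 * W)).
      by apply: (le_trans (HC' n n1)); rewrite ler_pM2l.
    have e3 : 1 <= n%:R * (K3 ^+ 2 * (C2 * W)) / c0 by rewrite ler_pdivlMr// mul1r.
    apply: (@le_trans _ _ (D / a n * (n%:R * (K3 ^+ 2 * (C2 * W)) / c0))).
      by rewrite ler_peMr// ltW// divr_gt0.
    have -> : D / a n * (n%:R * (K3 ^+ 2 * (C2 * W)) / c0)
       = D * (K3 ^+ 2 * C2 / c0) * ((n%:R / a n) * W).
      by field; rewrite !gt_eqF.
    by rewrite -[X in _ <= X]mulrA ler_pM2r// mulr_gt0.
  have rr : K1 * a n + (3 * h + 1) <= r.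
    apply: le_trans rf; rewrite /K2 [X in _ <= X]mulrDl lerD2l.
    have : (3 * h + 1) / amin * amin <= (3 * h + 1) / amin * a n by rewrite ler_pM2l.
    by rewrite divfK// gt_eqF.
  have Ka : 0 < K1 * a n by rewrite mulr_gt0//; lra.
  rewrite /y centeringE.
  have := @far_bound _ _ _ _ X Xs copies a (step_centering X alpha a)
    h c0 amin K1 C1 h0 am0 C10 Ham HC' Hbias Hloc n x n1.
  have [r1 r2 r3 rpos] : [/\ K1 * a n <= r, 3 * h <= r, 1 <= r & 0 < r].
    by clear - rr Ka h0; split; lra.
  rewrite -rE => /(_ r1 r2) far; apply: (le_trans far).
  have two : (1 : R) <= 2 by rewrite ler1n.
  have e1 : conc2 mu r <= 4 * (C2 * W).
    apply: (le_trans (conc2_scale mu two rpos)).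
    rewrite (_ : 2 ^+ 2 = 4 :> R); last by ring.
    rewrite ler_pM2l//; apply: le_trans W0; apply: conc2_le; clear - r0 r3; lra.
  have -> : D / a n * (37 * n%:R * conc2 mu r)
     = D * 37 * (n%:R / a n) * conc2 mu r by field; rewrite gt_eqF.
  apply: (@le_trans _ _ (D * 37 * (n%:R / a n) * (4 * (C2 * W)))).
    by rewrite ler_pM2l//; apply: mulr_gt0 => //; apply: mulr_gt0.
  rewrite [X in X <= _](_ : _ = D * (4 * 37 * C2) * ((n%:R / a n) * W)); last by ring.
  by rewrite -[X in _ <= X]mulrA ler_pM2r// mulr_gt0.
split => //.
(* The integer part moves the centre by less than one. *)
move=> _; have [C C0 HC] := main 1 ltr01; exists C => // n N n1.
apply: le_trans (HC n N%:~R n1).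
set c := centering X alpha a n.
have mS : measurable_fun setT (partial_sum Xs n) by exact: (measurable_walk Xs 0 n).
apply: le_measure; rewrite ?inE//.
- rewrite (_ : [set w | _] = walk Xs 0 n @^-1` [set (N%:~R + (Num.floor c)%:~R)]).
    by apply: (@measurable_preimage _ _ _ P (walk Xs 0 n)); exact: measurable_set1.
  apply/seteqP; split => w /= h; first by rewrite -h; rewrite /walk /partial_sum subrK.
  by rewrite /partial_sum; rewrite /walk in h; rewrite h addrK.
- rewrite (_ : [set w | _] = walk Xs 0 n @^-1`
      [set` `](c + (N%:~R - 1)), (c + (N%:~R + 1))]]).
    by apply: (@measurable_preimage _ _ _ P (walk Xs 0 n)); exact: measurable_itv.
  by apply/seteqP; split => w /=; rewrite in_itv/= ltrBrDl lerBlDl.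
move=> w /= h; have /andP[f1 f2] := floor_itv c.
by rewrite intrD in f2; apply/andP; split; lra.
Qed.
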